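(* Let $\mathcal{C}$ be a family of curves in $\mathbb{D}^2\cup\partial\mathbb{D}^2$ satisfying (C1), (C2) and (C3), let $P\subset\mathbb{D}^2$ be a convex polygon (with respect to $\mathcal{C}$), and let $d$ be the metric on $P$ constructed from a set $\Theta=\{\theta_i\}_{i\in\mathbb{N}}$ and weights $(w_i)_{i\in\mathbb{N}}$ as described in the context. Let $x\in P$, let $v$ be a point of the boundary of $P$, let $[x,v]$ be the unique segment obtained from $\mathcal{C}$, and $[x,v)=[x,v]\setminus\{v\}$. Then for any sequence $\{y_n\}\subset[x,v)$ converging to $v$ in the Euclidean sense, $$d(x,y_n)\to\infty\quad\text{as } n\to\infty.$$ In particular, $[x,v)$ is the image of a geodesic ray, i.e. of an isometric map $r_v:[0,\infty)\to (P,d)$, and $(P,d)$ is a geodesically complete metric space.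
   Context: $\mathbb{D}^2$ is the open unit disk in $\mathbb{R}^2$ and $\partial\mathbb{D}^2$ its boundary circle. $\mathcal{C}$ is a family of continuous injective maps $I\to\mathbb{D}^2\cup\partial\mathbb{D}^2$, $I$ a closed interval of $\mathbb{R}$, with the endpoints of $I$ mapped into $\partial\mathbb{D}^2$ and the interior of $I$ mapped into $\mathbb{D}^2$; curves are identified with their images. Properties: (C1) for any two distinct points $x,y\in\mathbb{D}^2$ there is a unique curve $c_{xy}\in\mathcal{C}$ containing both; the part of $c_{xy}$ between $x$ and $y$ is the segment $[x,y]$. (C2) for any two distinct $\xi,\eta\in\partial\mathbb{D}^2$ there is a unique curve in $\mathcal{C}$ with endpoints $\xi,\eta$, called the line $(\xi,\eta)$. (C3) for any $x\in\mathbb{D}^2$, $\xi\in\partial\mathbb{D}^2$ there is a unique curve $c_{x\xi}\in\mathcal{C}$ containing $x$ and having $\xi$ as one endpoint. A set $X\subset\mathbb{D}^2$ is convex if $[x,y]\subset X$ for all $x,y\in X$. A convex polygon is a nonempty open convex subset $P\subset\mathbb{D}^2$ whose boundary $\partial P$ (in $\mathbb{R}^2$) is a finite union of segments (the sides of $P$). Projections: for $x\in\mathbb{D}^2$, $\theta\in\partial\mathbb{D}^2$, $x_\theta\in\partial\mathbb{D}^2$ denotes the endpoint of $c_{x\theta}$ other than $\theta$. For each $\theta\in\partial\mathbb{D}^2$ there are unique points $\xi_\theta=g_1(\theta)$, $\eta_\theta=g_2(\theta)$ in $\partial\mathbb{D}^2$ such that the region bounded by the lines $(\theta,\xi_\theta)$,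 $(\theta,\eta_\theta)$ and the arc of $\partial\mathbb{D}^2$ from $\xi_\theta$ to $\eta_\theta$ not containing $\theta$ contains $P$ and is minimal with this property; they are labelled so that $\theta,\eta_\theta,\xi_\theta$ are in clockwise cyclic order. Pseudo-metrics: for points $a,b$ in the arc between $\eta_\theta$ and $\xi_\theta$ not containing $\theta$, $|ab|$ is the Euclidean length of the subarc between $a$ and $b$ not containing $\theta$. For $x,y\in P$, named so that the clockwise order is $\eta_\theta,y_\theta,x_\theta,\xi_\theta$ (with $x_\theta=y_\theta$ allowed), $$d_\theta(x,y):=\log\frac{|\eta_\theta x_\theta|\,|\xi_\theta y_\theta|}{|\eta_\theta y_\theta|\,|\xi_\theta x_\theta|}.$$ Metric: $\Theta=\{\theta_i\mid i\in\mathbb{N}\}$ is a countable dense subset of $\partial\mathbb{D}^2$ such that for each side $[v,w]$ of $P$ both endpoints of $c_{vw}$ belong to $\Theta$; $w_i>0$ are reals with $\sum_i w_i<\infty$; and $d(x,y):=\sum_{i=1}^\infty w_i\,d_{\theta_i}(x,y)$ for $x,y\in P$ (the series converges and $d$ is a metric). $(P,d)$ is geodesically complete if every geodesic segment (isometric image of a compact interval) extends to a geodesic line (image of an isometric map $\mathbb{R}\to P$). *)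

(* Defs.v *)
From HB Require Import structures.
From mathcomp Require Import all_boot all_order all_algebra.
From mathcomp Require Import all_classical all_reals all_analysis.

Set Implicit Arguments.
Unset Strict Implicit.
Unset Printing Implicit Defensive.

Import Order.TTheory GRing.Theory Num.Theory.
Import numFieldNormedType.Exports.

Local Open Scope classical_set_scope.
Local Open Scope ring_scope.

(* The product topology of R * R is the Euclidean topology of the plane. *)
Definition disk (R : realType) : set (R * R) :=
  [set p | p.1 ^+ 2 + p.2 ^+ 2 < 1].

Definition circle (R : realType) : set (R * R) :=
  [set p | p.1 ^+ 2 + p.2 ^+ 2 = 1].

Definition boundary (R : realType) (A : set (R * R)) : set (R * R) :=
  closure A `\` interior A.

(* A curve is identified with its image, so a family of curves is a set of
   subsets of the closed disk; [parametrizes c g a b] says that c is the image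
   of the curve g : [a, b] -> closed disk. *)
Definition parametrizes (R : realType) (c : set (R * R))
    (g : R -> R * R) (a b : R) : Prop :=
  [/\ a < b,
      {within `[a, b], continuous g},
      {in `[a, b] &, injective g},
      [/\ @circle R (g a), @circle R (g b)
        & forall t, t \in `]a, b[ -> @disk R (g t)]
    & c = g @` `[a, b]].

Definition is_curve (R : realType) (c : set (R * R)) : Prop :=
  exists g a b, parametrizes c g a b.

Definition endpoints (R : realType) (c : set (R * R)) : set (R * R) :=
  [set p | exists g a b, parametrizes c g a b /\ (p = g a \/ p = g b)].

Definition curve_family (R : realType) (C : set (set (R * R))) : Prop :=
  [/\ forall c, C c -> is_curve c,
      forall x y, @disk R x -> @disk R y -> x <> y ->
        exists! c, [/\ C c, c x & c y],
      forall xi eta, @circle R xi -> @circle R eta -> xi <> eta ->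
        exists! c, C c /\ endpoints c = [set xi; eta]
    & forall x xi, @disk R x -> @circle R xi ->
        exists! c, [/\ C c, c x & endpoints c xi]].

Definition curve_through (R : realType) (C : set (set (R * R)))
    (x y : R * R) : set (R * R) :=
  xget set0 [set c | [/\ C c, c x & c y]].

Definition line (R : realType) (C : set (set (R * R)))
    (xi eta : R * R) : set (R * R) :=
  xget set0 [set c | C c /\ endpoints c = [set xi; eta]].

Definition curve_to (R : realType) (C : set (set (R * R)))
    (x xi : R * R) : set (R * R) :=
  xget set0 [set c | [/\ C c, c x & endpoints c xi]].

(* The subarc does not depend on the parametrization of the curve. *)
Definition segment (R : realType) (C : set (set (R * R)))
    (x y : R * R) : set (R * R) :=
  [set z | exists g a b s t,
    [/\ parametrizes (curve_through C x y) g a b,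
        s \in `[a, b] /\ g s = x,
        t \in `[a, b] /\ g t = y
      & exists2 u, Num.min s t <= u <= Num.max s t & z = g u]].

Definition convex_for (R : realType) (C : set (set (R * R)))
    (X : set (R * R)) : Prop :=
  forall x y, X x -> X y -> segment C x y `<=` X.

(* [sides] may be any finite list of segments with union the boundary of [P];
   it need not consist of maximal segments. *)
Definition convex_polygon (R : realType) (C : set (set (R * R)))
    (P : set (R * R)) (sides : seq ((R * R) * (R * R))) : Prop :=
  [/\ [/\ P !=set0, open P & P `<=` @disk R],
      convex_for C P,
      forall s, s \in sides ->
        [/\ @disk R s.1, @disk R s.2 & s.1 <> s.2]
    & boundary P = \bigcup_(s in [set` sides]) segment C s.1 s.2].

(* [projection C x theta] is the point x_theta. *)
Definition projection (R : realType) (C : set (set (R * R)))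
    (x theta : R * R) : R * R :=
  xget theta [set p | endpoints (curve_to C x theta) p /\ p <> theta].

Definition rotate_cw (R : realType) (t : R) (p : R * R) : R * R :=
  (p.1 * cos t + p.2 * sin t, p.2 * cos t - p.1 * sin t).

(* The length, in [0, 2 pi[, of the arc running clockwise from theta to p. *)
Definition cw_angle (R : realType) (theta p : R * R) : R :=
  xget 0 [set t | 0 <= t < 2 * pi /\ rotate_cw t theta = p].

Definition clockwise (R : realType) (theta p q : R * R) : Prop :=
  [/\ @circle R theta, @circle R p, @circle R q
    & 0 < cw_angle theta p < cw_angle theta q].

(* The length of the arc of the unit circle between [a] and [b] which does not
   contain [theta]. *)
Definition arc_length (R : realType) (theta a b : R * R) : R :=
  `|cw_angle theta a - cw_angle theta b|.

(* The arc between [eta] and [xi] not containing [theta], for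
   [clockwise theta eta xi]. *)
Definition circle_arc (R : realType) (theta eta xi : R * R) : set (R * R) :=
  [set p | @circle R p /\
     cw_angle theta eta <= cw_angle theta p <= cw_angle theta xi].

(* The region enclosed by a Jordan curve J: the points lying in a bounded
   component of the complement of J. *)
Definition enclosed (R : realType) (J : set (R * R)) : set (R * R) :=
  [set z | ~ J z /\ bounded_set (connected_component (~` J) z)].

Definition wedge (R : realType) (C : set (set (R * R)))
    (theta xi eta : R * R) : set (R * R) :=
  enclosed (line C theta xi `|` line C theta eta `|` circle_arc theta eta xi).

Definition minimal_wedge (R : realType) (C : set (set (R * R)))
    (P : set (R * R)) (theta xi eta : R * R) : Prop :=
  [/\ clockwise theta eta xi,
      P `<=` wedge C theta xi eta
    & forall xi' eta', clockwise theta eta' xi' ->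
        P `<=` wedge C theta xi' eta' ->
        wedge C theta xi' eta' `<=` wedge C theta xi eta ->
        wedge C theta xi' eta' = wedge C theta xi eta].

(* g12 C P theta = (xi_theta, eta_theta) *)
Definition g12 (R : realType) (C : set (set (R * R))) (P : set (R * R))
    (theta : R * R) : (R * R) * (R * R) :=
  xget (theta, theta) [set q | minimal_wedge C P theta q.1 q.2].

Definition g1 (R : realType) (C : set (set (R * R))) (P : set (R * R))
    (theta : R * R) : R * R := (g12 C P theta).1.

Definition g2 (R : realType) (C : set (set (R * R))) (P : set (R * R))
    (theta : R * R) : R * R := (g12 C P theta).2.

Definition d_theta (R : realType) (C : set (set (R * R))) (P : set (R * R))
    (theta x y : R * R) : R :=
  let len := arc_length theta in
  let xi := g1 C P theta in
  let eta := g2 C P theta in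
  let ratio a b := ln ((len eta a * len xi b) / (len eta b * len xi a)) in
  let xt := projection C x theta in
  let yt := projection C y theta in
  if cw_angle theta yt <= cw_angle theta xt then ratio xt yt else ratio yt xt.

Definition d_sum (R : realType) (C : set (set (R * R))) (P : set (R * R))
    (theta : nat -> R * R) (w : nat -> R) (x y : R * R) : R :=
  limn (series (fun i => w i * d_theta C P (theta i) x y)).

Definition metric_data (R : realType) (C : set (set (R * R)))
    (sides : seq ((R * R) * (R * R)))
    (theta : nat -> R * R) (w : nat -> R) : Prop :=
  [/\ range theta `<=` @circle R,
      @circle R `<=` closure (range theta),
      forall s, s \in sides ->
        endpoints (curve_through C s.1 s.2) `<=` range theta,
      forall i, 0 < w i
    & cvgn (series w)].

Definition metric_on (R : realType) (T : Type) (P : set T)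
    (d : T -> T -> R) : Prop :=
  [/\ forall x y, P x -> P y -> 0 <= d x y,
      forall x y, P x -> P y -> (d x y = 0 <-> x = y),
      forall x y, P x -> P y -> d x y = d y x
    & forall x y z, P x -> P y -> P z -> d x z <= d x y + d y z].

Definition isometric_on (R : realType) (T : Type) (P : set T)
    (d : T -> T -> R) (I : set R) (r : R -> T) : Prop :=
  (forall t, I t -> P (r t)) /\
  (forall s t, I s -> I t -> d (r s) (r t) = `|s - t|).

Definition geodesically_complete (R : realType) (T : Type) (P : set T)
    (d : T -> T -> R) : Prop :=
  forall (a b : R) (g : R -> T), a <= b -> isometric_on P d `[a, b] g ->
    exists l : R -> T, isometric_on P d setT l /\ g @` `[a, b] `<=` range l.

(* Main.v *)
(* Everything is expressed through [fcoord th x], the angle at which th sees the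
   curve through th and x. The topological input is that two connected compact
   sets joining linked pairs of points of the circle meet; it is proved by a
   discrete winding number argument and yields that [fcoord th] is continuous on
   the closed disk minus th. Being injective on every curve that avoids th, it is
   monotone there, so segments are additive for each pseudo-metric
   d_th(x, y) = |ell th x - ell th y|, where ell th is an increasing function of
   [fcoord th] tending to -oo and +oo at the two sides of the minimal wedge.

   Linking also makes th |-> fcoord th x continuous, which bounds d_th(x, y)
   uniformly in th, so that the series converges. The curve carrying a side of P
   misses P, hence bounds the minimal wedge seen from its endpoints; as these
   endpoints belong to Theta, one term of the series tends to infinity at each
   boundary point. Finally, if d(x, z) = d(x, y) + d(y, z) then y lies between x
   and z as seen from a dense set of base points, hence y is on [x, z]: geodesic
   segments are segments of curves, which extend to the boundary both ways. *)

Require Import Defs.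
From HB Require Import structures.
From mathcomp Require Import all_boot all_order all_algebra.
From mathcomp Require Import all_classical all_reals all_analysis.
From mathcomp Require Import ring lra.

Set Implicit Arguments.
Unset Strict Implicit.
Unset Printing Implicit Defensive.

Import Order.TTheory GRing.Theory Num.Theory.
Import numFieldNormedType.Exports.

Local Open Scope classical_set_scope.
Local Open Scope ring_scope.

(** * Clockwise rotations and angles on the circle *)

Section Angles.
Variable R : realType.
Implicit Types (s t : R) (p q th : R * R).

(** The curves are merely continuous, so the only rigidity is uniqueness: two curves from a common
    base point on the circle that share another point are equal. All geometry is therefore reduced
    to the order of real coordinates. Two sets [K] and [L] meet exactly when 0 is a difference k -
    l. This is why winding about the origin detects crossings, and why fine chains are enough:
    disjoint compact sets have a positive distance, which fixes the mesh. Wedges are defined through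
    bounded components of a complement. No Jordan curve theorem is invoked to compute them: strict
    inequalities on the coordinate cut out a relatively clopen bounded set, and every other point
    off the curve is joined to infinity by hand. Minimality of a wedge then concerns only the
    extreme coordinates on [P], which are attained on its closure because the sides keep that
    closure compact inside the open disk. *)

Lemma rotate_cw0 p : rotate_cw 0 p = p.
Proof. by case: p => a b; rewrite /rotate_cw cos0 sin0 /=; congr pair; ring. Qed.

Lemma rotate_cwD s t p : rotate_cw s (rotate_cw t p) = rotate_cw (t + s) p.
Proof. by case: p => a b; rewrite /rotate_cw cosD sinD /=; congr pair; ring. Qed.

Lemma rotate_cwD2pi t p : rotate_cw (t + 2 * pi) p = rotate_cw t p.
Proof. by rewrite mulr_natl /rotate_cw cosD2pi sinD2pi. Qed.

Lemma circle_rotate_cw t p : circle p -> circle (rotate_cw t p).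
Proof.
case: p => a b; rewrite /circle /rotate_cw /= => h.
have := cos2Dsin2 t; set c := cos t; set s := sin t => cs.
transitivity ((a ^+ 2 + b ^+ 2) * (c ^+ 2 + s ^+ 2)); first by ring.
by rewrite h cs mulr1.
Qed.

Lemma cos_eq1_eq0 t : 0 <= t < 2 * pi -> cos t = 1 -> t = 0 :> R.
Proof.
move=> /andP[t0 t2] ct; case: (leP t pi) => tp.
  by apply: cos_inj; rewrite ?cos0 ?in_itv /= ?t0 ?tp ?lexx ?pi_ge0.
have : 2 * pi - t = 0 :> R.
  apply: cos_inj; rewrite ?cos0 ?in_itv /= ?lexx ?pi_ge0 //; last first.
    by rewrite addrC mulr_natl cosD2pi cosN ct.
  by rewrite subr_ge0 (ltW t2) /= lerBlDr; lra.
by lra.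
Qed.

(** The cosine of the relative angle is the inner product of [th] with its image, which is 1 when
    the two rotations agree on [th]. *)
Lemma rotate_cw_inj th s t : circle th -> 0 <= s < 2 * pi -> 0 <= t < 2 * pi ->
  rotate_cw s th = rotate_cw t th -> s = t.
Proof.
move=> cth; wlog st : s t / s <= t.
  by move=> H hs ht e; case: (leP s t) => [/H|/ltW/H h]; [exact|rewrite h].
move=> hs ht e.
suff : t - s = 0 by lra.
apply: cos_eq1_eq0; first by lra.
have /= : rotate_cw (t - s) th = th.
  have := congr1 (rotate_cw (- s)) e; rewrite !rotate_cwD subrr rotate_cw0.
  by move=> <-.
move: cth; case: th {e} => a b; rewrite /circle /rotate_cw /=.
set c := cos _; set d := sin _ => h [e1 e2].
transitivity (c * (a ^+ 2 + b ^+ 2)); first by rewrite h mulr1.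
transitivity (a * (a * c + b * d) + b * (b * c - a * d)); first by ring.
by rewrite e1 e2 -h !expr2.
Qed.

Lemma circle_angle th p : circle th -> circle p ->
  exists t, 0 <= t < 2 * pi /\ rotate_cw t th = p.
Proof.
case: th p => a b [x y]; rewrite /circle /= => h1 h2.
(* The inner product and the clockwise-signed cross product of the two points: the cosine and sine
   of the angle sought. *)
pose c := a * x + b * y; pose d := b * x - a * y.
have cd : c ^+ 2 + d ^+ 2 = 1.
  by transitivity ((a ^+ 2 + b ^+ 2) * (x ^+ 2 + y ^+ 2)); [rewrite /c /d; ring|rewrite h1 h2 mulr1].
have c1 : -1 <= c <= 1 by nra.
have sqd : Num.sqrt (1 - c ^+ 2) = `|d| by rewrite -sqrtr_sqr; congr Num.sqrt; lra.
have [t [t02 ct st]] : exists t, [/\ 0 <= t < 2 * pi, cos t = c & sin t = d].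
  case: (leP 0 d) => d0.
    exists (acos c); split; rewrite ?sin_acos ?sqd ?ger0_norm ?acosK ?in_itv //=.
    by rewrite acos_ge0 //= (le_lt_trans (acos_lepi c1)) //; have := @pi_gt0 R; lra.
  exists (2 * pi - acos c); have cN : -1 <= c < 1 by nra.
  have a0 := acos_gt0 cN; have ap := acos_lepi c1; have pi0 := @pi_gt0 R.
  split; first by lra.
    by rewrite addrC mulr_natl cosD2pi cosN acosK // in_itv.
  by rewrite addrC mulr_natl sinD2pi sinN sin_acos // sqd ltr0_norm // opprK.
exists t; split=> //; rewrite /rotate_cw /= ct st /c /d; congr pair.
  by transitivity (x * (a ^+ 2 + b ^+ 2)); [ring|rewrite h1 mulr1].
by transitivity (y * (a ^+ 2 + b ^+ 2)); [ring|rewrite h1 mulr1].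
Qed.

Lemma cw_angleP th p : circle th -> circle p ->
  0 <= cw_angle th p < 2 * pi /\ rotate_cw (cw_angle th p) th = p.
Proof.
move=> cth cp; rewrite /cw_angle; case: xgetP => [t _|/(_ _)] //.
by have [t ?] := circle_angle cth cp => /(_ t).
Qed.

Lemma cw_angle_rotate th t : circle th -> 0 <= t < 2 * pi ->
  cw_angle th (rotate_cw t th) = t.
Proof.
move=> cth ht; have [h e] := cw_angleP cth (circle_rotate_cw t cth).
exact: rotate_cw_inj e.
Qed.

Lemma cw_angle_gt0 th p : circle th -> circle p -> p <> th ->
  0 < cw_angle th p < 2 * pi.
Proof.
move=> cth cp pth; have [/andP[h0 h1] e] := cw_angleP cth cp.
rewrite h1 andbT lt_neqAle h0 andbT; apply/eqP => h.
by apply: pth; rewrite -e -h rotate_cw0.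
Qed.

Lemma rotate_cw_neq th t : circle th -> 0 < t < 2 * pi -> rotate_cw t th <> th.
Proof.
move=> cth ht e; have : t = 0; last by lra.
by apply: (rotate_cw_inj cth); rewrite ?rotate_cw0 //; lra.
Qed.

End Angles.

(** * Signed crossings of a ray on a grid *)

(* Colour the plane minus the origin by [undef] (a half-plane) and, in the other
   half-plane, by the two sides of a ray; [side_jump] counts signed crossings of
   that ray along an edge of a grid. A closed walk round a cell crosses the ray
   zero times in total unless it sees all three colours, which only happens near
   the origin. *)
Section DiscreteWinding.
Variables (A : eqType) (undef : pred A) (side : pred A).

Definition side_jump (v w : A) : int :=
  if undef v || undef w then 0 else (side v)%:R - (side w)%:R.

(** The negation of seeing all three colours at once. *)
Definition one_sided (s : seq A) : Prop :=
  (forall v, v \in s -> ~~ undef v) \/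
  (forall v w, v \in s -> w \in s -> ~~ undef v -> ~~ undef w -> side v = side w).

(** Either no vertex is [undef] and the jumps telescope along both paths from [v1] to [v4], or every
    jump vanishes. *)
Lemma side_jump_cell v1 v2 v3 v4 : one_sided [:: v1; v2; v3; v4] ->
  side_jump v1 v2 + side_jump v2 v4 = side_jump v1 v3 + side_jump v3 v4.
Proof.
have i1 : v1 \in [:: v1; v2; v3; v4] by rewrite !inE eqxx.
have i2 : v2 \in [:: v1; v2; v3; v4] by rewrite !inE eqxx !orbT.
have i3 : v3 \in [:: v1; v2; v3; v4] by rewrite !inE eqxx !orbT.
have i4 : v4 \in [:: v1; v2; v3; v4] by rewrite !inE eqxx !orbT.
rewrite /side_jump; case=> h.
  rewrite !(negbTE (h _ i1)) !(negbTE (h _ i2)) !(negbTE (h _ i3)) !(negbTE (h _ i4)) /=.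
  by ring.
have := (h _ _ i1 i2, h _ _ i2 i4, h _ _ i1 i3, h _ _ i3 i4).
case: (undef v1); case: (undef v2); case: (undef v3); case: (undef v4) => //=;
  move=> [[[h1 h2] h3] h4]; move: h1 h2 h3 h4;
  case: (side v1); case: (side v2); case: (side v3); case: (side v4) => h1 h2 h3 h4;
  by [|have := h1 isT isT|have := h2 isT isT|have := h3 isT isT|have := h4 isT isT].
Qed.

(** Summing the cell identity over a row shows that the total jump is the same along consecutive
    rows, as the two lateral sides contribute nothing. It is 0 on the top row; on the bottom row,
    where nothing is [undef], it telescopes to the difference of the two corners. *)
Lemma no_winding (v : nat -> nat -> A) (n m : nat) :
  (forall i j, (i < n)%N -> (j < m)%N ->
     one_sided [:: v i j; v i.+1 j; v i j.+1; v i.+1 j.+1]) ->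
  (forall j, (j < m)%N -> side_jump (v 0 j) (v 0 j.+1) = 0) ->
  (forall j, (j < m)%N -> side_jump (v n j) (v n j.+1) = 0) ->
  (forall i, (i < n)%N -> side_jump (v i m) (v i.+1 m) = 0) ->
  (forall i, (i <= n)%N -> ~~ undef (v i 0)) ->
  side (v 0 0) = side (v n 0).
Proof.
move=> hc hl hr ht hb.
have S j : (j <= m)%N -> \sum_(0 <= i < n) side_jump (v i j) (v i.+1 j) =
                         \sum_(0 <= i < n) side_jump (v i 0) (v i.+1 0).
  elim: j => // j IH jm; rewrite -(IH (ltnW jm)).
  have : \sum_(0 <= i < n) side_jump (v i j) (v i.+1 j) -
    \sum_(0 <= i < n) side_jump (v i j.+1) (v i.+1 j.+1) =
    \sum_(0 <= i < n) - (side_jump (v i.+1 j) (v i.+1 j.+1)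
                         - side_jump (v i j) (v i j.+1)).
    rewrite -sumrB; apply: eq_big_nat => i /= ilt.
    have := side_jump_cell (hc i j ilt jm).
    by set p := side_jump _ _; set q := side_jump _ _; set r := side_jump _ _;
       set s := side_jump _ _ => e; lra.
  rewrite sumrN telescope_sumr // hl // hr // subrr oppr0 => /eqP.
  by rewrite subr_eq0 => /eqP.
have : \sum_(0 <= i < n) side_jump (v i 0) (v i.+1 0) = 0.
  rewrite -(S m) //; apply: big1_seq => i /=; rewrite mem_index_iota => /ht.
  exact.
have -> : \sum_(0 <= i < n) side_jump (v i 0) (v i.+1 0) =
  \sum_(0 <= i < n) - ((side (v i.+1 0))%:R - (side (v i 0))%:R : int).
  apply: eq_big_nat => i /= ilt; rewrite /side_jump.
  by rewrite (negbTE (hb i (ltnW ilt))) (negbTE (hb i.+1 ilt)) /=; ring.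
rewrite sumrN telescope_sumr //.
by case: (side (v 0 0)); case: (side (v n 0)).
Qed.

End DiscreteWinding.

(** * Connected compact sets joining linked pairs of circle points meet *)

Section Crossing.
Variable R : realType.
Implicit Types (K L : set (R * R)) (a b p q x y : R * R).

Definition cdisk : set (R * R) := [set p | p.1 ^+ 2 + p.2 ^+ 2 <= 1].

Lemma norm_fst x : `|x.1| <= `|x|. Proof. by rewrite prod_normE le_max lexx. Qed.
Lemma norm_snd x : `|x.2| <= `|x|. Proof. by rewrite prod_normE le_max lexx orbT. Qed.

(** The points of [K] reachable by such chains form a nonempty relatively clopen subset. Chains are
    sequences over all of [nat], prolonged by a constant, so that no index bound has to be
    carried. *)
Lemma connected_chain K (e : R) a b : 0 < e -> connected K -> K a -> K b ->
  exists n (k : nat -> R * R), [/\ k 0%N = a, k n = b, forall i, K (k i)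
    & forall i, `|k i.+1 - k i| < e].
Proof.
move=> e0 cK Ka Kb.
pose chain x := exists n (k : nat -> R * R), [/\ k 0%N = a, k n = x,
  forall i, K (k i) & forall i, `|k i.+1 - k i| < e].
have step x y : chain x -> K y -> `|y - x| < e -> chain y.
  move=> [n [k [k0 kn Kk ke]]] Ky yx.
  exists n.+1, (fun i => if (i <= n)%N then k i else y); split=> /=.
  - exact: k0.
  - by rewrite ltnn.
  - by move=> i; case: ifP.
  - move=> i; case: (ltngtP i n) => [lin|lin|->].
    + exact: ke.
    + by rewrite subrr normr0.
    + by rewrite kn.
suff : [set x | K x /\ chain x] = K by move/seteqP=> [_ /(_ b Kb)[]].
apply: cK.
- exists a; split=> //; exists 0%N, (fun=> a); split=> // i.
  by rewrite subrr normr0.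
- exists (\bigcup_(x in [set x | K x /\ chain x]) ball x e).
    by apply: bigcup_open => x _; apply: ball_open.
  apply/seteqP; split=> [x [Kx cx]|x [Kx [y [Ky cy]]]].
    by split=> //; exists x => //; apply: ballxx.
  rewrite -ball_normE /= distrC => yx; split=> //; exact: step cy Kx yx.
- exists (~` \bigcup_(x in [set x | K x /\ ~ chain x]) ball x e).
    by apply: open_closedC; apply: bigcup_open => x _; apply: ball_open.
  apply/seteqP; split=> [x [Kx cx]|x [Kx nx]].
    split=> // -[y [Ky ncy]]; rewrite -ball_normE /= => yx.
    by apply: ncy; apply: step cx Ky yx.
  split=> //; apply: contrapT => ncx; apply: nx; exists x => //.
  exact: ballxx.
Qed.

Lemma compact_dist_gt0 K L : compact K -> compact L -> K `&` L = set0 ->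
  exists2 d : R, 0 < d & forall x y, K x -> L y -> d <= `|x - y|.
Proof.
move=> cK cL KL0.
have [->|/set0P[a Ka]] := eqVneq K set0; first by exists 1.
have [->|/set0P[b Lb]] := eqVneq L set0; first by exists 1 => // x y _ [].
have : exists2 z, z \in K `*` L & forall t, t \in K `*` L ->
    `|z.1 - z.2| <= `|t.1 - t.2|.
  apply: compact_EVT_min.
  - by exists (a, b).
  - exact: compact_setX.
  - apply: continuous_subspaceT => z.
    apply: (@continuous_comp _ _ _ (fun z : (R * R) * (R * R) => z.1 - z.2) (fun z => `|z|)).
      by apply: cvgB; [apply: cvg_fst|apply: cvg_snd].
    exact: norm_continuous.
move=> [z /set_mem[Kz Lz] zmin]; exists `|z.1 - z.2|.
  rewrite normr_gt0 subr_eq0; apply/eqP => e.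
  suff : (K `&` L) z.1 by rewrite KL0.
  by split=> //; rewrite e.
by move=> x y Kx Ly; apply: (zmin (x, y)); apply/mem_set.
Qed.


(* The mesh e = d^2 (- p2) / 100 is fine enough compared with the distance d
   between the two connected sets. *)
Lemma near_ray_contra (d e f x y c1 c2 p1 p2 : R) : p2 < 0 -> -1 <= p2 -> -1 <= p1 <= 1 ->
  -1 <= c1 <= 1 -> -1 <= c2 <= 1 -> c2 <= 0 -> 0 < d -> f = d ^+ 2 / 100 -> e = f * - p2 ->
  `|x| <= e -> x * p1 + y * p2 < 0 -> d ^+ 2 / 2 <= x * c1 + y * c2 -> False.
Proof.
move=> p20 p21 p11 c11 c21 c20 d0 hf he /ler_normlP[xe1 xe2] h1 h2.
have f0 : 0 < f by rewrite hf divr_gt0 // exprn_gt0.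
have hd : d ^+ 2 = 100 * f by rewrite hf; lra.
have ef : e <= f by nra.
have e0 : 0 < e by nra.
have xc : x * c1 <= e by nra.
have yc : 49 * f <= y * c2 by lra.
have y0 : y < 0 by nra.
have y1 : y <= - 49 * f by nra.
have xp : - e <= x * p1 by nra.
by nra.
Qed.

(** Rules out a cell that sees all three colours, since it would come too close to the origin. The
    factor [- p2] in [e] pays for the division by [p2] that recovers [y] from the inner product: |y|
    <= 6f, and [d <= 2] makes f small enough. *)
Lemma small_vector_contra (d e f x y p1 p2 : R) : p2 < 0 -> -1 <= p2 -> -1 <= p1 <= 1 ->
  0 < d -> d <= 2 -> f = d ^+ 2 / 100 -> e = f * - p2 ->
  `|x| <= 2 * e -> `|x * p1 + y * p2| <= 4 * e -> d ^+ 2 <= x ^+ 2 + y ^+ 2 -> False.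
Proof.
move=> p20 p21 p11 d0 d2 hf he /ler_normlP[xe1 xe2] /ler_normlP[h1 h2] h3.
have f0 : 0 < f by rewrite hf divr_gt0 // exprn_gt0.
have hd : d ^+ 2 = 100 * f by rewrite hf; lra.
have f4 : f <= 1 / 25 by nra.
have ef : e <= f by nra.
have yp1 : y * - p2 <= 6 * f * - p2 by nra.
have yp2 : - y * - p2 <= 6 * f * - p2 by nra.
have y1 : y <= 6 * f by nra.
have y2 : - y <= 6 * f by nra.
by nra.
Qed.

Lemma circle_bounds p : circle p -> (-1 <= p.1 <= 1) /\ (-1 <= p.2 <= 1).
Proof. by rewrite /circle /= => h; split; nra. Qed.

(** For |p| = 1 and |x| <= 1 one has |p - x|^2 <= 2 (p - x).p. So the differences between a circle
    point and far away points of the disk fill only a half-plane off the origin, which controls each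
    side of the grid. *)
Lemma cdisk_dot_circle (d : R) p x : circle p -> cdisk x ->
  d ^+ 2 <= (p.1 - x.1) ^+ 2 + (p.2 - x.2) ^+ 2 ->
  d ^+ 2 / 2 <= (p.1 - x.1) * p.1 + (p.2 - x.2) * p.2.
Proof. by rewrite /circle /cdisk /= => h1 h2 h3; nra. Qed.

Lemma cdisk_dot_circle_opp (d : R) p x : circle p -> cdisk x ->
  d ^+ 2 <= (x.1 - p.1) ^+ 2 + (x.2 - p.2) ^+ 2 ->
  d ^+ 2 / 2 <= (x.1 - p.1) * (- p).1 + (x.2 - p.2) * (- p).2.
Proof. by rewrite /circle /cdisk /= => h1 h2 h3; nra. Qed.

Lemma norm_le_of_opp_sign (x y e : R) : `|x - y| <= e -> 0 <= x -> y < 0 -> `|x| <= e.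
Proof. by move=> /ler_normlP[h1 h2] x0 y0; apply/ler_normlP; split; lra. Qed.

Lemma dot_le_of_opp_sign (v z p : R * R) (e : R) : -1 <= p.1 <= 1 -> -1 <= p.2 <= 1 ->
  `|z.1 - v.1| <= 2 * e -> `|z.2 - v.2| <= 2 * e ->
  0 <= z.1 * p.1 + z.2 * p.2 -> v.1 * p.1 + v.2 * p.2 < 0 ->
  `|v.1 * p.1 + v.2 * p.2| <= 4 * e.
Proof.
move=> p1 p2 h1 h2 hz hv.
have k1 : `|(z.1 - v.1) * p.1| <= 2 * e.
  rewrite normrM -[leRHS]mulr1 ler_pM //; apply/ler_normlP; split; lra.
have k2 : `|(z.2 - v.2) * p.2| <= 2 * e.
  rewrite normrM -[leRHS]mulr1 ler_pM //; apply/ler_normlP; split; lra.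
move: k1 k2 => /ler_normlP[k1 k1'] /ler_normlP[k2 k2'].
by apply/ler_normlP; split; lra.
Qed.

(** Two vertices of a cell differ by at most one step of each chain. *)
Lemma cell_close (k k' l l' : R * R) (e : R) x y : `|k' - k| < e -> `|l' - l| < e ->
  x \in [:: k - l; k' - l; k - l'; k' - l'] ->
  y \in [:: k - l; k' - l; k - l'; k' - l'] ->
  `|x.1 - y.1| <= 2 * e /\ `|x.2 - y.2| <= 2 * e.
Proof.
move=> kk ll xs ys; suff h : `|x - y| <= 2 * e.
  by split; apply: le_trans h; [apply: norm_fst (x - y)|apply: norm_snd (x - y)].
have kk' : `|k - k'| < e by rewrite distrC.
have ll' : `|l - l'| < e by rewrite distrC.
have e0 : 0 < e := le_lt_trans (normr_ge0 _) kk.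
have : exists (u w : R * R), [/\ x - y = u + w, `|u| <= e & `|w| <= e].
  have z0 : `|0 : R * R| <= e by rewrite normr0 ltW.
  by move: xs ys; rewrite !inE => /or4P[] /eqP -> /or4P[] /eqP ->;
    [exists 0, 0|exists (k - k'), 0|exists 0, (l' - l)|exists (k - k'), (l' - l)
    |exists (k' - k), 0|exists 0, 0|exists (k' - k), (l' - l)|exists 0, (l' - l)
    |exists 0, (l - l')|exists (k - k'), (l - l')|exists 0, 0|exists (k - k'), 0
    |exists (k' - k), (l - l')|exists 0, (l - l')|exists (k' - k), 0|exists 0, 0];
    split; rewrite ?(ltW kk) ?(ltW kk') ?(ltW ll) ?(ltW ll') //;
    rewrite [RHS]surjective_pairing [LHS]surjective_pairing /=; congr pair; ring.
move=> [u [w [-> hu hw]]]; apply: le_trans (ler_normD _ _) _.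
by rewrite mulr_natl mulr2n lerD.
Qed.

(* If K and L were disjoint, fine chains k_i in K from a to b and l_j in L from
   p to q would give a grid k_i - l_j staying away from 0. The side l_j = p of the
   grid crosses the ray {0} x (0, oo) once, the other three sides never do. *)
Lemma crossing_half K L a b p q : compact K -> connected K -> K `<=` cdisk ->
  compact L -> connected L -> L `<=` cdisk ->
  circle a -> circle b -> circle p -> circle q ->
  a.2 <= 0 -> b.2 <= 0 -> p.2 < 0 -> 0 <= q.2 -> b.1 < p.1 < a.1 ->
  K a -> K b -> L p -> L q -> K `&` L !=set0.
Proof.
move=> cK nK KD cL nL LD ca cb cp cq a2 b2 p2 q2 /andP[bp pa] Ka Kb Lp Lq.
apply: contrapT => /set0P/negP; rewrite negbK => /eqP KL0.
have [d0 d0gt hd0] := compact_dist_gt0 cK cL KL0.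
(* Capped to satisfy the bound [d <= 2] of [small_vector_contra]. *)
pose d := Num.min d0 1.
have dgt : 0 < d by rewrite lt_min d0gt ltr01.
have d2 : d <= 2 by rewrite ge_min; apply/orP; right; lra.
(* The product norm is the maximum norm, which the Euclidean norm dominates. *)
have hd x y : K x -> L y -> d ^+ 2 <= (x.1 - y.1) ^+ 2 + (x.2 - y.2) ^+ 2.
  move=> Kx Ly; have : d <= `|x - y| by rewrite ge_min hd0.
  rewrite prod_normE le_max => /orP[] h.
    have := ler_pM (ltW dgt) (ltW dgt) h h; rewrite -!expr2 real_normK ?num_real //=.
    by move=> h'; apply: (le_trans h'); rewrite lerDl sqr_ge0.
  have := ler_pM (ltW dgt) (ltW dgt) h h; rewrite -!expr2 real_normK ?num_real //=.
  by move=> h'; apply: (le_trans h'); rewrite lerDr sqr_ge0.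
have [p1b p2b] := circle_bounds cp.
have [a1b a2b] := circle_bounds ca.
have [b1b b2b] := circle_bounds cb.
have [q1b q2b] := circle_bounds cq.
pose f := d ^+ 2 / 100; pose e := f * - p.2.
have f0 : 0 < f by rewrite divr_gt0 // exprn_gt0.
have e0 : 0 < e by rewrite mulr_gt0 // oppr_gt0.
have [n [k [k0 kn Kk ke]]] := connected_chain e0 nK Ka Kb.
have [m [l [l0 lm Ll le]]] := connected_chain e0 nL Lp Lq.
have ke1 i : `|(k i.+1).1 - (k i).1| < e by exact: le_lt_trans (norm_fst (k i.+1 - k i)) (ke i).
have ke2 i : `|(k i.+1).2 - (k i).2| < e by exact: le_lt_trans (norm_snd (k i.+1 - k i)) (ke i).
have le1 i : `|(l i.+1).1 - (l i).1| < e by exact: le_lt_trans (norm_fst (l i.+1 - l i)) (le i).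
have le2 i : `|(l i.+1).2 - (l i).2| < e by exact: le_lt_trans (norm_snd (l i.+1 - l i)) (le i).
pose dot (x : R * R) := x.1 * p.1 + x.2 * p.2.
pose undef : pred (R * R) := fun x => 0 <= dot x.
pose side : pred (R * R) := fun x => 0 <= x.1.
(* When [c.2 <= 0], the half-plane of vectors with inner product at least [d ^+ 2 / 2] with [c]
   misses the ray {0} x (0, oo), and a short edge inside it does not cross that ray. *)
have jump0 (v w : R * R) (c : R * R) : circle c -> c.2 <= 0 ->
    `|v.1 - w.1| <= e ->
    d ^+ 2 / 2 <= v.1 * c.1 + v.2 * c.2 -> d ^+ 2 / 2 <= w.1 * c.1 + w.2 * c.2 ->
    side_jump undef side v w = 0.
  move=> cc c2 vw hv hw; have [c1b c2b] := circle_bounds cc.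
  rewrite /side_jump; case: ifP => // /norP[]; rewrite /undef -!ltNge => uv uw.
  suff -> : side v = side w by rewrite subrr.
  have key (v' w' : R * R) : `|v'.1 - w'.1| <= e -> dot v' < 0 ->
      d ^+ 2 / 2 <= v'.1 * c.1 + v'.2 * c.2 -> side v' -> ~~ side w' -> False.
    rewrite /side -ltNge => h1 h3 h4 h5 h6.
    apply: (@near_ray_contra d e f v'.1 v'.2 c.1 c.2 p.1 p.2) => //.
      by case/andP: p2b.
    exact: norm_le_of_opp_sign h1 h5 h6.
  apply/idP/idP => [sv|sw]; apply: contraT => h; exfalso.
    exact: (key v w).
  by apply: (key w v) => //; rewrite distrC.
pose F i j := k i - l j.
(* The row [l j = p] runs from [a - p] to [b - p], which have first coordinates of opposite
   signs. *)
suff : side (F 0%N 0%N) = side (F n 0%N).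
  rewrite /side /F /= k0 kn l0.
  have -> : 0 <= a.1 - p.1 by rewrite subr_ge0 ltW.
  by move/esym; rewrite subr_ge0 leNgt bp.
apply: (@no_winding _ undef side F n m).
- move=> i j _ _; set s := [:: _; _; _; _].
  have close x y := @cell_close _ _ _ _ _ x y (ke i) (le j).
  have Fs x : x \in s -> d ^+ 2 <= x.1 ^+ 2 + x.2 ^+ 2.
    by rewrite !inE => /or4P[] /eqP ->; apply: hd.
  have [allC|b0] := pselect (forall v, v \in s -> ~~ undef v); [by left|right].
  move=> v w vs ws uv uw.
  have [z zs uz] : exists2 z, z \in s & undef z.
    apply: contrapT => h; apply: b0 => z zs; apply/negP => uz; apply: h.
    by exists z.
  have key (v' w' : R * R) : v' \in s -> w' \in s -> ~~ undef v' ->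
      side v' -> ~~ side w' -> False.
    rewrite /side /undef -!ltNge => v's w's h1 h2 h3.
    have [c1 _] := close _ _ v's w's; have [c3 c4] := close _ _ zs v's.
    apply: (@small_vector_contra d e f v'.1 v'.2 p.1 p.2) => //.
    + by case/andP: p2b.
    + exact: norm_le_of_opp_sign c1 h2 h3.
    + exact: dot_le_of_opp_sign c3 c4 uz h1.
    + exact: Fs.
  apply/idP/idP => [sv|sw]; apply: contraT => h; exfalso.
    exact: (key v w).
  exact: (key w v).
- move=> j _; apply: (jump0 _ _ a) => //; rewrite /F /= k0.
  + by rewrite opprD addrACA subrr add0r opprK addrC ltW.
  + by apply: cdisk_dot_circle; [|apply: LD|apply: hd].
  + by apply: cdisk_dot_circle; [|apply: LD|apply: hd].
- move=> j _; apply: (jump0 _ _ b) => //; rewrite /F /= kn.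
  + by rewrite opprD addrACA subrr add0r opprK addrC ltW.
  + by apply: cdisk_dot_circle; [|apply: LD|apply: hd].
  + by apply: cdisk_dot_circle; [|apply: LD|apply: hd].
- have dotq x : K x -> d ^+ 2 / 2 <= (x.1 - q.1) * (- q).1 + (x.2 - q.2) * (- q).2.
    by move=> Kx; apply: cdisk_dot_circle_opp (KD _ Kx) (hd _ _ Kx Lq).
  move=> i _; apply: (jump0 _ _ (- q)); rewrite /F ?lm /=.
  + by move: cq; rewrite /circle /= !sqrrN.
  + by rewrite oppr_le0.
  + by rewrite opprD addrACA subrr addr0 distrC ltW.
  + exact: dotq.
  + exact: dotq.
- move=> i _; rewrite /undef -ltNge /F l0 /dot /=.
  have := cdisk_dot_circle_opp cp (KD _ (Kk i)) (hd _ _ (Kk i) Lp).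
  rewrite /= !mulrN -opprD lerNr => /le_lt_trans; apply.
  by rewrite oppr_lt0 divr_gt0 // exprn_gt0.
Qed.

Lemma continuous_rotate_cw (t : R) : continuous (@rotate_cw R t).
Proof.
move=> p; apply: (@cvg_pair _ _ _ (nbhs p) (nbhs (rotate_cw t p).1)
  (nbhs (rotate_cw t p).2) _ _ _ (fun p => (rotate_cw t p).1) (fun p => (rotate_cw t p).2)).
  by apply: cvgD; apply: cvgMr_tmp; [apply: cvg_fst|apply: cvg_snd].
by apply: cvgB; apply: cvgMr_tmp; [apply: cvg_snd|apply: cvg_fst].
Qed.

Lemma cdisk_rotate_cw (t : R) p : cdisk p -> cdisk (rotate_cw t p).
Proof.
rewrite /cdisk /rotate_cw /= => h.
have := cos2Dsin2 t; set c := cos t; set s := sin t => cs.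
suff -> : (p.1 * c + p.2 * s) ^+ 2 + (p.2 * c - p.1 * s) ^+ 2 =
  (p.1 ^+ 2 + p.2 ^+ 2) * (c ^+ 2 + s ^+ 2) by rewrite cs mulr1.
by ring.
Qed.

(** Since [s2 <= pi], a rotation brings both ends of [K] to the closed lower half circle, with the
    first end of [L] between them and the second in the upper half, as [crossing_half] requires. *)
Lemma crossing_short th K L (s1 s2 s3 : R) : circle th ->
  0 < s1 -> s1 < s2 -> s2 < s3 -> s3 < 2 * pi -> s2 <= pi ->
  compact K -> connected K -> K `<=` cdisk ->
  compact L -> connected L -> L `<=` cdisk ->
  K th -> K (rotate_cw s2 th) -> L (rotate_cw s1 th) -> L (rotate_cw s3 th) ->
  K `&` L !=set0.
Proof.
move=> cth s10 s12 s23 s32 s2p cK nK KD cL nL LD Kt K2 L1 L3.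
have pi0 := @pi_gt0 R.
(* The rotation will send clockwise angle s to (cos (s - c), - sin (s - c)). If [s3 < pi], the shift
   puts [s2] at angle pi, so that [s3] lands beyond it. *)
have [c [c0 c2 c3]] : exists c : R, [/\ c <= 0, s2 - c <= pi & pi <= s3 - c <= 2 * pi].
  by case: (leP pi s3) => h; [exists 0|exists (s2 - pi)]; split; lra.
have o1 : circle ((1, 0) : R * R) by rewrite /circle /= expr1n expr0n addr0.
have [tau [_ rtau]] := circle_angle cth o1.
pose G := @rotate_cw R (tau - c).
have GE s : G (rotate_cw s th) = (cos (s - c), - sin (s - c)).
  rewrite /G rotate_cwD.
  have -> : s + (tau - c) = tau + (s - c) by ring.
  by rewrite -rotate_cwD rtau /rotate_cw /= !mul1r !mul0r addr0 sub0r.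
have cG A : {within A, continuous G}.
  exact: continuous_subspaceT (@continuous_rotate_cw _).
have cosI (x y : R) : 0 <= x <= pi -> 0 <= y <= pi -> x < y -> cos y < cos x :> R.
  by move=> hx hy xy; rewrite ltr_cos // in_itv.
have Gt : G th = (cos (- c), - sin (- c)) by rewrite -[th]rotate_cw0 GE sub0r.
have [|||||||||||||||||||y [[k Kk ky] [l Ll ly]]] := @crossing_half (G @` K) (G @` L)
    (G th) (G (rotate_cw s2 th)) (G (rotate_cw s1 th)) (G (rotate_cw s3 th)).
- exact: continuous_compact.
- exact: connected_continuous_connected.
- by move=> _ [z Kz <-]; apply/cdisk_rotate_cw/KD.
- exact: continuous_compact.
- exact: connected_continuous_connected.
- by move=> _ [z Kz <-]; apply/cdisk_rotate_cw/LD.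
- exact: circle_rotate_cw.
- exact/circle_rotate_cw/circle_rotate_cw.
- exact/circle_rotate_cw/circle_rotate_cw.
- exact/circle_rotate_cw/circle_rotate_cw.
- by rewrite Gt /= oppr_le0 sin_ge0_pi //; lra.
- by rewrite GE /= oppr_le0 sin_ge0_pi //; lra.
- by rewrite GE /= oppr_lt0 sin_gt0_pi //; lra.
- rewrite GE /= oppr_ge0.
  have -> : s3 - c = (s3 - c - pi) + pi by ring.
  by rewrite sinDpi oppr_le0 sin_ge0_pi //; lra.
- by rewrite Gt !GE /=; apply/andP; split; apply: cosI; lra.
- by exists th.
- by exists (rotate_cw s2 th).
- by exists (rotate_cw s1 th).
  by exists (rotate_cw s3 th).
exists k; split=> //; suff -> : k = l by [].
have := congr1 (@rotate_cw R (- (tau - c))) (etrans ky (esym ly)).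
by rewrite /G !rotate_cwD addrN !rotate_cw0.
Qed.

(** If [s2 > pi], measure angles from the other end of [K]: the clockwise arc from there back to
    [th] is shorter than pi. *)
Lemma crossing th K L (s1 s2 s3 : R) : circle th ->
  0 < s1 -> s1 < s2 -> s2 < s3 -> s3 < 2 * pi ->
  compact K -> connected K -> K `<=` cdisk ->
  compact L -> connected L -> L `<=` cdisk ->
  K th -> K (rotate_cw s2 th) -> L (rotate_cw s1 th) -> L (rotate_cw s3 th) ->
  K `&` L !=set0.
Proof.
move=> cth s10 s12 s23 s32 cK nK KD cL nL LD Kt K2 L1 L3.
case: (leP s2 pi) => [s2p|s2p]; first exact: (@crossing_short th K L s1 s2 s3).
have r2 s : rotate_cw (2 * pi - s2 + s) (rotate_cw s2 th) = rotate_cw s th.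
  rewrite rotate_cwD; have -> : s2 + (2 * pi - s2 + s) = s + 2 * pi by ring.
  exact: rotate_cwD2pi.
apply: (@crossing_short (rotate_cw s2 th) K L (s3 - s2) (2 * pi - s2) (2 * pi - s2 + s1)) => //.
- exact: circle_rotate_cw.
- lra.
- lra.
- lra.
- lra.
- lra.
- by have := r2 0; rewrite addr0 => ->; rewrite rotate_cw0.
- by rewrite rotate_cwD addrC subrK.
- by rewrite r2.
Qed.

End Crossing.

(** * Single curves: ends, compactness, subarcs *)

Section Curves.
Variable R : realType.
Implicit Types (c : set (R * R)) (p q th x y : R * R).

Lemma disk_not_circle x : disk x -> ~ circle x.
Proof. by rewrite /disk /circle /= => h1 h2; rewrite h2 ltxx in h1. Qed.

Lemma disk_cdisk x : disk x -> cdisk x.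
Proof. exact: ltW. Qed.

Lemma circle_cdisk x : circle x -> cdisk x.
Proof. by rewrite /cdisk /circle /= => ->. Qed.

Lemma cdiskP x : cdisk x -> disk x \/ circle x.
Proof. by rewrite /cdisk /circle /disk /= le_eqVlt => /orP[/eqP|]; [right|left]. Qed.

Lemma itv_endpoints (a b t : R) : t \in `[a, b] -> [\/ t = a, t = b | t \in `]a, b[].
Proof.
rewrite !in_itv /= => /andP[]; rewrite le_eqVlt => /orP[/eqP->|at_].
  by move=> _; apply: Or31.
by rewrite le_eqVlt => /orP[/eqP->|tb]; [apply: Or32|apply: Or33; rewrite at_ tb].
Qed.

Lemma parametrizes_circle c (g : R -> R * R) a b t : parametrizes c g a b ->
  t \in `[a, b] -> circle (g t) -> t = a \/ t = b.
Proof.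
move=> [_ _ _ [_ _ h] _] /itv_endpoints[->|->|/h]; [by left|by right|].
by move/disk_not_circle.
Qed.

Lemma parametrizes_in c (g : R -> R * R) a b t : parametrizes c g a b ->
  t \in `[a, b] -> c (g t).
Proof. by move=> [_ _ _ _ ->] tab; exists t. Qed.

Lemma parametrizes_bounds c (g : R -> R * R) a b : parametrizes c g a b ->
  a \in `[a, b] /\ b \in `[a, b].
Proof. by move=> [/ltW ab _ _ _ _]; rewrite !in_itv /= !lexx ab. Qed.

(** Interior parameters go into the open disk, so the ends are the points on the circle. This makes
    [endpoints] independent of the parametrization. *)
Lemma endpointsE c : is_curve c -> endpoints c = c `&` @circle R.
Proof.
move=> [g [a [b hg]]]; apply/seteqP; split=> p.
  move=> [h [a' [b' [hh e]]]]; have [ha hb] := parametrizes_bounds hh.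
  case: (hh) => _ _ _ [ca cb _] _.
  by case: e => ->; split=> //; apply: parametrizes_in hh _.
move=> [cp pc]; exists g, a, b; split=> //.
case: (hg) => _ _ _ _ ec; move: cp; rewrite ec => -[t tab et].
rewrite -et in pc *; have [->|->] := parametrizes_circle hg tab pc; [by left|by right].
Qed.

Lemma parametrizes_endpoints c (g : R -> R * R) a b : parametrizes c g a b ->
  endpoints c = [set g a; g b] /\ g a <> g b.
Proof.
move=> hg; have [ia ib] := parametrizes_bounds hg.
case: (hg) => ab cg ig [ga gb _] ec; split; last first.
  by move=> /(ig _ _ ia ib) e; rewrite e ltxx in ab.
rewrite endpointsE; last by exists g, a, b.
apply/seteqP; split=> p.
  rewrite {1}ec => -[[t tab <-]] /(parametrizes_circle hg tab).
  by case=> ->; [left|right].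
by case=> ->; split=> //; apply: parametrizes_in hg _.
Qed.

Lemma curve_compact c : is_curve c -> compact c.
Proof.
move=> [g [a [b [_ cg _ _ ->]]]]; apply: continuous_compact => //.
exact: segment_compact.
Qed.

Lemma curve_closed c : is_curve c -> closed c.
Proof. by move=> /curve_compact; apply: compact_closed; exact: norm_hausdorff. Qed.

Lemma curve_connected c : is_curve c -> connected c.
Proof.
move=> [g [a [b [_ cg _ _ ->]]]]; apply: connected_continuous_connected => //.
exact: segment_connected.
Qed.

Lemma curve_cdisk c : is_curve c -> c `<=` @cdisk R.
Proof.
move=> [g [a [b [_ _ _ [ga gb h] ->]]]] _ [t /itv_endpoints[->|->|/h ?] <-].
- exact: circle_cdisk.
- exact: circle_cdisk.
- exact: disk_cdisk.
Qed.

Lemma subarc_compact_connected (g : R -> R * R) (a b s t : R) : {within `[a, b], continuous g} ->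
  a <= s -> t <= b -> compact (g @` `[s, t]) /\ connected (g @` `[s, t]).
Proof.
move=> cg as_ tb.
have cs : {within `[s, t], continuous g}.
  apply: continuous_subspaceW cg => u /=; rewrite !in_itv /= => /andP[h1 h2].
  by rewrite (le_trans as_ h1) (le_trans h2 tb).
split; first by apply: continuous_compact => //; exact: segment_compact.
by apply: connected_continuous_connected => //; exact: segment_connected.
Qed.

(** Removes the base point from a curve: distinct curves of the family starting at [th] share only
    [th], so the piece kept here is disjoint from all the others. *)
Lemma curve_subarc c th eta x : is_curve c -> endpoints c = [set th; eta] ->
  c x -> x <> th -> eta <> th ->
  exists K, [/\ compact K, connected K, K `<=` c, K x & K eta /\ ~ K th].
Proof.
move=> [g [a [b hg]]] ep; case: (hg) => /ltW ab cg ig _ ec.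
have [ia ib] := parametrizes_bounds hg.
rewrite {1}ec => -[s sab <-] sth etath; have sab' := sab.
rewrite /= in_itv /= in sab'; case/andP: sab' => as_ sb.
have [epg gab] := parametrizes_endpoints hg; rewrite epg in ep.
have th_ab : [set g a; g b] th by rewrite ep; left.
have eta_ab : [set g a; g b] eta by rewrite ep; right.
have sub u v : a <= u -> v <= b -> g @` `[u, v] `<=` c.
  move=> au vb _ [r rab <-]; apply: parametrizes_in hg _.
  move: rab; rewrite /= !in_itv /= => /andP[h1 h2].
  by rewrite (le_trans au h1) (le_trans h2 vb).
have notin u v t : a <= u -> v <= b -> t \in `[a, b] -> t \notin `[u, v] ->
    ~ (g @` `[u, v]) (g t).
  move=> au vb tab tuv [r ruv]; have rab : r \in `[a, b].
    move: ruv; rewrite /= !in_itv /= => /andP[h1 h2].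
    by rewrite (le_trans au h1) (le_trans h2 vb).
  by move/(ig _ _ rab tab) => e; rewrite -e in tuv; move/negP: tuv; apply.
have sa : s <> b -> s < b by move=> h; rewrite lt_neqAle sb andbT; apply/eqP.
have sb' : s <> a -> a < s by move=> h; rewrite lt_neqAle as_ andbT; apply/eqP=> /esym.
case: th_ab => thE.
  exists (g @` `[s, b]); have [K1 K2] := subarc_compact_connected cg as_ (lexx b).
  split=> //.
  - exact: sub.
  - by exists s => //=; rewrite in_itv /= lexx.
  split.
    case: eta_ab => etaE; first by case: etath; rewrite thE.
    by rewrite etaE; exists b => //=; rewrite in_itv /= lexx andbT.
  rewrite thE; apply: notin => //; rewrite in_itv /= negb_and -ltNge sb' //.
  by move=> e; apply: sth; rewrite thE e.
exists (g @` `[a, s]); have [K1 K2] := subarc_compact_connected cg (lexx a) sb.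
split=> //.
- exact: sub.
- by exists s => //=; rewrite in_itv /= lexx andbT.
split.
  case: eta_ab => etaE; last by case: etath; rewrite thE.
  by rewrite etaE; exists a => //=; rewrite in_itv /= lexx.
rewrite thE; apply: notin => //; rewrite in_itv /= negb_and -!ltNge sa ?orbT //.
by move=> e; apply: sth; rewrite thE e.
Qed.

(** A Euclidean segment, unrelated to the family of curves, used as a short connected link between
    nearby points. *)
Lemma straight_segment_cdisk x y (e : R) : cdisk x -> cdisk y -> ball x e y ->
  exists L, [/\ compact L, connected L, L `<=` @cdisk R, L x /\ L y & L `<=` ball x e].
Proof.
move=> cx cy bxy; pose f (t : R) : R * R := (x.1 + t * (y.1 - x.1), x.2 + t * (y.2 - x.2)).
have cf : {within `[0, 1], continuous f}.
  apply: continuous_subspaceT => t.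
  apply: (@cvg_pair _ _ _ (nbhs t) (nbhs (f t).1) (nbhs (f t).2) _ _ _
    (fun t => (f t).1) (fun t => (f t).2)).
    by apply: cvgD; [apply: cvg_cst|apply: cvgMr_tmp; apply: cvg_id].
  by apply: cvgD; [apply: cvg_cst|apply: cvgMr_tmp; apply: cvg_id].
exists (f @` `[0, 1]); split.
- by apply: continuous_compact => //; exact: segment_compact.
- by apply: connected_continuous_connected => //; exact: segment_connected.
- move=> _ [t /= t01 <-]; rewrite in_itv /= in t01; case/andP: t01 => t0 t1.
  move: cx cy; rewrite /cdisk /f /=.
  case: x {bxy f cf} => x1 x2; case: y => y1 y2 /= hx hy.
  (* The three nonnegative terms add up to 1 minus the squared norm of the point. *)
  have : 0 <= (1 - t) * (1 - (x1 ^+ 2 + x2 ^+ 2)) by rewrite mulr_ge0 // subr_ge0.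
  have : 0 <= t * (1 - (y1 ^+ 2 + y2 ^+ 2)) by rewrite mulr_ge0 // subr_ge0.
  have : 0 <= t * (1 - t) * ((x1 - y1) ^+ 2 + (x2 - y2) ^+ 2).
    by apply: mulr_ge0; [rewrite mulr_ge0 ?subr_ge0|rewrite addr_ge0 ?sqr_ge0].
  by move=> h1 h2 h3; rewrite -subr_ge0; move: (addr_ge0 h1 (addr_ge0 h2 h3)); congr (_ <= _); ring.
- split.
    exists 0; rewrite /f /= ?bound_itvE // !mul0r !addr0.
    by rewrite -surjective_pairing.
  exists 1; rewrite /f /= ?bound_itvE // !mul1r !subrKC.
  by rewrite -surjective_pairing.
move=> _ [t /= t01 <-]; rewrite in_itv /= in t01; case/andP: t01 => t0 t1.
move: bxy; rewrite -!ball_normE /=; apply: le_lt_trans.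
have -> : x - f t = t *: (x - y).
  by rewrite /f [LHS]surjective_pairing [RHS]surjective_pairing /=; congr pair; rewrite /GRing.scale /=; ring.
by rewrite normrZ ger0_norm // ler_piMl.
Qed.

End Curves.

(** * The family seen from a base point on the circle *)

Section Family.
Variables (R : realType) (C : set (set (R * R))).
Hypothesis hC : curve_family C.
Implicit Types (c : set (R * R)) (p q th x y z : R * R) (s t : R).

Lemma family_curve c : C c -> is_curve c.
Proof. by case: hC => h _ _ _; exact: h. Qed.

Lemma family_endpoint c p : C c -> c p -> circle p -> endpoints c p.
Proof. by move=> Cc cp pc; rewrite endpointsE //; exact: family_curve. Qed.

Lemma family_endpoint_in c p : C c -> endpoints c p -> c p /\ circle p.
Proof. by move=> Cc; rewrite endpointsE; [|exact: family_curve]. Qed.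

Lemma family_eq_disk c c' x y : C c -> C c' -> disk x -> disk y -> x <> y ->
  c x -> c y -> c' x -> c' y -> c = c'.
Proof.
move=> Cc Cc' dx dy xy cx cy c'x c'y; case: hC => _ h _ _.
have [e [_ ue]] := h x y dx dy xy.
by rewrite -(ue c) // -(ue c').
Qed.

Lemma family_eq_circle c c' x th : C c -> C c' -> disk x -> circle th ->
  c x -> c th -> c' x -> c' th -> c = c'.
Proof.
move=> Cc Cc' dx cth cx cc c'x cc'; case: hC => _ _ _ h.
have [e [_ ue]] := h x th dx cth.
by rewrite -(ue c) ?(ue c') //; split=> //; exact: family_endpoint.
Qed.

Lemma family_two_endpoints c th : C c -> endpoints c th ->
  exists p, [/\ p <> th, circle p & endpoints c = [set th; p]].
Proof.
move=> Cc; have [g [a [b hg]]] := family_curve Cc.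
have [-> gab] := parametrizes_endpoints hg; case: (hg) => _ _ _ [ga gb _] _.
case=> ->; [exists (g b)|exists (g a)]; split=> //; first exact/nesym.
by rewrite setUC.
Qed.

Definition ray th t : set (R * R) := line C th (rotate_cw t th).

Lemma rayP th t : circle th -> 0 < t < 2 * pi ->
  C (ray th t) /\ endpoints (ray th t) = [set th; rotate_cw t th].
Proof.
move=> cth ht; rewrite /ray /line; case: xgetP => [c _ []//|/(_ _)].
case: hC => _ _ h _ nex.
have [|c [hc _]] := h th (rotate_cw t th) cth (circle_rotate_cw t cth).
  by move=> /esym; apply: rotate_cw_neq.
by case: (nex c).
Qed.

Lemma ray_eq th t c : circle th -> 0 < t < 2 * pi -> C c ->
  endpoints c = [set th; rotate_cw t th] -> c = ray th t.
Proof.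
move=> cth ht Cc ec; case: hC => _ _ h _.
have [|e [_ ue]] := h th (rotate_cw t th) cth (circle_rotate_cw t cth).
  by move=> /esym; apply: rotate_cw_neq.
by rewrite -(ue c) // -(ue (ray th t)) //; exact: rayP.
Qed.

Lemma ray_C th t : circle th -> 0 < t < 2 * pi -> C (ray th t).
Proof. by move=> cth /(rayP cth)[]. Qed.

Lemma ray_curve th t : circle th -> 0 < t < 2 * pi -> is_curve (ray th t).
Proof. by move=> cth /(ray_C cth); exact: family_curve. Qed.

Lemma ray_base th t : circle th -> 0 < t < 2 * pi -> ray th t th.
Proof.
move=> cth ht; have [Cr er] := rayP cth ht.
by apply: (family_endpoint_in Cr _).1; rewrite er; left.
Qed.

Lemma ray_end th t : circle th -> 0 < t < 2 * pi -> ray th t (rotate_cw t th).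
Proof.
move=> cth ht; have [Cr er] := rayP cth ht.
by apply: (family_endpoint_in Cr _).1; rewrite er; right.
Qed.

Lemma ray_circle th t x : circle th -> 0 < t < 2 * pi -> ray th t x -> circle x ->
  x <> th -> x = rotate_cw t th.
Proof.
move=> cth ht rx cx xth; have [Cr er] := rayP cth ht.
by have := family_endpoint Cr rx cx; rewrite er => -[].
Qed.

Lemma family_ray c th : C c -> circle th -> c th ->
  exists2 t, 0 < t < 2 * pi & c = ray th t.
Proof.
move=> Cc cth cc; have [p [pth cp ep]] := family_two_endpoints Cc (family_endpoint Cc cc cth).
exists (cw_angle th p); first exact: cw_angle_gt0.
apply: ray_eq => //; first exact: cw_angle_gt0.
by rewrite (cw_angleP cth cp).2.
Qed.

(* The position of the point x of the closed disk as seen from th: the clockwise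
   angle from th to x_th, where x_th = x if x is on the circle. *)
Definition fcoord th x : R :=
  cw_angle th (if `[< circle x >] then x else projection C x th).

Lemma fcoord_circle th x : circle x -> fcoord th x = cw_angle th x.
Proof. by move=> cx; rewrite /fcoord; case: asboolP. Qed.

Lemma fcoord_disk th x : disk x -> fcoord th x = cw_angle th (projection C x th).
Proof. by move=> /disk_not_circle dx; rewrite /fcoord; case: asboolP. Qed.

Lemma fcoordP th x : circle th -> cdisk x -> x <> th ->
  0 < fcoord th x < 2 * pi /\ ray th (fcoord th x) x.
Proof.
move=> cth /cdiskP[dx|cx] xth; last first.
  rewrite fcoord_circle //; have h := cw_angle_gt0 cth cx xth; split=> //.
  by have := ray_end cth h; rewrite (cw_angleP cth cx).2.
rewrite fcoord_disk //.
have [Cc cx eth] : [/\ C (curve_to C x th), curve_to C x th x &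
    endpoints (curve_to C x th) th].
  rewrite /curve_to; case: xgetP => [c _ []//|/(_ _) nex].
  case: hC => _ _ _ h; have [c [hc _]] := h x th dx cth; by case: (nex c).
have [ep pth] : endpoints (curve_to C x th) (projection C x th) /\
    projection C x th <> th.
  rewrite /projection; case: xgetP => [p _ []//|/(_ _) nex].
  have [p [pth cp ec]] := family_two_endpoints Cc eth.
  by case: (nex p); split=> //; rewrite ec; right.
have cp := (family_endpoint_in Cc ep).2.
have ht := cw_angle_gt0 cth cp pth; split=> //.
rewrite -(@ray_eq _ _ (curve_to C x th)) //.
have [q [qth cq ec]] := family_two_endpoints Cc eth.
rewrite (cw_angleP cth cp).2; rewrite ec in ep *.
by case: ep => // ->.
Qed.

(** By uniqueness in (C2) and (C3), [ray th t] is the ray that defines the coordinate of [x]; hence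
    the other ends agree. *)
Lemma fcoord_ray th t x : circle th -> 0 < t < 2 * pi -> ray th t x -> x <> th ->
  fcoord th x = t.
Proof.
move=> cth ht rx xth; have Cr := ray_C cth ht.
have cdx := curve_cdisk (family_curve Cr) rx.
have [cx|dx] := cdiskP cdx; last first.
  rewrite fcoord_circle // (ray_circle cth ht rx dx xth) cw_angle_rotate //.
  by move: ht => /andP[/ltW-> ->].
have [hf rf] := fcoordP cth cdx xth.
have Cf := ray_C cth hf.
have e := family_eq_circle Cr Cf cx cth rx (ray_base cth ht) rf (ray_base cth hf).
have re : ray th t (rotate_cw (fcoord th x) th) by rewrite e; apply: ray_end.
have := ray_circle cth ht re (circle_rotate_cw _ cth) (rotate_cw_neq cth hf).
by apply: rotate_cw_inj => //; apply/andP; split; case/andP: hf ht => ? ? /andP[? ?] //; apply: ltW.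
Qed.

Lemma fcoord_rotate th t : circle th -> 0 < t < 2 * pi ->
  fcoord th (rotate_cw t th) = t.
Proof.
by move=> cth ht; apply: fcoord_ray => //; [apply: ray_end|apply: rotate_cw_neq].
Qed.

(** Points with equal coordinate lie on one ray from [th]. If they were distinct, uniqueness would
    make [c] equal to that ray, which contains [th]. *)
Lemma fcoord_inj th c x y : circle th -> C c -> ~ c th -> c x -> c y ->
  fcoord th x = fcoord th y -> x = y.
Proof.
move=> cth Cc nc cx cy e.
have cdx := curve_cdisk (family_curve Cc) cx.
have cdy := curve_cdisk (family_curve Cc) cy.
have xth : x <> th by move=> h; apply: nc; rewrite -h.
have yth : y <> th by move=> h; apply: nc; rewrite -h.
have [hx rx] := fcoordP cth cdx xth; have [hy ry] := fcoordP cth cdy yth.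
rewrite -e in hy ry; have Cr := ray_C cth hx.
have cN : c = ray th (fcoord th x) -> False.
  by move=> h; apply: nc; rewrite h; apply: ray_base.
have [dx|ccx] := cdiskP cdx; have [dy|ccy] := cdiskP cdy.
- apply: contrapT => xy; apply: cN; exact: (family_eq_disk Cc Cr dx dy).
- by case: cN; apply: (family_eq_circle Cc Cr dx ccy).
- by case: cN; apply: (family_eq_circle Cc Cr dy ccx).
by rewrite (ray_circle cth hx rx ccx xth) (ray_circle cth hx ry ccy yth).
Qed.

(* If x and x0 lay on different sides of [ray th al], their rays towards the
   circle, joined by a straight segment missing [ray th al], would cross it. *)
Lemma fcoord_near_side th x0 al : circle th -> cdisk x0 -> x0 <> th ->
  0 < al < 2 * pi -> al <> fcoord th x0 ->
  \forall x \near x0, cdisk x -> x <> th ->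
    fcoord th x <> al /\ (fcoord th x < al) = (fcoord th x0 < al).
Proof.
move=> cth cd0 x0th hal al0; have Cr := ray_C cth hal.
have nr0 : ~ ray th al x0 by move=> h; apply: al0; rewrite (fcoord_ray cth hal h).
have : nbhs x0 (~` ray th al).
  apply: open_nbhs_nbhs; split=> //; apply: closed_openC.
  exact: curve_closed (family_curve Cr).
move=> /nbhs_ballP[e /= e0 be]; apply/nbhs_ballP; exists e => // x bx cdx xth.
have nrx : ~ ray th al x by exact: be.
have [hx rx] := fcoordP cth cdx xth.
have [h0 r0] := fcoordP cth cd0 x0th.
have fal : fcoord th x <> al by move=> h; apply: nrx; rewrite -h.
split=> //; apply: contrapT => hne.
have [K [K1 K2 K3 K4 [K5 K6]]] := curve_subarc (ray_curve cth hx) (rayP cth hx).2 rx xth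
  (rotate_cw_neq cth hx).
have [K' [K1' K2' K3' K4' [K5' K6']]] := curve_subarc (ray_curve cth h0) (rayP cth h0).2 r0 x0th
  (rotate_cw_neq cth h0).
have [S [S1 S2 S3 [S4 S5] S6]] := straight_segment_cdisk cd0 cdx bx.
pose L := K `|` S `|` K'.
have cL : compact L by apply: compactU => //; apply: compactU.
have nL : connected L.
  apply: connectedU => //; first by exists x0; split=> //; right.
  by apply: connectedU => //; exists x.
have LD : L `<=` @cdisk R.
  move=> z [[/K3|/S3//]|/K3'].
    exact: (curve_cdisk (ray_curve cth hx)).
  exact: (curve_cdisk (ray_curve cth h0)).
have meet : ray th al `&` L !=set0.
  have lt_ne s t : s <> t -> s < t \/ t < s.
    by move=> st; case: (ltgtP s t) => h; [left|right|].
  have [xl|xl] := lt_ne _ _ fal; have [al_|al_] := lt_ne _ _ al0.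
  - apply: (@crossing _ th _ _ (fcoord th x) al (fcoord th x0)) => //.
    + by case/andP: hx.
    + by case/andP: h0.
    + exact: curve_compact (family_curve Cr).
    + exact: curve_connected (family_curve Cr).
    + exact: curve_cdisk (family_curve Cr).
    + exact: ray_base.
    + exact: ray_end.
    + by left; left.
    + by right.
  - by case: hne; rewrite xl al_.
  - by case: hne; rewrite !ltNge !ltW.
  - apply: (@crossing _ th _ _ (fcoord th x0) al (fcoord th x)) => //.
    + by case/andP: h0.
    + by case/andP: hx.
    + exact: curve_compact (family_curve Cr).
    + exact: curve_connected (family_curve Cr).
    + exact: curve_cdisk (family_curve Cr).
    + exact: ray_base.
    + exact: ray_end.
    + by right.
    + by left; left.
have [z [rz [[Kz|Sz]|Kz]]] := meet.
- have zth : z <> th by move=> h; apply: K6; rewrite -h.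
  by apply: fal; rewrite -(fcoord_ray cth hal rz zth) (fcoord_ray cth hx (K3 _ Kz) zth).
- exact: be (S6 _ Sz) rz.
- have zth : z <> th by move=> h; apply: K6'; rewrite -h.
  by apply: al0; rewrite -(fcoord_ray cth hal rz zth) (fcoord_ray cth h0 (K3' _ Kz) zth).
Qed.

Lemma fcoord_near_lt th x0 al : circle th -> cdisk x0 -> x0 <> th ->
  fcoord th x0 < al -> \forall x \near x0, cdisk x -> x <> th -> fcoord th x < al.
Proof.
move=> cth cd0 x0th h; have [/andP[h0 h1] _] := fcoordP cth cd0 x0th.
(* For [al >= 2 * pi] there is no ray at angle [al], but every coordinate is below it. *)
case: (ltP al (2 * pi)) => al2.
  have hal : 0 < al < 2 * pi by rewrite (lt_trans h0 h) al2.
  have nal : al <> fcoord th x0 by move=> e; rewrite e ltxx in h.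
  apply: filterS (fcoord_near_side cth cd0 x0th hal nal) => x hx cdx xth.
  by case: (hx cdx xth) => _ ->.
apply: (@filterE _ (nbhs x0)) => x cdx xth; have [/andP[_ h2] _] := fcoordP cth cdx xth.
exact: lt_le_trans h2 al2.
Qed.

Lemma fcoord_near_gt th x0 al : circle th -> cdisk x0 -> x0 <> th ->
  al < fcoord th x0 -> \forall x \near x0, cdisk x -> x <> th -> al < fcoord th x.
Proof.
move=> cth cd0 x0th h; have [/andP[h0 h1] _] := fcoordP cth cd0 x0th.
case: (ltP 0 al) => al0.
  have hal : 0 < al < 2 * pi by rewrite al0 (lt_trans h h1).
  have nal : al <> fcoord th x0 by move=> e; rewrite e ltxx in h.
  apply: filterS (fcoord_near_side cth cd0 x0th hal nal) => x hx cdx xth.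
  case: (hx cdx xth) => /eqP ne; rewrite [RHS]ltNge (ltW h) /= => /negbT.
  by rewrite -leNgt le_eqVlt eq_sym (negbTE ne).
apply: (@filterE _ (nbhs x0)) => x cdx xth; have [/andP[h2 _] _] := fcoordP cth cdx xth.
exact: le_lt_trans al0 h2.
Qed.

Lemma fcoord_continuous_within th (A : set (R * R)) : circle th ->
  A `<=` @cdisk R -> ~ A th -> {within A, continuous (fcoord th)}.
Proof.
move=> cth AD Ath; apply/subspace_continuousP => x Ax.
have xth : x <> th by move=> e; apply: Ath; rewrite -e.
apply/cvgrPdist_lt => e e0.
have xe1 : fcoord th x < fcoord th x + e by rewrite ltrDl.
have xe2 : fcoord th x - e < fcoord th x by rewrite ltrBlDr ltrDl.
rewrite near_withinE; near=> y => Ay.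
have yth : y <> th by move=> h; apply: Ath; rewrite -h.
have h1 : fcoord th x - e < fcoord th y.
  move: (AD _ Ay) yth; near: y.
  exact: fcoord_near_gt cth (AD _ Ax) xth xe2.
have h2 : fcoord th y < fcoord th x + e.
  move: (AD _ Ay) yth; near: y.
  exact: fcoord_near_lt cth (AD _ Ax) xth xe1.
by rewrite ltr_distlC h1 h2.
Unshelve. all: by end_near. Qed.

End Family.

(** * Order along curves and betweenness *)

Section Order.
Variables (R : realType) (C : set (set (R * R))).
Hypothesis hC : curve_family C.
Implicit Types (c : set (R * R)) (p q th x y z : R * R) (s t : R).

Local Notation F := (fcoord C).
Local Notation ray := (ray C).

(** Join [x] to the circle point at half its coordinate. Were [th] on this curve, it would be the
    ray through [x], whose only other end is at the full angle. *)
Lemma exists_transversal th x : circle th -> disk x -> exists c, [/\ C c, c x & ~ c th].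
Proof.
move=> cth dx; have xth : x <> th by move=> e; apply: (disk_not_circle dx); rewrite e.
have [hf rf] := fcoordP hC cth (disk_cdisk dx) xth.
pose t := F th x / 2; have ht : 0 < t < 2 * pi by rewrite /t; lra.
case: (hC) => _ _ _ /(_ x (rotate_cw t th) dx (circle_rotate_cw t cth)).
move=> [c [[Cc cx ec] _]]; exists c; split=> // cc.
have e := family_eq_circle hC Cc (ray_C hC cth hf) dx cth cx cc rf (ray_base hC cth hf).
have [ct _] := family_endpoint_in hC Cc ec; rewrite e in ct.
have := ray_circle hC cth hf ct (circle_rotate_cw t cth) (rotate_cw_neq cth ht).
move=> /(rotate_cw_inj cth) h; have : t = F th x; last by rewrite /t; lra.
by apply: h; lra.
Qed.

Lemma fcoord_param_continuous th c (g : R -> R * R) a b : circle th -> C c -> ~ c th ->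
  parametrizes c g a b -> {within `[a, b], continuous (fun t => F th (g t))}.
Proof.
move=> cth Cc nc hg; case: (hg) => ab cg ig _ ec.
have ingc t : t \in `[a, b] -> c (g t) by move=> tab; apply: parametrizes_in hg tab.
apply/subspace_continuousP => s sab.
have /subspace_continuousP/(_ _ sab) cgs := cg.
have cF := @fcoord_continuous_within _ _ hC th c cth (curve_cdisk (family_curve hC Cc)) nc.
have /subspace_continuousP/(_ _ (ingc _ sab)) cFs := cF.
move=> U /cFs HU; have HV := cgs _ HU.
by apply: (@filterS _ (nbhs s)) HV => t Ht tab; apply: Ht => //; apply: ingc.
Qed.

Lemma fcoord_monotone th c (g : R -> R * R) a b : circle th -> C c -> ~ c th ->
  parametrizes c g a b ->
  {in `[a, b] &, {mono (fun t => F th (g t)) : s t / s < t}} \/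
  {in `[a, b] &, {mono (fun t => F th (g t)) : s t /~ s < t}}.
Proof.
move=> cth Cc nc hg; case: (hg) => ab cg ig _ ec.
have ingc t : t \in `[a, b] -> c (g t) by move=> tab; apply: parametrizes_in hg tab.
pose h := (fun t => F th (g t)).
have ih : {in `[a, b] &, injective h}.
  move=> s t sab tab e; apply: ig => //.
  exact: (fcoord_inj hC cth Cc nc (ingc _ sab) (ingc _ tab)).
have ch : {within `[a, b], continuous h} := fcoord_param_continuous cth Cc nc hg.
have fab : h a < h b \/ h b < h a.
  have [ia ib] := parametrizes_bounds hg.
  case: (ltgtP (h a) (h b)) => [||e]; [by left|by right|].
  by have := ih _ _ ia ib e => e'; rewrite e' ltxx in ab.
case: fab => [/ltW|/ltW] fab.
  by left; apply/leW_mono_in/segment_continuous_inj_le.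
by right; apply/leW_nmono_in/segment_continuous_inj_ge.
Qed.

Lemma curve_throughP x y : disk x -> disk y -> x <> y ->
  [/\ C (curve_through C x y), curve_through C x y x & curve_through C x y y].
Proof.
move=> dx dy xy; rewrite /curve_through; case: xgetP => [c _ []//|/(_ _) nex].
by case: hC => _ /(_ x y dx dy xy)[c [hc _]] _ _; case: (nex c).
Qed.

Definition between (r s t : R) := (r <= s <= t) || (t <= s <= r).

Lemma betweenC (r s t : R) : between r s t = between t s r.
Proof. by rewrite /between orbC. Qed.

Lemma between_minmax (r s t : R) : (Num.min r t <= s <= Num.max r t) = between r s t.
Proof.
rewrite /between; case: (leP r t) => rt.
  case: (boolP (r <= s <= t)) => //= /negP h.
  by apply/esym/negP => /andP[h1 h2]; apply: h; apply/andP; lra.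
case: (boolP (t <= s <= r)) => [_|/negP h]; rewrite ?orbT // orbF.
by apply/esym/negP => /andP[h1 h2]; apply: h; apply/andP; lra.
Qed.

Lemma fcoord_between th c (g : R -> R * R) a b r s t : circle th -> C c -> ~ c th ->
  parametrizes c g a b -> r \in `[a, b] -> s \in `[a, b] -> t \in `[a, b] ->
  between (F th (g r)) (F th (g s)) (F th (g t)) = between r s t.
Proof.
move=> cth Cc nc hg ra sa ta; rewrite /between.
by case: (fcoord_monotone cth Cc nc hg) => h; rewrite !leNgt !h // orbC andbC [X in _ || X]andbC.
Qed.

Lemma fcoord_const th c x y : circle th -> C c -> c th -> c x -> c y -> x <> th -> y <> th ->
  F th x = F th y.
Proof.
move=> cth Cc cc cx cy xth yth; have [t ht e] := family_ray hC Cc cth cc.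
by rewrite e in cx cy; rewrite (fcoord_ray hC cth ht cx xth) (fcoord_ray hC cth ht cy yth).
Qed.

(** Lets segments be handled through one base point off their curve, so that parametrizations with
    different domains or orientations never have to be compared. *)
Lemma segmentP th x y : disk x -> disk y -> x <> y -> circle th ->
  ~ curve_through C x y th ->
  segment C x y = [set z | curve_through C x y z /\ between (F th x) (F th z) (F th y)].
Proof.
move=> dx dy xy cth nc; have [Cc cx cy] := curve_throughP dx dy xy.
apply/seteqP; split=> z.
  move=> [g [a [b [s [t [hg [sab es] [tab et] [u hu ez]]]]]]].
  have uab : u \in `[a, b].
    move: sab tab hu; rewrite !in_itv /= ge_min le_max.
    by move=> /andP[? ?] /andP[? ?] /andP[/orP[] ? /orP[] ?]; apply/andP; split; lra.
  rewrite ez; split; first exact: parametrizes_in hg uab.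
  by rewrite -{1}es -{1}et (fcoord_between cth Cc nc hg) // -between_minmax.
have [g [a [b hg]]] := family_curve hC Cc.
have ec : curve_through C x y = g @` `[a, b] by case: hg.
move=> [cz bz]; rewrite /segment /=; exists g, a, b.
move: (cx) (cy) (cz); rewrite {1 2 3}ec => -[s sab ex] -[t tab ey] -[u uab ez].
exists s, t; split=> //; exists u => //.
rewrite between_minmax -(fcoord_between cth Cc nc hg) //.
by rewrite ex ey ez.
Qed.

(** A curve has only two points on the circle; take one halfway round from one to the other. *)
Lemma exists_off_curve c : C c -> exists th, circle th /\ ~ c th.
Proof.
move=> Cc; have [g [a [b hg]]] := family_curve hC Cc.
case: (hg) => _ _ _ [ca _ _] _; have [ia _] := parametrizes_bounds hg.
have [t ht e] := family_ray hC Cc ca (parametrizes_in hg ia).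
have ht2 : 0 < t / 2 < 2 * pi by lra.
exists (rotate_cw (t / 2) (g a)); split; first exact: circle_rotate_cw.
rewrite e => h.
have := ray_circle hC ca ht h (circle_rotate_cw _ ca) (rotate_cw_neq ca ht2).
move=> /(rotate_cw_inj ca) h'; have : t / 2 = t; last by lra.
by apply: h'; lra.
Qed.

Lemma segment_sub x y : disk x -> disk y -> x <> y ->
  segment C x y `<=` curve_through C x y `&` @disk R.
Proof.
move=> dx dy xy z [g [a [b [s [t [hg [sab es] [tab et] [u hu ez]]]]]]].
rewrite ez; rewrite -es in dx; rewrite -et in dy.
have uab : u \in `[a, b].
  move: sab tab hu; rewrite !in_itv /= ge_min le_max.
    by move=> /andP[? ?] /andP[? ?] /andP[/orP[] ? /orP[] ?]; apply/andP; split; lra.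
split; first exact: parametrizes_in hg uab.
case: (hg) => _ _ _ [ca cb h] _.
have hs : s \in `]a, b[.
  by case: (itv_endpoints sab) => // e; case: (disk_not_circle dx); rewrite e.
have ht : t \in `]a, b[.
  by case: (itv_endpoints tab) => // e; case: (disk_not_circle dy); rewrite e.
apply: h; move: hs ht hu; rewrite !in_itv /= ge_min le_max.
by move=> /andP[? ?] /andP[? ?] /andP[/orP[] ? /orP[] ?]; apply/andP; split; lra.
Qed.

(** Base points on the curve are covered too: they see the whole segment at a single angle, and
    [between] is weak. *)
Lemma segment_between th x y z : disk x -> disk y -> x <> y -> circle th ->
  segment C x y z -> between (F th x) (F th z) (F th y).
Proof.
move=> dx dy xy cth sz; have [Cc cx cy] := curve_throughP dx dy xy.
have [cc|nc] := pselect (curve_through C x y th); last first.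
  by move: sz; rewrite (segmentP dx dy xy cth nc) => -[].
have [cz dz] := segment_sub dx dy xy sz.
have ne p : disk p -> p <> th by move=> dp e; apply: (disk_not_circle dp); rewrite e.
rewrite (fcoord_const cth Cc cc cx cz (ne _ dx) (ne _ dz)).
by rewrite (fcoord_const cth Cc cc cy cz (ne _ dy) (ne _ dz)) /between !lexx.
Qed.

Lemma open_disk : open (@disk R).
Proof.
have -> : @disk R = (fun p : R * R => p.1 ^+ 2 + p.2 ^+ 2) @^-1` [set t | t < 1] by [].
apply: open_comp; last exact: open_lt.
move=> p _; apply: (@cvgD _ _ _ _ _ (fun p : R * R => p.1 ^+ 2) (fun p => p.2 ^+ 2)).
  by apply: (@cvgM _ _ _ _ fst fst); apply: cvg_fst.
by apply: (@cvgM _ _ _ _ snd snd); apply: cvg_snd.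
Qed.

Lemma closed_cdisk : closed (@cdisk R).
Proof.
have -> : @cdisk R = (fun p : R * R => p.1 ^+ 2 + p.2 ^+ 2) @^-1` [set t | t <= 1] by [].
apply: preimage_closed; last exact: closed_le.
move=> p _; apply: (@cvgD _ _ _ _ _ (fun p : R * R => p.1 ^+ 2) (fun p => p.2 ^+ 2)).
  by apply: (@cvgM _ _ _ _ fst fst); apply: cvg_fst.
by apply: (@cvgM _ _ _ _ snd snd); apply: cvg_snd.
Qed.

(* F th is strictly monotone along a curve through x that avoids th. *)
Lemma open_extends (P : set (R * R)) th x : open P -> P `<=` @disk R -> P x -> circle th ->
  (exists2 y, P y & F th y < F th x) /\ (exists2 y, P y & F th x < F th y).
Proof.
move=> oP PD Px cth; have dx := PD _ Px.
have [c [Cc cx nc]] := exists_transversal cth dx.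
have [g [a [b hg]]] := family_curve hC Cc.
case: (hg) => ab cg ig [ga gb _] ec; move: (cx); rewrite {1}ec => -[s sab ex].
have /andP[as_ sb] : a < s < b.
  case: (itv_endpoints sab) => [e|e|]; last by rewrite in_itv.
    by case: (disk_not_circle dx); rewrite -ex e.
  by case: (disk_not_circle dx); rewrite -ex e.
have nP : \forall t \near s, t \in `[a, b] -> P (g t).
  have /subspace_continuousP/(_ _ sab) cgs := cg.
  apply: (cgs P); apply: open_nbhs_nbhs; split=> //.
  by move: Px; rewrite -ex.
have [e /= e0 he] := (nbhs_ballP _ _).1 nP.
pose e1 := Num.min (e / 2) (Num.min (s - a) (b - s)).
have e10 : 0 < e1 by rewrite !lt_min !subr_gt0 as_ sb divr_gt0.
have e1e : e1 < e.
  by apply: (le_lt_trans (_ : _ <= e / 2)); [rewrite ge_min lexx|lra].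
have e1a : e1 <= s - a by rewrite !ge_min lexx orbT.
have e1b : e1 <= b - s by rewrite !ge_min lexx !orbT.
have i1 : s - e1 \in `[a, b] by rewrite in_itv /=; apply/andP; split; lra.
have i2 : s + e1 \in `[a, b] by rewrite in_itv /=; apply/andP; split; lra.
have P1 : P (g (s - e1)).
  by apply: he => //; rewrite -ball_normE /= opprB addrC subrK gtr0_norm.
have P2 : P (g (s + e1)).
  by apply: he => //; rewrite -ball_normE /= opprD addrA subrr sub0r normrN gtr0_norm.
have l1 : s - e1 < s by lra.
have l2 : s < s + e1 by lra.
case: (fcoord_monotone cth Cc nc hg) => h; split.
- by exists (g (s - e1)) => //; rewrite -ex h.
- by exists (g (s + e1)) => //; rewrite -ex h.
- by exists (g (s + e1)) => //; rewrite -ex h.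
- by exists (g (s - e1)) => //; rewrite -ex h.
Qed.

End Order.

(** * Wedges as strips of the coordinate, and the extreme angles of the polygon *)

Section Wedges.
Variables (R : realType) (C : set (set (R * R))).
Hypothesis hC : curve_family C.
Implicit Types (c : set (R * R)) (p q th x y z : R * R) (s t : R).

Local Notation F := (fcoord C).
Local Notation ray := (ray C).

Lemma disk_neq_circle x th : disk x -> circle th -> x <> th.
Proof. by move=> dx cth e; apply: (disk_not_circle dx); rewrite e. Qed.

Lemma norm_cdisk x : cdisk x -> `|x| <= 1.
Proof.
rewrite /cdisk /= prod_normE ge_max => h.
have h1 : x.1 ^+ 2 <= 1 by have := sqr_ge0 x.2; lra.
have h2 : x.2 ^+ 2 <= 1 by have := sqr_ge0 x.1; lra.
by apply/andP; split; apply/ler_normlP; split; nra.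
Qed.

Lemma norm_outside x : ~ disk x -> 1 / 2 <= `|x|.
Proof.
move=> nd; case: leP => // h; case: nd; rewrite /disk /=.
have /ltr_normlP[h1 h2] := le_lt_trans (norm_fst x) h.
have /ltr_normlP[h3 h4] := le_lt_trans (norm_snd x) h.
by nra.
Qed.

(** The radial half-line: it leads to infinity without returning to the closed disk. The point
    itself may be on the circle, whence the exception for [y = x]. *)
Lemma halfline_outside x : ~ disk x -> exists B, [/\ connected B, B x,
  forall y, B y -> y = x \/ ~ cdisk y & forall M : R, exists2 y, B y & M < `|y|].
Proof.
move=> nd; pose f (t : R) : R * R := (t * x.1, t * x.2).
have cf : {within `[1, +oo[, continuous f}.
  apply: continuous_subspaceT => t.
  apply: (@cvg_pair _ _ _ (nbhs t) (nbhs (f t).1) (nbhs (f t).2) _ _ _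
    (fun t => (f t).1) (fun t => (f t).2)).
    by apply: cvgMr_tmp; apply: cvg_id.
  by apply: cvgMr_tmp; apply: cvg_id.
exists (f @` `[1, +oo[); split.
- apply: connected_continuous_connected => //.
  by apply/connected_intervalP; exact: interval_is_interval.
- exists 1; first by rewrite /= in_itv /= lexx.
  by rewrite /f !mul1r -surjective_pairing.
- move=> _ [t /= + <-]; rewrite in_itv /= andbT le_eqVlt => /orP[/eqP <-|t1].
    by left; rewrite /f !mul1r -surjective_pairing.
  right; rewrite /cdisk /f /= => h; apply: nd; rewrite /disk /=.
  have h' : (x.1 ^+ 2 + x.2 ^+ 2) * t ^+ 2 <= 1 by rewrite (le_trans _ h) // !exprMn; lra.
  have t2 : 1 < t ^+ 2 by rewrite expr2; nra.
  have := sqr_ge0 x.1; have := sqr_ge0 x.2.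
  by nra.
- move=> M; pose t := 2 * (`|M| + 1).
  have M0 := normr_ge0 M; have MM := ler_norm M.
  exists (f t); first by exists t => //=; rewrite in_itv /= andbT /t; lra.
  have -> : f t = t *: x by rewrite /f [RHS]surjective_pairing.
  rewrite normrZ ger0_norm; last by rewrite /t; lra.
  by have := norm_outside nd; rewrite /t; nra.
Qed.

Definition strip th (al be : R) : set (R * R) :=
  [set x | disk x /\ al < F th x < be].

Lemma open_strip th al be : circle th -> open (strip th al be).
Proof.
move=> cth; rewrite openE => x [dx /andP[h1 h2]].
have xth := disk_neq_circle dx cth; have cdx := disk_cdisk dx.
have n0 : nbhs x (@disk R) by apply: open_nbhs_nbhs; split=> //; exact: open_disk.
have n1 := fcoord_near_gt hC cth cdx xth h1.
have n2 := fcoord_near_lt hC cth cdx xth h2.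
apply: (@filterS3 _ (nbhs x) _ _ _ _ _ _ n0 n1 n2) => y dy g1 g2.
have yth := disk_neq_circle dy cth; have cdy := disk_cdisk dy.
by split=> //; rewrite g1 ?g2.
Qed.

(** The strip is relatively clopen in the complement of the closed curve [J], so a component meeting
    it stays inside and is bounded. Any other point off [J] is joined to infinity without meeting
    [J]. *)
Lemma wedgeE th xi eta : clockwise th eta xi ->
  wedge C th xi eta = strip th (cw_angle th eta) (cw_angle th xi).
Proof.
move=> [cth ceta cxi /andP[al0 albe]].
have [/andP[_ eta2] eetaE] := cw_angleP cth ceta.
have [/andP[_ xi2] exiE] := cw_angleP cth cxi.
set al := cw_angle th eta in al0 albe eta2 eetaE *.
set be := cw_angle th xi in albe xi2 exiE *.
have hal : 0 < al < 2 * pi by rewrite al0.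
have hbe : 0 < be < 2 * pi by rewrite (lt_trans al0 albe).
have -> : wedge C th xi eta = enclosed (ray th be `|` ray th al `|` circle_arc th eta xi).
  by rewrite /wedge /ray exiE eetaE.
set J := _ `|` _.
have JD : J `<=` @cdisk R.
  move=> z [[/(curve_cdisk (ray_curve hC cth hbe))//|/(curve_cdisk (ray_curve hC cth hal))//]|[cz _]].
  exact: circle_cdisk.
have Jth : J th by left; left; exact: ray_base.
have Jcirc z : circle z -> al <= F th z <= be -> J z.
  by move=> cz h; right; split=> //; rewrite -(fcoord_circle C th cz).
have Jray z : cdisk z -> z <> th -> F th z = al \/ F th z = be -> J z.
  move=> cdz zth h; have [_ rz] := fcoordP hC cth cdz zth.
  by left; case: h => e; [right|left]; rewrite -e.
have JF z : J z -> z <> th -> al <= F th z <= be.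
  move=> [[rz|rz]|[cz h]] zth.
  - by rewrite (fcoord_ray hC cth hbe rz zth) lexx ltW.
  - by rewrite (fcoord_ray hC cth hal rz zth) lexx ltW.
  - by rewrite (fcoord_circle C th cz).
have UJ z : strip th al be z -> ~ J z.
  move=> [dz /andP[h1 h2]] [[rz|rz]|[cz _]].
  - by rewrite (fcoord_ray hC cth hbe rz (disk_neq_circle dz cth)) ltxx in h2.
  - by rewrite (fcoord_ray hC cth hal rz (disk_neq_circle dz cth)) ltxx in h1.
  - exact: (disk_not_circle dz).
(* A limit point keeps the weak inequalities by continuity; equality, or lying on the circle, would
   put it on [J]. *)
have clU z : closure (strip th al be) z -> ~ J z -> strip th al be z.
  move=> clz nJ.
  have cdz : cdisk z.
    rewrite ((closure_id _).1 (@closed_cdisk R)).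
    by apply: closureS clz => w [/disk_cdisk].
  have zth : z <> th by move=> e; apply: nJ; rewrite e.
  have h1 : al <= F th z.
    rewrite leNgt; apply/negP => h.
    have [w [[dw /andP[g1 _]] hw]] := clz _ (fcoord_near_lt hC cth cdz zth h).
    by have := lt_trans g1 (hw (disk_cdisk dw) (disk_neq_circle dw cth)); rewrite ltxx.
  have h2 : F th z <= be.
    rewrite leNgt; apply/negP => h.
    have [w [[dw /andP[_ g1]] hw]] := clz _ (fcoord_near_gt hC cth cdz zth h).
    by have := lt_trans g1 (hw (disk_cdisk dw) (disk_neq_circle dw cth)); rewrite ltxx.
  have [dz|cz] := cdiskP cdz; last by case: nJ; apply: Jcirc => //; rewrite h1 h2.
  split=> //; rewrite !lt_neqAle h1 h2 !andbT; apply/andP; split; apply/eqP => e; apply: nJ.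
    by apply: Jray => //; left.
  by apply: Jray => //; right.
apply/seteqP; split=> x.
  move=> [nJ bd]; apply: contrapT => nU.
  have [B [nB Bx BJ Bbig]] : exists B, [/\ connected B, B x, B `<=` ~` J &
      forall M : R, exists2 y, B y & M < `|y|].
    have [dx|ndx] := pselect (disk x); last first.
      have [B [B1 B2 B3 B4]] := halfline_outside ndx; exists B; split=> //.
      by move=> y /B3[->//|ncd] /JD.
    have xth := disk_neq_circle dx cth; have cdx := disk_cdisk dx.
    have [hx rx] := fcoordP hC cth cdx xth.
    have out : ~ (al <= F th x <= be).
      move=> /andP[h1 h2]; apply: nU; split=> //; rewrite !lt_neqAle h1 h2 !andbT.
      apply/andP; split; apply/eqP => e; apply: nJ.
        by apply: Jray => //; left.
      by apply: Jray => //; right.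
    (* From a point of the disk whose coordinate is outside the range, follow its ray to the circle
       at constant coordinate, hence off [J], and then go out radially. *)
    have [K [K1 K2 K3 K4 [K5 K6]]] := curve_subarc (ray_curve hC cth hx) (rayP hC cth hx).2
      rx xth (rotate_cw_neq cth hx).
    have KJ : K `<=` ~` J.
      move=> z Kz Jz; have zth : z <> th by move=> e; apply: K6; rewrite -e.
      apply: out; rewrite -(fcoord_ray hC cth hx (K3 _ Kz) zth); exact: JF.
    have ndp : ~ disk (rotate_cw (F th x) th).
      by move=> /disk_not_circle; apply; exact: circle_rotate_cw.
    have [B [B1 B2 B3 B4]] := halfline_outside ndp; exists (K `|` B); split.
    - by apply: connectedU => //; exists (rotate_cw (F th x) th).
    - by left.
    - by move=> y [/KJ//|/B3[->|ncd /JD//]]; exact: KJ.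
    - by move=> M; have [y By My] := B4 M; exists y => //; right.
  have sub := connected_component_max Bx BJ nB.
  case: bd => M [_ hM]; have [y By] := Bbig (M + 1).
  by rewrite ltNge => /negP; apply; apply: (hM (M + 1)); [rewrite ltrDl|apply: sub].
move=> Ux; have nJ := UJ _ Ux; split=> //.
suff sub : connected_component (~` J) x `<=` strip th al be.
  exists 1; split=> [|M M1 z /sub[/disk_cdisk/norm_cdisk dz _]]; first exact: num_real.
  exact: le_trans dz (ltW M1).
move=> y [A [Ax AJ nA] Ay].
have : A `&` strip th al be = A.
  apply: nA.
  - by exists x.
  - by exists (strip th al be) => //; exact: open_strip.
  - exists (closure (strip th al be)); first exact: closed_closure.
    apply/seteqP; split=> z [Az hz]; split=> //; first exact: subset_closure.
    by apply: clU => //; exact: AJ.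
by move=> e; have [] : (A `&` strip th al be) y by rewrite e.
Qed.

(** Every angle in ]0, 2 pi[ is attained in the disk, so a nonempty strip determines its bounds. The
    witness [m] in ]al, be[ is taken on the wrong side of the supposedly narrower bound. *)
Lemma strip_sub th al be al' be' : circle th -> 0 < al < 2 * pi -> 0 < be < 2 * pi ->
  al < be -> strip th al be `<=` strip th al' be' -> al' <= al /\ be <= be'.
Proof.
move=> cth hal hbe albe sub.
have ex t : 0 < t < 2 * pi -> exists2 x, disk x & F th x = t.
  move=> ht; have [g [a [b hg]]] := ray_curve hC cth ht.
  case: (hg) => ab _ _ [_ _ hd] e; exists (g ((a + b) / 2)).
    by apply: hd; rewrite in_itv /=; apply/andP; split; lra.
  apply: (fcoord_ray hC cth ht).
    by apply: parametrizes_in hg _; rewrite in_itv /=; apply/andP; split; lra.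
  apply: disk_neq_circle => //; apply: hd.
  by rewrite in_itv /=; apply/andP; split; lra.
have hsub t : al < t < be -> al' < t < be'.
  move=> /andP[t1 t2]; have [|x dx e] := ex t; first by apply/andP; split; lra.
  by have [|_] := sub x; [split=> //; rewrite e t1|rewrite e].
split; rewrite leNgt; apply/negP => h.
  pose m := Num.min al' ((al + be) / 2).
  have m1 : m <= al' by rewrite /m ge_min lexx.
  have m2 : m <= (al + be) / 2 by rewrite /m ge_min lexx orbT.
  have m3 : al < m by rewrite lt_min h /=; lra.
  have /andP[] : al' < m < be' by apply: hsub; apply/andP; split; lra.
  by lra.
pose m := Num.max be' ((al + be) / 2).
have m1 : be' <= m by rewrite /m le_max lexx.
have m2 : (al + be) / 2 <= m by rewrite /m le_max lexx orbT.
have m3 : m < be by rewrite gt_max h /=; lra.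
have /andP[] : al' < m < be' by apply: hsub; apply/andP; split; lra.
by lra.
Qed.

Variables (P : set (R * R)) (sides : seq ((R * R) * (R * R))).
Hypothesis hP : convex_polygon C P sides.

Lemma polygon_disk : P `<=` @disk R. Proof. by case: hP => -[]. Qed.
Lemma polygon_open : open P. Proof. by case: hP => -[]. Qed.
Lemma polygon_neq0 : P !=set0. Proof. by case: hP => -[]. Qed.

(** Sides are segments between points of the open disk, so the boundary never reaches the circle. *)
Lemma polygon_boundary v : boundary P v -> disk v /\ ~ P v.
Proof.
move=> hb; split; last first.
  by case: hb => _ hi Pv; apply: hi; rewrite (interior_id P).1 //; exact: polygon_open.
case: hP => _ _ hs e; move: hb; rewrite e => -[s /= ss /segment_sub].
by have [d1 d2 ne] := hs s ss; move=> /(_ d1 d2 ne)[].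
Qed.

Lemma polygon_closure v : closure P v -> P v \/ boundary P v.
Proof.
move=> cl; have [Pv|nP] := pselect (P v); [by left|right].
by split=> // /interior_subset.
Qed.

Lemma polygon_closure_disk : closure P `<=` @disk R.
Proof. by move=> v /polygon_closure[/polygon_disk//|/polygon_boundary[]]. Qed.

Lemma polygon_closure_compact : compact (closure P).
Proof.
pose I : set R := `[-1, 1]%classic.
apply: (@subclosed_compact (R * R)%type _ (I `*` I)).
- exact: closed_closure.
- by apply: compact_setX; apply: segment_compact.
- move=> x /polygon_closure_disk/disk_cdisk/norm_cdisk h.
  have /ler_normlP[h1 h2] := le_trans (norm_fst x) h.
  have /ler_normlP[h3 h4] := le_trans (norm_snd x) h.
  by split; rewrite /I /= in_itv /=; apply/andP; split; lra.
Qed.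

(** The extremes are attained on the compact closure; they are not attained on [P], where an open
    set always contains points of smaller and larger coordinate. *)
Lemma polygon_extremes th : circle th -> exists m M,
  [/\ 0 < m < M /\ M < 2 * pi, forall x, P x -> m < F th x < M,
      forall t, m < t -> exists2 x, P x & F th x < t
    & forall t, t < M -> exists2 x, P x & t < F th x].
Proof.
move=> cth; have [x0 Px0] := polygon_neq0.
have K0 : closure P !=set0 by exists x0; apply: subset_closure.
have cF : {within closure P, continuous (F th)}.
  apply: fcoord_continuous_within => //.
    by move=> x /polygon_closure_disk/disk_cdisk.
  by move=> /polygon_closure_disk/disk_not_circle.
have [u /set_mem clu umin] := compact_EVT_min K0 polygon_closure_compact cF.
have [v /set_mem clv vmax] := compact_EVT_max K0 polygon_closure_compact cF.
have Cl x : P x -> x \in closure P by move=> Px; apply/mem_set/subset_closure.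
have du := polygon_closure_disk clu; have dv := polygon_closure_disk clv.
have [/andP[u0 _] _] := fcoordP hC cth (disk_cdisk du) (disk_neq_circle du cth).
have [/andP[_ v2] _] := fcoordP hC cth (disk_cdisk dv) (disk_neq_circle dv cth).
have str x : P x -> F th u < F th x < F th v.
  move=> Px; have [[y Py h1] [z Pz h2]] := open_extends hC polygon_open polygon_disk Px cth.
  by rewrite (le_lt_trans (umin _ (Cl _ Py)) h1) (lt_le_trans h2 (vmax _ (Cl _ Pz))).
exists (F th u), (F th v); split=> //.
- split=> //; rewrite u0 /=; by have /andP[h1 h2] := str _ Px0; exact: lt_trans h1 h2.
- move=> t ut; have [y [Py hy]] := clu _ (fcoord_near_lt hC cth (disk_cdisk du) (disk_neq_circle du cth) ut).
  by exists y => //; have dy := polygon_disk Py; apply: hy; [exact: disk_cdisk|exact: disk_neq_circle].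
- move=> t tv; have [y [Py hy]] := clv _ (fcoord_near_gt hC cth (disk_cdisk dv) (disk_neq_circle dv cth) tv).
  by exists y => //; have dy := polygon_disk Py; apply: hy; [exact: disk_cdisk|exact: disk_neq_circle].
Qed.

(** The angles of eta_theta and xi_theta, identified in [lo_hiP] with the infimum and supremum of
    the coordinate on [P]. *)
Definition lo th : R := cw_angle th (g2 C P th).
Definition hi th : R := cw_angle th (g1 C P th).

(** The strip between the extreme coordinates lies in every wedge containing [P], hence is itself a
    minimal wedge. The wedge chosen by [g12] contains it and is minimal, so the two coincide, and so
    do their bounds. *)
Lemma lo_hiP th : circle th ->
  [/\ 0 < lo th < hi th /\ hi th < 2 * pi, forall x, P x -> lo th < F th x < hi th,
      forall t, lo th < t -> exists2 x, P x & F th x < t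
    & forall t, t < hi th -> exists2 x, P x & t < F th x].
Proof.
move=> cth; have [m [M [[/andP[m0 mM] M2] PmM Pm PM]]] := polygon_extremes cth.
have hm : 0 < m < 2 * pi by rewrite m0 (lt_trans mM M2).
have hM : 0 < M < 2 * pi by rewrite M2 (lt_trans m0 mM).
have cwm : cw_angle th (rotate_cw m th) = m by rewrite cw_angle_rotate //; case/andP: hm => /ltW-> ->.
have cwM : cw_angle th (rotate_cw M th) = M by rewrite cw_angle_rotate //; case/andP: hM => /ltW-> ->.
have clk0 : clockwise th (rotate_cw m th) (rotate_cw M th).
  by split; rewrite ?cwm ?cwM ?m0 //; exact: circle_rotate_cw.
have Pstrip xi eta : clockwise th eta xi -> P `<=` wedge C th xi eta ->
    cw_angle th eta <= m /\ M <= cw_angle th xi.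
  move=> hc; rewrite wedgeE // => sub; split; rewrite leNgt; apply/negP.
    move=> /Pm[x /sub[_ /andP[h1 _]] h2].
    by have := lt_trans h1 h2; rewrite ltxx.
  move=> /PM[x /sub[_ /andP[_ h1]] h2].
  by have := lt_trans h1 h2; rewrite ltxx.
have hmin : minimal_wedge C P th (rotate_cw M th) (rotate_cw m th).
  split=> //.
    by rewrite wedgeE // cwm cwM => x Px; split; [exact: polygon_disk|exact: PmM].
  move=> xi eta hc sub sub2; apply/seteqP; split=> //.
  have [h1 h2] := Pstrip _ _ hc sub.
  rewrite !wedgeE // cwm cwM => x [dx /andP[h3 h4]]; split=> //.
  by rewrite (le_lt_trans h1 h3) (lt_le_trans h4 h2).
have [hc sub hmin'] : minimal_wedge C P th (g1 C P th) (g2 C P th).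
  rewrite /g1 /g2 /g12; case: xgetP => [q _ //|/(_ _) nex].
  by case: (nex (rotate_cw M th, rotate_cw m th)).
have [h1 h2] := Pstrip _ _ hc sub.
have := hmin' _ _ clk0; case: hmin => _ sub0 _ /(_ sub0).
rewrite !wedgeE // cwm cwM => H.
have sub3 : strip th m M `<=` strip th (cw_angle th (g2 C P th)) (cw_angle th (g1 C P th)).
  move=> x [dx /andP[h3 h4]]; split=> //.
  by rewrite (le_lt_trans h1 h3) (lt_le_trans h4 h2).
have e := H sub3.
case: hc => _ cg2 cg1 /andP[g20 g21].
have [/andP[_ g12]] := cw_angleP cth cg1.
have [||||k1 k2] := @strip_sub th (cw_angle th (g2 C P th)) (cw_angle th (g1 C P th)) m M cth.
- by rewrite g20 (lt_trans g21 g12).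
- by rewrite (lt_trans g20 g21) g12.
- exact: g21.
- by rewrite -e.
have elo : lo th = m by apply/eqP; rewrite eq_le h1 k1.
have ehi : hi th = M by apply/eqP; rewrite eq_le h2 k2.
by rewrite elo ehi m0 mM.
Qed.

End Wedges.

(** * Moving the base point along the circle *)

Section Basepoint.
Variables (R : realType) (C : set (set (R * R))).
Hypothesis hC : curve_family C.
Implicit Types (c : set (R * R)) (p q th x y z : R * R) (s t : R).

Local Notation F := (fcoord C).
Local Notation ray := (ray C).

Lemma cw_angle_shift th s t : circle th -> 0 <= s - t < 2 * pi ->
  cw_angle (rotate_cw t th) (rotate_cw s th) = s - t.
Proof.
move=> cth h; have {1}-> : s = t + (s - t) by rewrite addrC subrK.
by rewrite -rotate_cwD cw_angle_rotate //; exact: circle_rotate_cw.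
Qed.

(** The coordinate is injective and monotone along [c], and [p] and [q] are the two ends of [c]. *)
Lemma fcoord_strictly_between tau c x p q : circle tau -> C c -> ~ c tau -> disk x -> c x ->
  circle p -> circle q -> c p -> c q -> p <> q ->
  cw_angle tau p < cw_angle tau q ->
  cw_angle tau p < F tau x < cw_angle tau q.
Proof.
move=> ctau Cc nc dx cx cp cq pc qc pq lt_pq.
have [g [a [b hg]]] := family_curve hC Cc.
have [ia ib] := parametrizes_bounds hg.
have ec : c = g @` `[a, b] by case: hg.
have [s sab es] : exists2 s, s \in `[a, b] & g s = x by move: cx; rewrite {1}ec.
have [u uab eu] : exists2 u, u \in `[a, b] & g u = p by move: pc; rewrite {1}ec.
have [v vab ev] : exists2 v, v \in `[a, b] & g v = q by move: qc; rewrite {1}ec.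
have btw : between u s v.
  have cu : circle (g u) by rewrite eu.
  have cv : circle (g v) by rewrite ev.
  move: sab; rewrite in_itv /between /= => sab.
  have [eu'|eu'] := parametrizes_circle hg uab cu; have [ev'|ev'] := parametrizes_circle hg vab cv.
  - by case: pq; rewrite -eu -ev eu' ev'.
  - by rewrite eu' ev' sab.
  - by rewrite eu' ev' sab orbT.
  - by case: pq; rewrite -eu -ev eu' ev'.
rewrite -(fcoord_between hC ctau Cc nc hg) // es eu ev in btw.
have xp : F tau x <> F tau p.
  move=> e; apply: (disk_not_circle dx).
  by rewrite (fcoord_inj hC ctau Cc nc cx pc e).
have xq : F tau x <> F tau q.
  move=> e; apply: (disk_not_circle dx).
  by rewrite (fcoord_inj hC ctau Cc nc cx qc e).
move: btw lt_pq; rewrite -!(fcoord_circle C tau) // /between.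
move/eqP: xp => xp; move/eqP: xq => xq.
case/orP => /andP[]; rewrite !le_eqVlt ![_ == F tau x]eq_sym (negbTE xp) (negbTE xq) /=.
  by move=> -> ->.
move=> h1 h2 h3; exfalso; move: (lt_trans h1 h2) h3 => h4 h5.
by have := lt_trans h4 h5; rewrite ltxx.
Qed.

(** The curve from [x] to the circle point at angle [be] must end on the far side of the coordinate
    of [x]. Such curves trap [x] when the base point moves. *)
Lemma fcoord_other_end th x (be : R) : circle th -> disk x -> 0 < be < 2 * pi ->
  be <> F th x -> exists c ga, [/\ C c, c x /\ ~ c th, 0 < ga < 2 * pi,
    c (rotate_cw be th) /\ c (rotate_cw ga th)
  & be <> ga /\ ((be < F th x < ga) \/ (ga < F th x < be))].
Proof.
move=> cth dx hbe ne; have cbe := circle_rotate_cw be cth.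
case: (hC) => _ _ _ /(_ x (rotate_cw be th) dx cbe)[c [[Cc cx ec] _]].
have [p [pne cp ep]] := family_two_endpoints hC Cc ec.
have [cbec _] := family_endpoint_in hC Cc ec.
have [pc _] : c p /\ circle p by apply: (family_endpoint_in hC Cc); rewrite ep; right.
have nc : ~ c th.
  move=> cc; have [t ht e] := family_ray hC Cc cth cc; apply: ne.
  rewrite e in cx cbec.
  rewrite (fcoord_ray hC cth ht cx (disk_neq_circle dx cth)).
  by rewrite -(fcoord_ray hC cth ht cbec (rotate_cw_neq cth hbe)) fcoord_rotate.
have pth : p <> th by move=> e; apply: nc; rewrite -e.
have hga := cw_angle_gt0 cth cp pth.
have ep' : rotate_cw (cw_angle th p) th = p by have [] := cw_angleP cth cp.
have cwbe : cw_angle th (rotate_cw be th) = be by rewrite cw_angle_rotate //; case/andP: hbe => /ltW-> ->.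
have nbg : be <> cw_angle th p by move=> e; apply: pne; rewrite -ep' -e.
exists c, (cw_angle th p); rewrite ep'; split=> //; split=> //.
have := @fcoord_strictly_between th c x _ _ cth Cc nc dx cx.
move=> H; case: (ltgtP be (cw_angle th p)) => [h|h|//]; [left|right].
  by have := H _ _ cbe cp cbec pc (nesym pne); rewrite cwbe; apply.
by have := H _ _ cp cbe pc cbec pne; rewrite cwbe; apply.
Qed.

Lemma rotate_cw_neq_lt th s t : circle th -> s < t -> t - s < 2 * pi ->
  rotate_cw t th <> rotate_cw s th.
Proof.
move=> cth st ts; have := @rotate_cw_neq _ (rotate_cw s th) (t - s) (circle_rotate_cw s cth).
by rewrite rotate_cwD subrKC; apply; rewrite subr_gt0 st.
Qed.

Lemma family_third_point c p q r : C c -> circle p -> circle q -> circle r ->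
  c p -> c q -> p <> q -> p <> r -> q <> r -> ~ c r.
Proof.
move=> Cc cp cq cr pc qc pq pr qr rc.
have [z [_ _ ez]] := family_two_endpoints hC Cc (family_endpoint hC Cc rc cr).
have := family_endpoint hC Cc pc cp.
have := family_endpoint hC Cc qc cq.
rewrite ez => -[/qr//|qz] [/pr//|pz].
by apply: pq; rewrite pz qz.
Qed.

(** The moved base point lies on the arc complementary to the one from [s] to [s'], so both ends of
    [c] are seen in the same order, at angles shifted by [t], with [x] between them. *)
Lemma fcoord_base_between th x c s s' t : circle th -> disk x -> C c -> c x ->
  c (rotate_cw s th) -> c (rotate_cw s' th) ->
  s < s' -> t < s -> s' - t < 2 * pi -> s - t < F (rotate_cw t th) x < s' - t.
Proof.
move=> cth dx Cc cx cs cs' ss' ts s't.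
have w1 : cw_angle (rotate_cw t th) (rotate_cw s th) = s - t.
  by apply: cw_angle_shift => //; apply/andP; split; lra.
have w2 : cw_angle (rotate_cw t th) (rotate_cw s' th) = s' - t.
  by apply: cw_angle_shift => //; apply/andP; split; lra.
have Ccirc u : circle (rotate_cw u th) by exact: circle_rotate_cw.
have n1 : rotate_cw s th <> rotate_cw t th by apply: rotate_cw_neq_lt => //; lra.
have n2 : rotate_cw s' th <> rotate_cw t th by apply: rotate_cw_neq_lt => //; lra.
have n3 : rotate_cw s th <> rotate_cw s' th by apply/nesym/rotate_cw_neq_lt => //; lra.
rewrite -w1 -w2; apply: (@fcoord_strictly_between _ c) => //.
  exact: (family_third_point Cc (Ccirc s) (Ccirc s')).
by rewrite w1 w2; lra.
Qed.

(** Three curves through [x] trap its coordinate: the ray from [th], and the curves with an end at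
    [be1] or [be2], slightly before and after the coordinate. For [t > 0] the ray bounds from below
    and the second curve from above; for [t < 0] the ray bounds from above and the first curve from
    below. *)
Lemma fcoord_base_near th x (e : R) : circle th -> disk x -> 0 < e ->
  exists2 d, 0 < d & forall t, `|t| < d -> `|F (rotate_cw t th) x - F th x| < e.
Proof.
move=> cth dx e0; have xth := disk_neq_circle dx cth.
have [hb rb] := fcoordP hC cth (disk_cdisk dx) xth.
set b0 := F th x in hb rb *; have [/andP[b00 b02]] := (hb, rb).
move=> {}rb; have Cr := ray_C hC cth hb.
pose be2 := Num.min (b0 + e / 2) ((b0 + 2 * pi) / 2).
have be2a : be2 <= b0 + e / 2 by rewrite ge_min lexx.
have be2b : b0 < be2 by rewrite lt_min; apply/andP; split; lra.
have be2c : be2 <= (b0 + 2 * pi) / 2 by rewrite ge_min lexx orbT.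
pose be1 := Num.max (b0 - e / 2) (b0 / 2).
have be1a : b0 - e / 2 <= be1 by rewrite le_max lexx.
have be1b : be1 < b0 by rewrite gt_max; apply/andP; split; lra.
have be1c : b0 / 2 <= be1 by rewrite le_max lexx orbT.
have hbe2 : 0 < be2 < 2 * pi by apply/andP; split; lra.
have hbe1 : 0 < be1 < 2 * pi by apply/andP; split; lra.
have ne2 : be2 <> F th x by rewrite -/b0; lra.
have ne1 : be1 <> F th x by rewrite -/b0; lra.
have [c2 [ga2 [Cc2 [c2x nc2] /andP[ga20 ga22] [c2be c2ga] [beg2 ord2]]]] := fcoord_other_end cth dx hbe2 ne2.
have [c1 [ga1 [Cc1 [c1x nc1] /andP[ga10 ga12] [c1be c1ga] [beg1 ord1]]]] := fcoord_other_end cth dx hbe1 ne1.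
have g2b : ga2 < b0.
  by case: ord2 => /andP[] // /(lt_trans be2b); rewrite ltxx.
have g1b : b0 < ga1.
  by case: ord1 => /andP[] // _ /(lt_trans be1b); rewrite ltxx.
have r0 : rotate_cw 0 th = th by exact: rotate_cw0.
have r2pi : rotate_cw (2 * pi) th = th by rewrite -[2 * pi]add0r rotate_cwD2pi.
have rth : ray th b0 th by exact: ray_base.
have rend : ray th b0 (rotate_cw b0 th) by exact: ray_end.
(* Small enough that the moved base point does not pass the far end [ga2] or [ga1] of the trapping
   curve. *)
pose d := Num.min (e / 2) (Num.min ga2 (2 * pi - ga1)).
have d1 : d <= e / 2 by rewrite ge_min lexx.
have d2 : d <= ga2 by rewrite !ge_min lexx orbT.
have d3 : d <= 2 * pi - ga1 by rewrite !ge_min lexx !orbT.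
exists d; first by rewrite !lt_min subr_gt0 ga12 ga20 divr_gt0.
move=> t /ltr_normlP[t1 t2]; case: (ltgtP t 0) => t0.
- have /andP[_ h1] : 0 - t < F (rotate_cw t th) x < b0 - t.
    by apply: (fcoord_base_between cth dx Cr) => //; [rewrite r0|lra].
  have /andP[h2 _] : be1 - t < F (rotate_cw t th) x < ga1 - t.
    by apply: (fcoord_base_between cth dx Cc1) => //; lra.
  by apply/ltr_normlP; split; lra.
- have /andP[h1 _] : b0 - t < F (rotate_cw t th) x < 2 * pi - t.
    by apply: (fcoord_base_between cth dx Cr) => //; [rewrite r2pi|lra|lra].
  have /andP[_ h2] : ga2 - t < F (rotate_cw t th) x < be2 - t.
    by apply: (fcoord_base_between cth dx Cc2) => //; lra.
  by apply/ltr_normlP; split; lra.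
- by rewrite t0 r0 -/b0 subrr normr0.
Qed.

Lemma fcoord_base_continuous th x : circle th -> disk x ->
  continuous (fun t => F (rotate_cw t th) x).
Proof.
move=> cth dx t0; apply/cvgrPdist_lt => e e0.
have [d d0 hd] := fcoord_base_near (circle_rotate_cw t0 cth) dx e0.
apply/nbhs_ballP; exists d => // t /= ht.
have := hd (t - t0); rewrite rotate_cwD subrKC => h; rewrite distrC; apply: h.
by rewrite distrC.
Qed.

Variables (P : set (R * R)) (sides : seq ((R * R) * (R * R))).
Hypothesis hP : convex_polygon C P sides.

(** Near a given base point, two fixed points of [P] with smaller and larger coordinate keep that of
    [x] away from [lo] and [hi]; compactness of the circle makes the gap uniform. *)
Lemma lo_hi_gap x : P x -> exists2 e, 0 < e &
  forall th, circle th -> e <= F th x - lo C P th /\ e <= hi C P th - F th x.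
Proof.
move=> Px; have PD := polygon_disk hP; have dx := PD _ Px.
have o1 : circle ((1, 0) : R * R) by rewrite /circle /= expr1n expr0n addr0.
pose r t : R * R := rotate_cw t ((1, 0) : R * R).
have cr t : circle (r t) by exact: circle_rotate_cw.
have cF y : disk y -> continuous (fun t => F (r t) y) by exact: fcoord_base_continuous.
pose Q (e : R) (t : R) := e <= F (r t) x - lo C P (r t) /\ e <= hi C P (r t) - F (r t) x.
(* Compactness of the interval of angles in covering form, along [e] tending to 0 from the right. *)
have /compact_near_coveringP/(_ _ (0%R^'+) Q _) cov := @segment_compact R 0 (2 * pi).
have loc t0 : `[0, 2 * pi]%classic t0 -> \forall t \near t0 & e \near 0%R^'+, Q e t.
  move=> _; have [[y Py hy] [z Pz hz]] := open_extends hC (polygon_open hP) PD Px (cr t0).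
  have dy := PD _ Py; have dz := PD _ Pz.
  pose e1 := (F (r t0) x - F (r t0) y) / 2; pose e2 := (F (r t0) z - F (r t0) x) / 2.
  have e10 : 0 < e1 by rewrite divr_gt0 // subr_gt0.
  have e20 : 0 < e2 by rewrite divr_gt0 // subr_gt0.
  have n1 : \forall t \near t0, e1 < F (r t) x - F (r t) y.
    apply: (@cvgr_gt _ _ (nbhs t0) _ (fun t => F (r t) x - F (r t) y) (F (r t0) x - F (r t0) y)).
      by apply: cvgB; apply: cF.
    by rewrite /e1; lra.
  have n2 : \forall t \near t0, e2 < F (r t) z - F (r t) x.
    apply: (@cvgr_gt _ _ (nbhs t0) _ (fun t => F (r t) z - F (r t) x) (F (r t0) z - F (r t0) x)).
      by apply: cvgB; apply: cF.
    by rewrite /e2; lra.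
  have n12 := filterI n1 n2.
  exists ([set t | e1 < F (r t) x - F (r t) y] `&` [set t | e2 < F (r t) z - F (r t) x],
          [set e | e < Num.min e1 e2]).
    have e120 : 0 < Num.min e1 e2 by rewrite lt_min e10 e20.
    by split; [exact: n12|have := nbhs_right_lt e120].
  move=> [t e] /= [[h1 h2]]; rewrite lt_min => /andP[h3 h4].
  have [_ hlh _ _] := lo_hiP hC hP (cr t).
  have /andP[k1 _] := hlh _ Py; have /andP[_ k2] := hlh _ Pz.
  by split; lra.
have [e [he e0]] := filter_ex (filterI (cov loc) (nbhs_right_gt (0 : R))).
exists e => // th cth; have [t [ht et]] := circle_angle o1 cth.
have [h1 h2] : Q e t by apply: he; rewrite /= in_itv /=; apply/andP; split; lra.
by move: h1 h2; rewrite /r et.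
Qed.

End Basepoint.

(** * Convexity and the sides of the polygon *)

Section Convexity.
Variables (R : realType) (C : set (set (R * R))).
Hypothesis hC : curve_family C.
Implicit Types (c : set (R * R)) (p q th x y z u v : R * R) (s t : R).

Local Notation F := (fcoord C).
Local Notation ray := (ray C).

Lemma curve_through_eq c x y : C c -> c x -> c y -> disk x -> disk y -> x <> y ->
  curve_through C x y = c.
Proof.
move=> Cc cx cy dx dy xy; have [Cd d1 d2] := curve_throughP hC dx dy xy.
exact: (family_eq_disk hC Cd Cc dx dy).
Qed.

Lemma curve_base c : C c -> exists th, circle th /\ c th.
Proof.
move=> Cc; have [g [a [b hg]]] := family_curve hC Cc.
have [ia _] := parametrizes_bounds hg; exists (g a).
by split; [case: hg => _ _ _ []|exact: parametrizes_in hg ia].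
Qed.

Lemma fcoord_on_curve th c x y : circle th -> C c -> c th -> c x -> x <> th ->
  cdisk y -> y <> th -> F th y = F th x -> c y.
Proof.
move=> cth Cc cc cx xth cdy yth e; have [t ht et] := family_ray hC Cc cth cc.
have [_ ry] := fcoordP hC cth cdy yth; rewrite et in cx *.
by rewrite -(fcoord_ray hC cth ht cx xth) -e.
Qed.

Lemma segment_in c th x y z : C c -> circle th -> ~ c th -> disk x -> disk y ->
  c x -> c y -> c z -> F th x <> F th y -> between (F th x) (F th z) (F th y) ->
  segment C x y z.
Proof.
move=> Cc cth nc dx dy cx cy cz ne btw.
have xy : x <> y by move=> e; apply: ne; rewrite e.
have e := curve_through_eq Cc cx cy dx dy xy.
by rewrite (segmentP hC dx dy xy cth) e.
Qed.

Lemma not_between (r s t : R) : ~ between r s t -> between s r t \/ between s t r.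
Proof.
rewrite /between => h; case/orP: (le_total s r) => h1; case/orP: (le_total s t) => h2;
  case/orP: (le_total r t) => h3; rewrite ?h1 ?h2 ?h3 ?orbT /=.
all: by [left|right|case: h; rewrite h1 h2 ?orbT].
Qed.

Lemma segment_ivt th x y (k : R) : disk x -> disk y -> x <> y -> circle th ->
  between (F th x) k (F th y) -> exists2 z, segment C x y z & F th z = k.
Proof.
move=> dx dy xy cth btw; have [Cc cx cy] := curve_throughP hC dx dy xy.
have [cc|nc] := pselect (curve_through C x y th).
  have e := fcoord_const hC cth Cc cc cx cy (disk_neq_circle dx cth) (disk_neq_circle dy cth).
  have [ph [cph nph]] := exists_off_curve hC Cc.
  (* Seen from a base point on the curve the coordinate is constant, so [x] serves. *)
  exists x.
    by rewrite (segmentP hC dx dy xy cph nph); split=> //; rewrite /between !lexx andbT le_total.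
  by move: btw; rewrite -e /between orbb => h; apply/eqP; rewrite eq_le.
have [g [a [b hg]]] := family_curve hC Cc.
have ec : curve_through C x y = g @` `[a, b] by case: hg.
have [s sab es] : exists2 s, s \in `[a, b] & g s = x by move: cx; rewrite {1}ec.
have [t tab et] : exists2 t, t \in `[a, b] & g t = y by move: cy; rewrite {1}ec.
pose h := fun r => F th (g r).
have ch : {within `[Num.min s t, Num.max s t], continuous h}.
  have ch := fcoord_param_continuous hC cth Cc nc hg.
  apply: continuous_subspaceW ch => r /=; move: sab tab; rewrite !in_itv /= ge_min le_max.
  by move=> /andP[? ?] /andP[? ?] /andP[/orP[] ? /orP[] ?]; apply/andP; split; lra.
have mM : Num.min s t <= Num.max s t by rewrite ge_min le_max !lexx.
have hbt : Num.min (h (Num.min s t)) (h (Num.max s t)) <= k <= Num.max (h (Num.min s t)) (h (Num.max s t)).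
  rewrite between_minmax /h; case: (leP s t) => _; rewrite es et //.
  by rewrite betweenC.
have [r] := IVT mM ch hbt; rewrite in_itv /= => hr er.
exists (g r) => //; exists g, a, b, s, t; split=> //; by exists r.
Qed.

Variables (P : set (R * R)) (sides : seq ((R * R) * (R * R))).
Hypothesis hP : convex_polygon C P sides.

Lemma polygon_convex x y z : P x -> P y -> segment C x y z -> P z.
Proof. by case: hP => _ h _ _ Px Py; exact: h. Qed.

(* z1, z2 in P lie on both sides of the curve L through z and y; a point y' of P
   close to y lies, say, across L from z1, and [z1, y'] meets L beyond u because
   the endpoint of the curve through u and z1 sees y' and y on the same side. *)
Lemma polygon_halfopen z y u : P z -> closure P y -> z <> y -> segment C z y u -> u <> y -> P u.
Proof.
move=> Pz cly zy szu uy; have PD := polygon_disk hP.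
have dz := PD _ Pz; have dy := polygon_closure_disk hP cly.
have [->//|/eqP uz] := eqVneq u z.
have [CL Lz Ly] := curve_throughP hC dz dy zy.
have [Lu du] := segment_sub dz dy zy szu.
set L := curve_through C z y in CL Lz Ly Lu.
have [th [cth Lth]] := curve_base CL.
have neth p : disk p -> p <> th by move=> dp; exact: disk_neq_circle.
have eu : F th u = F th z by apply: (fcoord_const hC cth CL) => //; exact: neth.
(* [ph] is an end of the curve through [u] and [w]: it sees these two at one angle, which separates
   the angles of [z] and [y]. *)
have side w : P w -> F th w <> F th z -> exists ph, [/\ circle ph, ~ L ph, F ph w = F ph u,
    F ph z <> F ph u & (F ph z < F ph u /\ F ph u < F ph y) \/ (F ph y < F ph u /\ F ph u < F ph z)].
  move=> Pw ne; have dw := PD _ Pw.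
  have uw : u <> w by move=> e; apply: ne; rewrite -e.
  have [Ce eu' ew] := curve_throughP hC du dw uw.
  have [ph [cph eph]] := curve_base Ce.
  have nLph : ~ L ph.
    move=> Lph; apply: ne; apply: (fcoord_const hC cth CL) => //; try exact: neth.
    by rewrite -(family_eq_circle hC Ce CL du cph eu' eph Lu Lph).
  have zu : F ph z <> F ph u by move=> /(fcoord_inj hC cph CL nLph Lz Lu)/esym.
  have yu : F ph y <> F ph u by move=> /(fcoord_inj hC cph CL nLph Ly Lu)/esym.
  exists ph; split=> //.
    by apply: (fcoord_const hC cph Ce) => //; exact: disk_neq_circle.
  have := segment_between hC dz dy zy cph szu; rewrite /between.
  move/eqP: zu => zu; move/eqP: yu => yu.
  rewrite !le_eqVlt (negbTE zu) (negbTE yu) ![F ph u == _]eq_sym (negbTE zu) (negbTE yu) /=.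
  by move=> /orP[] /andP[]; [left|right].
have finish ph k : circle ph -> ~ L ph -> L k -> P k -> F ph z <> F ph k ->
    between (F ph z) (F ph u) (F ph k) -> P u.
  move=> cph nL Lk Pk ne btw; apply: (polygon_convex Pz Pk).
  by apply: (segment_in CL cph nL) => //; exact: PD.
have [[z1 Pz1 hz1] [z2 Pz2 hz2]] := open_extends hC (polygon_open hP) PD Pz cth.
have ne1 : F th z1 <> F th z by move=> e; rewrite e ltxx in hz1.
have ne2 : F th z2 <> F th z by move=> e; rewrite e ltxx in hz2.
have [ph1 [cph1 nL1 e1 zu1 o1]] := side _ Pz1 ne1.
have [ph2 [cph2 nL2 e2 zu2 o2]] := side _ Pz2 ne2.
pose good ph p := (F ph z < F ph u /\ F ph u < F ph p) \/ (F ph p < F ph u /\ F ph u < F ph z).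
have near_good ph : circle ph -> good ph y -> \forall p \near y, disk p -> good ph p.
  move=> cph [[h1 h2]|[h1 h2]].
    have := fcoord_near_gt hC cph (disk_cdisk dy) (disk_neq_circle dy cph) h2.
    by apply: (@filterS _ (nbhs y)) => p hp dp; left; split=> //; apply: hp; [exact: disk_cdisk|exact: disk_neq_circle].
  have := fcoord_near_lt hC cph (disk_cdisk dy) (disk_neq_circle dy cph) h1.
  by apply: (@filterS _ (nbhs y)) => p hp dp; right; split=> //; apply: hp; [exact: disk_cdisk|exact: disk_neq_circle].
have [y' [Py' [g1 g2]]] := cly _ (filterI (near_good _ cph1 o1) (near_good _ cph2 o2)).
have dy' := PD _ Py'; move: g1 g2 => /(_ dy') g1 /(_ dy') g2.
have across w ph : P w -> circle ph -> ~ L ph -> F ph w = F ph u -> good ph y' ->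
    w <> y' -> between (F th w) (F th z) (F th y') -> P u.
  move=> Pw cph nL ew gy wy' btw; have dw := PD _ Pw.
  have [k sk ek] := segment_ivt dw dy' wy' cth btw.
  have Pk := polygon_convex Pw Py' sk; have dk := PD _ Pk.
  have Lk : L k by apply: (fcoord_on_curve cth CL Lth Lz) => //; [exact: neth|exact: disk_cdisk|exact: neth].
  have := segment_between hC dw dy' wy' cph sk; rewrite ew /between => bk.
  have [h1 h2] : between (F ph z) (F ph u) (F ph k) /\ F ph z <> F ph k.
    case: gy => -[h1 h2]; case/orP: bk => /andP[h3 h4].
    - by rewrite /between (ltW h1) h3; split=> // e; rewrite -e leNgt h1 in h3.
    - by have := le_lt_trans (le_trans h3 h4) h2; rewrite ltxx.
    - by have := lt_le_trans h1 (le_trans h3 h4); rewrite ltxx.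
    - by rewrite /between h4 (ltW h2) orbT; split=> // e; rewrite -e leNgt h2 in h4.
  exact: (finish ph k).
(* The auxiliary point is whichever of [z1], [z2] lies across [L] from [y']; if [y'] is on [L],
   convexity applies to [z] and [y'] directly. *)
case: (ltgtP (F th y') (F th z)) => hy'.
- apply: (across z2 ph2) => //.
    by move=> e; have := lt_trans hy' hz2; rewrite e ltxx.
  by rewrite /between (ltW hy') (ltW hz2) orbT.
- apply: (across z1 ph1) => //.
    by move=> e; have := lt_trans hz1 hy'; rewrite e ltxx.
  by rewrite /between (ltW hy') (ltW hz1).
- have Ly' : L y' by apply: (fcoord_on_curve cth CL Lth Lz) => //; [exact: neth|exact: disk_cdisk|exact: neth].
  apply: (finish ph1 y') => //.
    by case: g1 => -[h1 h2] e; [have := lt_trans h1 h2|have := lt_trans h1 h2]; rewrite e ltxx.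
  by rewrite /between; case: g1 => -[/ltW-> /ltW->]; rewrite ?orbT.
Qed.

Lemma segment_ends x y : disk x -> disk y -> x <> y -> segment C x y x /\ segment C x y y.
Proof.
move=> dx dy xy; have [Cc cx cy] := curve_throughP hC dx dy xy.
have [ph [cph nph]] := exists_off_curve hC Cc.
by rewrite (segmentP hC dx dy xy cph nph); split; split=> //; rewrite /between !lexx !andbT le_total.
Qed.

(** A point of [P] on the curve is not on the side itself, so one end of the side lies between it
    and the other end. By [polygon_halfopen] the nearer end would then belong to [P], though it is a
    boundary point. *)
Lemma side_misses (s : (R * R) * (R * R)) z : s \in sides -> P z -> ~ curve_through C s.1 s.2 z.
Proof.
move=> ss Pz Lz; case: (hP) => _ _ /(_ s ss)[d1 d2 s12] eb.
have [CL L1 L2] := curve_throughP hC d1 d2 s12.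
set L := curve_through C s.1 s.2 in CL L1 L2 Lz.
have bd w : segment C s.1 s.2 w -> boundary P w by move=> sw; rewrite eb; exists s.
have [e1 e2] := segment_ends d1 d2 s12.
have b1 := bd _ e1; have b2 := bd _ e2.
have [ph [cph nph]] := exists_off_curve hC CL.
have dz := polygon_disk hP Pz.
have notP w : boundary P w -> ~ P w by move=> /(polygon_boundary hP)[].
have nb : ~ between (F ph s.1) (F ph z) (F ph s.2).
  move=> btw; apply: (notP z) => //; apply: bd.
  apply: (segment_in CL cph nph) => //.
  by move=> /(fcoord_inj hC cph CL nph L1 L2).
have cl w : boundary P w -> closure P w by case.
have z1 : F ph z <> F ph s.1.
  by move=> /(fcoord_inj hC cph CL nph Lz L1) e; apply: (notP _ b1); rewrite -e.
have z2 : F ph z <> F ph s.2.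
  by move=> /(fcoord_inj hC cph CL nph Lz L2) e; apply: (notP _ b2); rewrite -e.
have [h|h] : between (F ph z) (F ph s.1) (F ph s.2) \/ between (F ph z) (F ph s.2) (F ph s.1).
  exact: not_between.
- apply: (notP _ b1); apply: (polygon_halfopen Pz (cl _ b2)) => //.
    by move=> e; apply: z2; rewrite e.
  exact: (segment_in CL cph nph).
- apply: (notP _ b2); apply: (polygon_halfopen Pz (cl _ b1)) => //.
  + by move=> e; apply: z1; rewrite e.
  + exact: (segment_in CL cph nph).
  + exact/nesym.
Qed.

(** No point of [P] has the coordinate of [v]; by convexity and intermediate values all of [P] is on
    one side of it, and [v] is a limit of points of [P]. *)
Lemma side_extreme (s : (R * R) * (R * R)) th v : s \in sides -> circle th -> curve_through C s.1 s.2 th ->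
  segment C s.1 s.2 v -> F th v = lo C P th \/ F th v = hi C P th.
Proof.
move=> ss cth Lth sv; case: (hP) => _ _ /(_ s ss)[d1 d2 s12] eb.
have [CL L1 L2] := curve_throughP hC d1 d2 s12.
have [Lv dv] := segment_sub d1 d2 s12 sv.
have clv : closure P v by have [] : boundary P v by rewrite eb; exists s.
have PD := polygon_disk hP.
have neq x : P x -> F th x <> F th v.
  move=> Px e; apply: (side_misses ss Px).
  apply: (fcoord_on_curve cth CL Lth Lv) => //; try exact: disk_neq_circle.
    by apply: disk_cdisk; exact: PD.
  by apply: disk_neq_circle => //; exact: PD.
have nears := (disk_cdisk dv, disk_neq_circle dv cth).
have [_ hlh hlo hhi] := lo_hiP hC hP cth.
have nolt x y : P x -> P y -> F th x < F th v -> F th v < F th y -> False.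
  move=> Px Py h1 h2.
  have xy : x <> y by move=> e; have := lt_trans h1 h2; rewrite e ltxx.
  have btw : between (F th x) (F th v) (F th y) by rewrite /between (ltW h1) (ltW h2).
  have [k sk ek] := segment_ivt (PD _ Px) (PD _ Py) xy cth btw.
  exact: neq _ (polygon_convex Px Py sk) ek.
have [x Px] := polygon_neq0 hP; case: (ltgtP (F th x) (F th v)) => h; last by case: (neq x).
- right; apply/eqP; rewrite eq_le !leNgt; apply/andP; split; apply/negP.
    move=> h2; have [y [Py hy]] := clv _ (fcoord_near_gt hC cth nears.1 nears.2 h2).
    have dy := PD _ Py; have /andP[_] := hlh _ Py.
    by move=> /(lt_trans (hy (disk_cdisk dy) (disk_neq_circle dy cth))); rewrite ltxx.
  by move=> /hhi[y Py] h2; exact: (nolt x y).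
- left; apply/eqP; rewrite eq_le !leNgt; apply/andP; split; apply/negP.
    by move=> /hlo[y Py] h2; exact: (nolt y x).
  move=> h2; have [y [Py hy]] := clv _ (fcoord_near_lt hC cth nears.1 nears.2 h2).
  have dy := PD _ Py; have /andP[h3 _] := hlh _ Py.
  by have := lt_trans h3 (hy (disk_cdisk dy) (disk_neq_circle dy cth)); rewrite ltxx.
Qed.

End Convexity.

(** * Series of nonnegative terms *)

Section Series.
Variable R : realType.
Implicit Types (u v a : R ^nat).

Lemma series_term_le u n : (forall i, 0 <= u i) -> cvgn (series u) -> u n <= limn (series u).
Proof.
move=> u0 cu; have nd : nondecreasing_seq (series u) by exact: nondecreasing_series.
apply: le_trans (nondecreasing_cvgn_le nd cu n.+1).
by rewrite seriesEnat /= big_nat_recr //= lerDr sumr_ge0.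
Qed.

Lemma lim_series_tail u a N : (forall i, 0 <= u i) -> (forall i, u i <= a i) ->
  cvgn (series a) ->
  limn (series u) <= series u N + (limn (series a) - series a N).
Proof.
move=> u0 ua ca.
have a0 i : 0 <= a i by exact: le_trans (u0 i) (ua i).
have cu := series_le_cvg u0 a0 ua ca.
have nd : nondecreasing_seq (series a) by exact: nondecreasing_series.
apply: limr_le => //; near=> n.
have Nn : (N <= n)%N by near: n; exists N.
apply: (le_trans (_ : _ <= series u N + (series a n - series a N))).
  rewrite -lerBlDl; have -> : series u n - series u N = \sum_(N <= i < n) u i by rewrite sub_series_geq.
  have -> : series a n - series a N = \sum_(N <= i < n) a i by rewrite sub_series_geq.
  by apply: ler_sum => i _.
by rewrite lerD2l lerD2r; exact: nondecreasing_cvgn_le.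
Unshelve. all: by end_near. Qed.

(* Tannery's theorem. *)
Lemma cvg_series_dominated (T : Type) (G : set_system T) {FG : Filter G}
    (f : nat -> T -> R) a :
  (\forall t \near G, forall i, 0 <= f i t <= a i) -> cvgn (series a) ->
  (forall i, f i t @[t --> G] --> 0) ->
  limn (series (fun i => f i t)) @[t --> G] --> 0.
Proof.
move=> fa ca f0; apply/cvgrPdist_lt => e e0; have e20 : 0 < e / 2 by rewrite divr_gt0.
have [N _ hN] : \forall n \near \oo, `|limn (series a) - series a n| < e / 2.
  by have /cvgrPdist_lt := ca; apply.
have sN : series (fun i => f i t) N @[t --> G] --> 0.
  rewrite /series /=; elim: N {hN} => [|N IH].
    by under eq_fun do rewrite big_geq //; exact: cvg_cst.
  under eq_fun do rewrite big_nat_recr //=.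
  by have := cvgD IH (f0 N); rewrite addr0; apply.
have /cvgrPdist_lt/(_ _ e20) hs := sN.
near=> t.
have ft : forall i, 0 <= f i t <= a i by near: t.
have f0' i : 0 <= f i t by case/andP: (ft i).
have fa' i : f i t <= a i by case/andP: (ft i).
have ct := series_le_cvg f0' (fun i => le_trans (f0' i) (fa' i)) fa' ca.
rewrite sub0r normrN ger0_norm; last first.
  by apply: limr_ge => //; near=> n; rewrite /series /= sumr_ge0.
apply: le_lt_trans (lim_series_tail N f0' fa' ca) _.
have h1 : `|limn (series a) - series a N| < e / 2 by apply: hN => /=.
have : `|0 - series (fun i => f i t) N| < e / 2 by near: t.
rewrite sub0r normrN => h2.
have := le_lt_trans (ler_norm _) h1; have := le_lt_trans (ler_norm _) h2.
by lra.
Unshelve. all: by end_near. Qed.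

End Series.

(** * The metric and the equality case of its triangle inequality *)

Section Metric.
Variables (R : realType) (C : set (set (R * R))).
Hypothesis hC : curve_family C.
Variables (P : set (R * R)) (sides : seq ((R * R) * (R * R))).
Hypothesis hP : convex_polygon C P sides.
Implicit Types (c : set (R * R)) (p q th x y z u v : R * R) (s t : R).

Local Notation F := (fcoord C).
Local Notation lo := (lo C P).
Local Notation hi := (hi C P).

(** The logarithm of (F - lo) / (hi - F), which maps ]lo, hi[ onto the real line and turns the cross
    ratio in [d_theta] into a difference. *)
Definition ell th x : R := ln (F th x - lo th) - ln (hi th - F th x).

Lemma lo_lt th x : circle th -> P x -> 0 < F th x - lo th.
Proof.
by move=> cth Px; have [_ h _ _] := lo_hiP hC hP cth; case/andP: (h _ Px) => h1 _; rewrite subr_gt0.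
Qed.

Lemma hi_gt th x : circle th -> P x -> 0 < hi th - F th x.
Proof.
by move=> cth Px; have [_ h _ _] := lo_hiP hC hP cth; case/andP: (h _ Px) => _ h1; rewrite subr_gt0.
Qed.

Lemma ell_lt th x y : circle th -> P x -> P y -> F th x < F th y -> ell th x < ell th y.
Proof.
move=> cth Px Py xy; have lx := lo_lt cth Px; have ly := lo_lt cth Py.
have hx := hi_gt cth Px; have hy := hi_gt cth Py.
rewrite /ell; apply: ltrD.
  by rewrite ltr_ln ?posrE // ltrD2r.
by rewrite ltrN2 ltr_ln ?posrE // ltrD2l ltrN2.
Qed.

Lemma ell_le th x y : circle th -> P x -> P y -> (ell th x <= ell th y) = (F th x <= F th y).
Proof.
move=> cth Px Py; case: (ltgtP (F th x) (F th y)) => [h|h|h].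
- by rewrite ltW // ell_lt.
- by apply/negbTE; rewrite -ltNge ell_lt.
- by rewrite /ell h lexx.
Qed.

Lemma ell_eq th x y : circle th -> P x -> P y -> ell th x = ell th y -> F th x = F th y.
Proof.
move=> cth Px Py e; apply/eqP; rewrite eq_le -!(ell_le cth) // e.
by rewrite lexx.
Qed.

Lemma ell_between th x y z : circle th -> P x -> P y -> P z ->
  between (ell th x) (ell th y) (ell th z) = between (F th x) (F th y) (F th z).
Proof. by move=> cth Px Py Pz; rewrite /between !ell_le. Qed.

(** The test in [d_theta] puts the larger coordinate first, which makes the logarithm
    nonnegative. *)
Lemma d_thetaE th x y : circle th -> P x -> P y ->
  d_theta C P th x y = `|ell th x - ell th y|.
Proof.
move=> cth Px Py; have PD := polygon_disk hP.
rewrite /d_theta /arc_length -!(fcoord_disk C th (PD _ _)) // -/(lo th) -/(hi th).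
have lx := lo_lt cth Px; have ly := lo_lt cth Py.
have hx := hi_gt cth Px; have hy := hi_gt cth Py.
rewrite !(distrC (lo th)) (gtr0_norm lx) (gtr0_norm ly) (gtr0_norm hx) (gtr0_norm hy).
have key u v : P u -> P v -> F th v <= F th u ->
    ln ((F th u - lo th) * (hi th - F th v) / ((F th v - lo th) * (hi th - F th u)))
    = `|ell th u - ell th v|.
  move=> Pu Pv vu; have lu := lo_lt cth Pu; have lv := lo_lt cth Pv.
  have hu := hi_gt cth Pu; have hv := hi_gt cth Pv.
  rewrite ln_div ?posrE ?mulr_gt0 // !lnM ?posrE // ger0_norm; first by rewrite /ell; ring.
  by rewrite subr_ge0 ell_le.
case: ifP => h; first exact: key.
by rewrite key // 1?distrC // ltW // ltNge h.
Qed.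

(** Both arc lengths lie between the uniform gap and 2 pi, so their logarithms are bounded; the
    series is then dominated by a multiple of that of the weights. *)
Lemma ell_bounded x : P x -> exists B, forall th, circle th -> `|ell th x| <= B.
Proof.
move=> Px; have [e e0 he] := lo_hi_gap hC hP Px.
exists (2 * (`|ln e| + `|ln (2 * pi)|)) => th cth.
have [h1 h2] := he th cth; have [[/andP[l0 lh] h2pi] hlh _ _] := lo_hiP hC hP cth.
have /andP[k1 k2] := hlh _ Px.
have lnb (t : R) : e <= t -> t <= 2 * pi -> `|ln t| <= `|ln e| + `|ln (2 * pi)|.
  move=> et t2; have t0 : 0 < t by exact: lt_le_trans et.
  have p0 : 0 < 2 * pi :> R by exact: lt_le_trans t2.
  have a1 : ln e <= ln t by rewrite ler_ln ?posrE.
  have a2 : ln t <= ln (2 * pi) by rewrite ler_ln ?posrE.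
  apply/ler_normlP; split.
    apply: (le_trans (_ : _ <= `|ln e|)); last by rewrite lerDl.
    by rewrite -normrN (le_trans _ (ler_norm _)) // lerN2.
  by apply: le_trans a2 _; rewrite (le_trans (ler_norm _)) // lerDr.
apply: le_trans (ler_normB _ _) _; rewrite mulr_natl mulr2n.
by apply: lerD; apply: lnb => //; lra.
Qed.

Variables (theta : nat -> R * R) (w : nat -> R).
Hypothesis hd : metric_data C sides theta w.

Local Notation d := (d_sum C P theta w).

Lemma theta_circle i : circle (theta i).
Proof. by case: hd => h _ _ _ _; apply: h; exists i. Qed.

Lemma w_gt0 i : 0 < w i. Proof. by case: hd. Qed.

Definition dterm x y i : R := w i * `|ell (theta i) x - ell (theta i) y|.

Lemma d_sumE x y : P x -> P y -> d x y = limn (series (dterm x y)).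
Proof.
move=> Px Py; rewrite /d_sum; congr (limn (series _)); apply/funext => i.
by rewrite /dterm d_thetaE //; exact: theta_circle.
Qed.

Lemma dterm_ge0 x y i : 0 <= dterm x y i.
Proof. by rewrite mulr_ge0 // ltW // w_gt0. Qed.

Lemma dterm_cvg x y : P x -> P y -> cvgn (series (dterm x y)).
Proof.
move=> Px Py; have [B hB] := ell_bounded Px; have [B' hB'] := ell_bounded Py.
have B0 : 0 <= B + B'.
  apply: addr_ge0; first exact: le_trans (normr_ge0 _) (hB _ (theta_circle 0)).
  exact: le_trans (normr_ge0 _) (hB' _ (theta_circle 0)).
apply: (@series_le_cvg _ _ ((B + B') *: (w : R^o ^nat))).
- exact: dterm_ge0.
- by move=> n; apply: mulr_ge0 => //; rewrite ltW // w_gt0.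
- move=> n; rewrite /dterm mulrC ler_wpM2r //; first by rewrite ltW // w_gt0.
  apply: le_trans (ler_normB _ _) _; apply: lerD; [apply: hB|apply: hB'];
  exact: theta_circle.
- by apply: is_cvg_seriesZ; case: hd.
Qed.

Lemma dterm_le x y i : P x -> P y -> dterm x y i <= d x y.
Proof.
move=> Px Py; rewrite d_sumE //.
by apply: series_term_le; [exact: dterm_ge0|exact: dterm_cvg].
Qed.

Lemma d_ge0 x y : P x -> P y -> 0 <= d x y.
Proof. by move=> Px Py; exact: le_trans (dterm_ge0 x y 0) (dterm_le 0 Px Py). Qed.

Lemma d_sym x y : P x -> P y -> d x y = d y x.
Proof.
move=> Px Py; rewrite (d_sumE Px Py) (d_sumE Py Px); congr (limn (series _)).
by apply/funext => i; rewrite /dterm distrC.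
Qed.

Lemma d_refl x : P x -> d x x = 0.
Proof.
move=> Px; rewrite d_sumE //.
have -> : dterm x x = fun=> 0 by apply/funext => i; rewrite /dterm subrr normr0 mulr0.
have -> : series (fun=> 0) = (fun=> 0 : R) by apply/funext => n; rewrite /series /= big1.
exact: lim_cst.
Qed.

Lemma d_triangle x y z : P x -> P y -> P z -> d x z <= d x y + d y z.
Proof.
move=> Px Py Pz; rewrite (d_sumE Px Py) (d_sumE Py Pz) (d_sumE Px Pz) -lim_seriesD;
  [|exact: dterm_cvg|exact: dterm_cvg].
apply: lim_series_le; first exact: dterm_cvg.
  by apply: is_cvg_seriesD; exact: dterm_cvg.
move=> n; rewrite /dterm /= -[leRHS]mulrDr ler_wpM2l //; first by rewrite ltW // w_gt0.
exact: ler_distD.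
Qed.

Lemma norm_between (a b c : R) : between a b c -> `|a - c| = `|a - b| + `|b - c|.
Proof.
rewrite /between => /orP[] /andP[h1 h2].
  by rewrite !ler0_norm ?subr_le0 //; [ring|exact: le_trans h1 h2].
by rewrite !ger0_norm ?subr_ge0 //; [ring|exact: le_trans h1 h2].
Qed.

Lemma between_norm (a b c : R) : `|a - c| = `|a - b| + `|b - c| -> between a b c.
Proof.
move=> e; have [//|/not_between[] /norm_between e'] := pselect (between a b c).
  have : `|a - b| = 0 by rewrite (distrC b a) in e'; lra.
  by move/normr0_eq0/eqP; rewrite subr_eq0 /between => /eqP->; rewrite !lexx andbT le_total.
have : `|b - c| = 0 by rewrite (distrC b a) (distrC c a) in e'; lra.
by move/normr0_eq0/eqP; rewrite subr_eq0 /between => /eqP->; rewrite !lexx andbT le_total.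
Qed.

Lemma d_additive x y z : P x -> P y -> P z ->
  (forall i, between (F (theta i) x) (F (theta i) y) (F (theta i) z)) ->
  d x z = d x y + d y z.
Proof.
move=> Px Py Pz h; rewrite (d_sumE Px Py) (d_sumE Py Pz) (d_sumE Px Pz) -lim_seriesD;
  [|exact: dterm_cvg|exact: dterm_cvg].
congr (limn (series _)); apply/funext => i.
rewrite /dterm /= -[RHS]mulrDr; congr (_ * _); apply: norm_between.
by rewrite ell_between //; exact: theta_circle.
Qed.

(** The excesses [u] in the termwise triangle inequalities are nonnegative and sum to 0, so each
    vanishes; on the real line this is betweenness. *)
Lemma d_additive_between x y z : P x -> P y -> P z -> d x z = d x y + d y z ->
  forall i, between (F (theta i) x) (F (theta i) y) (F (theta i) z).
Proof.
move=> Px Py Pz e i; have ci := theta_circle i.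
rewrite -(ell_between ci) //; apply: between_norm.
have c1 : cvgn (series (dterm x y + dterm y z)) by apply: is_cvg_seriesD; exact: dterm_cvg.
have c2 := dterm_cvg Px Pz.
pose u := dterm x y + dterm y z - dterm x z.
have u0 j : 0 <= u j.
  rewrite /u /= subr_ge0 /dterm -[leRHS]mulrDr ler_wpM2l //; first by rewrite ltW // w_gt0.
  exact: ler_distD.
have cu : cvgn (series u) by exact: is_cvg_seriesB.
have lu : limn (series u) = 0.
  rewrite /u lim_seriesB // lim_seriesD; [|exact: dterm_cvg|exact: dterm_cvg].
  by move/eqP: e; rewrite (d_sumE Px Py) (d_sumE Py Pz) (d_sumE Px Pz) eq_sym -subr_eq0 => /eqP.
have := series_term_le i u0 cu; rewrite lu => ui.
have : u i = 0 by apply/eqP; rewrite eq_le ui u0.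
have -> : u i = w i * (`|ell (theta i) x - ell (theta i) y| + `|ell (theta i) y - ell (theta i) z|)
  - w i * `|ell (theta i) x - ell (theta i) z| by rewrite mulrDr.
by move=> /subr0_eq/(mulfI (lt0r_neq0 (w_gt0 i)))/esym.
Qed.

Lemma theta_off_curve c : C c -> exists i, ~ c (theta i).
Proof.
move=> Cc; have [ph [cph nph]] := exists_off_curve hC Cc.
case: hd => _ dense _ _ _; have clph := dense _ cph.
have nb : nbhs ph (~` c).
  apply: open_nbhs_nbhs; split=> //; apply: closed_openC.
  exact: curve_closed (family_curve hC Cc).
by have [_ [[i _ <-] h]] := clph _ nb; exists i.
Qed.

(** A base point off the curve through two distinct points already separates them. *)
Lemma d_eq0 x y : P x -> P y -> d x y = 0 -> x = y.
Proof.
move=> Px Py e; apply: contrapT => xy.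
have dx := polygon_disk hP Px; have dy := polygon_disk hP Py.
have [Cc cx cy] := curve_throughP hC dx dy xy.
have [i nc] := theta_off_curve Cc; have ci := theta_circle i.
apply: xy; apply: (fcoord_inj hC ci Cc nc cx cy); apply: ell_eq => //.
have := dterm_le i Px Py; rewrite e => h.
have : dterm x y i = 0 by apply/eqP; rewrite eq_le h dterm_ge0.
by move/eqP; rewrite mulf_eq0 gt_eqF ?w_gt0 //= normr_eq0 subr_eq0 => /eqP.
Qed.

Lemma d_metric : metric_on P d.
Proof.
split.
- exact: d_ge0.
- by move=> x y Px Py; split=> [|->]; [exact: d_eq0|exact: d_refl].
- exact: d_sym.
- exact: d_triangle.
Qed.

(** Translates density in the plane into density of angles: the compact arc of angles from [e] to 2
    pi - e stays away from [th]. *)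
Lemma theta_dense th (e : R) : circle th -> 0 < e ->
  exists i t, `|t| < e /\ theta i = rotate_cw t th.
Proof.
move=> cth e0; pose K := (fun t => rotate_cw t th) @` `[e, 2 * pi - e].
have cr : {within `[e, 2 * pi - e], continuous (fun t => rotate_cw t th)}.
  apply: continuous_subspaceT => t.
  apply: (@cvg_pair _ _ _ (nbhs t) (nbhs (rotate_cw t th).1) (nbhs (rotate_cw t th).2) _ _ _
    (fun t => (rotate_cw t th).1) (fun t => (rotate_cw t th).2)).
    by apply: cvgD; apply: cvgMl_tmp; [exact: continuous_cos|exact: continuous_sin].
  by apply: cvgB; apply: cvgMl_tmp; [exact: continuous_cos|exact: continuous_sin].
have cK : closed K.
  apply: compact_closed; first exact: norm_hausdorff.
  by apply: continuous_compact => //; exact: segment_compact.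
have nK : nbhs th (~` K).
  apply: open_nbhs_nbhs; split; first exact: closed_openC.
  move=> [t /=]; rewrite in_itv /= => /andP[h1 h2]; apply: rotate_cw_neq => //.
  by apply/andP; split; lra.
case: hd => _ dense _ _ _; have [_ [[i _ <-] h]] := dense _ cth _ nK.
have [/andP[a0 a1] ea] := cw_angleP cth (theta_circle i).
set a := cw_angle th (theta i) in a0 a1 ea.
exists i; case: (ltP a e) => ae.
  by exists a; split=> //; rewrite ger0_norm.
(* An angle just below 2 pi is a small negative one. *)
exists (a - 2 * pi); split; last by rewrite -rotate_cwD2pi subrK.
rewrite ltr0_norm ?subr_lt0 //; rewrite ltNge; apply/negP => h'; apply: h.
by exists a => //=; rewrite in_itv /=; apply/andP; split; lra.
Qed.

(* Off the curve through x and z, the point y is separated from x and z as seen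
   from an endpoint of that curve, hence also from nearby base points. *)
Lemma between_segment x y z : P x -> P y -> P z -> x <> z ->
  (forall i, between (F (theta i) x) (F (theta i) y) (F (theta i) z)) ->
  segment C x z y.
Proof.
move=> Px Py Pz xz h; have PD := polygon_disk hP.
have dx := PD _ Px; have dy := PD _ Py; have dz := PD _ Pz.
have [Cc cx cz] := curve_throughP hC dx dz xz.
have [cy|ncy] := pselect (curve_through C x z y).
  have [i nc] := theta_off_curve Cc.
  by rewrite (segmentP hC dx dz xz (theta_circle i) nc).
have [th [cth cc]] := curve_base hC Cc.
have nth p : disk p -> p <> th by move=> dp; exact: disk_neq_circle.
have exz := fcoord_const hC cth Cc cc cx cz (nth _ dx) (nth _ dz).
have ney : F th y <> F th x.
  by move=> e; apply: ncy; apply: (fcoord_on_curve hC cth Cc cc cx (nth _ dx) (disk_cdisk dy) (nth _ dy)).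
(* Half the gap: if each coordinate moves by less than this, [y] stays on the same side of both [x]
   and [z]. *)
pose e := `|F th y - F th x| / 2.
have e0 : 0 < e by rewrite divr_gt0 // normr_gt0 subr_eq0; apply/eqP.
have [d1 d10 h1] := fcoord_base_near hC cth dx e0.
have [d2 d20 h2] := fcoord_base_near hC cth dy e0.
have [d3 d30 h3] := fcoord_base_near hC cth dz e0.
have m0 : 0 < Num.min d1 (Num.min d2 d3) by rewrite !lt_min d10 d20.
have [i [t [ht et]]] := theta_dense cth m0.
move: ht; rewrite !lt_min => /and3P[t1 t2 t3].
have := h i; rewrite et; have := h1 _ t1; have := h2 _ t2; have := h3 _ t3.
set a := F (rotate_cw t th) x; set b := F (rotate_cw t th) y; set c := F (rotate_cw t th) z.
rewrite -exz => /ltr_normlP[k1 k2] /ltr_normlP[k3 k4] /ltr_normlP[k5 k6].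
have ee : 2 * e = F th y - F th x \/ 2 * e = F th x - F th y.
  rewrite /e mulrC divfK ?pnatr_eq0 //.
  case: (leP 0 (F th y - F th x)) => hh; [left|right]; first by rewrite ger0_norm.
  by rewrite ltr0_norm // opprB.
clear -e0 k1 k2 k3 k4 k5 k6 ee.
by rewrite /between => /orP[] /andP[j1 j2]; exfalso; case: ee => ee; lra.
Qed.

End Metric.

(** * Blow-up at the boundary, geodesic rays and lines *)

Section Rays.
Local Opaque d_sum.
Variables (R : realType) (C : set (set (R * R))).
Hypothesis hC : curve_family C.
Variables (P : set (R * R)) (sides : seq ((R * R) * (R * R))).
Hypothesis hP : convex_polygon C P sides.
Variables (theta : nat -> R * R) (w : nat -> R).
Hypothesis hd : metric_data C sides theta w.
Implicit Types (c : set (R * R)) (th x y z v : R * R) (p q r s t : R).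

Local Notation F := (fcoord C).
Local Notation lo := (lo C P).
Local Notation hi := (hi C P).
Local Notation ell := (ell C P).
Local Notation d := (d_sum C P theta w).

Lemma ell_blowup th x v (A : R) : circle th -> disk v -> P x ->
  F th v = lo th \/ F th v = hi th ->
  \forall y \near v, P y -> A <= `|ell th x - ell th y|.
Proof.
move=> cth dv Px hv; have [[/andP[_ lh] _] _ _ _] := lo_hiP hC hP cth.
pose W := hi th - lo th; have W0 : 0 < W / 2 by rewrite divr_gt0 // subr_gt0.
have vth := disk_neq_circle dv cth; have cdv := disk_cdisk dv.
have cdP y : P y -> cdisk y by move=> /(polygon_disk hP)/disk_cdisk.
have thP y : P y -> y <> th by move=> /(polygon_disk hP) dy; exact: disk_neq_circle.
have lnlt (K a : R) : 0 < a -> a < expR K -> ln a <= K.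
  by move=> a0 aK; rewrite -[leRHS]expRK ler_ln ?posrE ?expR_gt0 // ltW.
case: hv => hv.
  (* Solves [ell th x + K + ln (W / 2) = A]. The minimum below makes the logarithm of F - lo at most
     [- K], and keeps [y] in the half of the strip next to [lo], where hi - F is at least W / 2. *)
  pose K := A - ell th x - ln (W / 2).
  have d0 : 0 < Num.min (W / 2) (expR (- K)) by rewrite lt_min W0 expR_gt0.
  have : F th v < lo th + Num.min (W / 2) (expR (- K)) by rewrite hv ltrDl.
  move=> /(fcoord_near_lt hC cth cdv vth).
  apply: (@filterS _ (nbhs v)) => y hy Py; have {hy} := hy (cdP _ Py) (thP _ Py).
  rewrite -ltrBlDl lt_min => /andP[h1 h2].
  have l0 := lo_lt hC hP cth Py; have h0 := hi_gt hC hP cth Py.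
  have k1 := lnlt _ _ l0 h2.
  have k2 : ln (W / 2) <= ln (hi th - F th y) by rewrite ler_ln ?posrE // /W; rewrite /W in h1; lra.
  apply: le_trans (ler_norm _); rewrite {2}/ell /K in k1 *.
  by set a := ell th x in k1 *; lra.
pose K := A + ell th x - ln (W / 2).
have d0 : 0 < Num.min (W / 2) (expR (- K)) by rewrite lt_min W0 expR_gt0.
have : hi th - Num.min (W / 2) (expR (- K)) < F th v by rewrite hv ltrBlDr ltrDl.
move=> /(fcoord_near_gt hC cth cdv vth).
apply: (@filterS _ (nbhs v)) => y hy Py; have {hy} := hy (cdP _ Py) (thP _ Py).
rewrite ltrBlDr -ltrBlDl lt_min => /andP[h1 h2].
have l0 := lo_lt hC hP cth Py; have h0 := hi_gt hC hP cth Py.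
have k1 := lnlt _ _ h0 h2.
have k2 : ln (W / 2) <= ln (F th y - lo th) by rewrite ler_ln ?posrE // /W; rewrite /W in h1; lra.
rewrite distrC; apply: le_trans (ler_norm _); rewrite {1}/ell /K in k1 *.
by set a := ell th x in k1 *; lra.
Qed.

Lemma boundary_base v : boundary P v ->
  exists i, F (theta i) v = lo (theta i) \/ F (theta i) v = hi (theta i).
Proof.
case: (hP) => _ _ hs eb; rewrite eb => -[s ss sv]; have [d1 d2 s12] := hs _ ss.
have [Cc _ _] := curve_throughP hC d1 d2 s12.
have [th [cth cc]] := curve_base hC Cc.
case: hd => _ _ /(_ _ ss) hr _ _; have [i _ ei] := hr _ (family_endpoint hC Cc cc cth).
by exists i; rewrite ei; exact: (side_extreme hC hP ss cth cc sv).
Qed.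

Lemma d_blowup x v (A : R) : P x -> boundary P v -> \forall y \near v, P y -> A <= d x y.
Proof.
move=> Px bv; have [dv _] := polygon_boundary hP bv.
have [i hi_] := boundary_base bv; have wi := w_gt0 hd i.
have := ell_blowup (A / w i) (theta_circle hd i) dv Px hi_.
apply: (@filterS _ (nbhs v)) => y hy Py; apply: le_trans (dterm_le hC hP hd i Px Py).
by rewrite /dterm mulrC -ler_pdivrMr //; exact: hy.
Qed.

Lemma d_blowup_cvg x v (y : nat -> R * R) : P x -> boundary P v ->
  (forall n, P (y n)) -> y n @[n --> \oo] --> v -> d x (y n) @[n --> \oo] --> +oo.
Proof.
move=> Px bv Py yv; apply/cvgryPge => A.
have := yv _ (d_blowup A Px bv).
by apply: (@filterS _ \oo) => n; apply.
Qed.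

Lemma boundary_neq x v : P x -> boundary P v -> x <> v.
Proof. by move=> Px bv e; have [_] := polygon_boundary hP bv; rewrite -e. Qed.

Lemma halfopen_sub x v : P x -> boundary P v -> segment C x v `\ v `<=` P.
Proof.
move=> Px bv z [sz zv]; have clv : closure P v by case: bv.
exact: (polygon_halfopen hC hP Px clv (boundary_neq Px bv) sz zv).
Qed.

Lemma within_comp (A : set R) (B : set (R * R)) (f : R * R -> R) (g : R -> R * R) :
  (forall t, A t -> B (g t)) -> {within A, continuous g} -> {within B, continuous f} ->
  {within A, continuous (fun t => f (g t))}.
Proof.
move=> AB /subspace_continuousP cg /subspace_continuousP cf.
apply/subspace_continuousP => s As U /(cf _ (AB _ As)) HU; have HV := cg _ As _ HU.
by apply: (@filterS _ (nbhs s)) HV => t Ht At; apply: Ht => //; exact: AB.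
Qed.

(** An affine change of parameter, decreasing if necessary, orients the segment from [x] to [v]. *)
Lemma segment_param x v : disk x -> disk v -> x <> v -> exists ga : R -> R * R,
  [/\ {within `[0, 1], continuous ga}, ga 0 = x /\ ga 1 = v,
      ga @` `[0, 1] = segment C x v, {in `[0, 1] &, injective ga}
    & forall th, circle th -> forall p q r, 0 <= p -> p <= q -> q <= r -> r <= 1 ->
        between (F th (ga p)) (F th (ga q)) (F th (ga r))].
Proof.
move=> dx dv xv; have [Cc cx cv] := curve_throughP hC dx dv xv.
have [g [a [b hg]]] := family_curve hC Cc; case: (hg) => _ cg ig _ ec.
have [s sab es] : exists2 s, s \in `[a, b] & g s = x by move: cx; rewrite {1}ec.
have [t tab et] : exists2 t, t \in `[a, b] & g t = v by move: cv; rewrite {1}ec.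
have ts : t - s != 0.
  by rewrite subr_eq0; apply/eqP => e; apply: xv; rewrite -es -et e.
pose rho (q : R) := s + q * (t - s).
have rab q : 0 <= q -> q <= 1 -> rho q \in `[a, b].
  move: sab tab; rewrite !in_itv /rho /= => /andP[? ?] /andP[? ?] ? ?.
  by apply/andP; split; nra.
have rbt p q r : p <= q -> q <= r -> between (rho p) (rho q) (rho r).
  move=> pq qr; rewrite /between /rho !lerD2l; case: (ltP 0 (t - s)) => h.
    by rewrite !ler_pM2r // pq qr.
  by apply/orP; right; rewrite !ler_wnM2r.
have crho : {within `[0, 1], continuous (fun q => g (rho q))}.
  apply/subspace_continuousP => q; rewrite /= in_itv /= => /andP[q0 q1].
  have /subspace_continuousP/(_ _ (rab _ q0 q1)) cgr := cg.
  have cr : rho q' @[q' --> q] --> rho q.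
    by apply: cvgD; [exact: cvg_cst|apply: cvgMr_tmp; exact: cvg_id].
  move=> U /cgr HU; have := cr _ HU.
  apply: (@filterS _ (nbhs q)) => q' hq' /=; rewrite in_itv /= => /andP[h0 h1].
  by apply: hq'; exact: rab.
have [ph [cph nph]] := exists_off_curve hC Cc.
have r0 : rho 0 = s by rewrite /rho mul0r addr0.
have r1 : rho 1 = t by rewrite /rho mul1r subrKC.
exists (fun q => g (rho q)); split=> //.
- by rewrite r0 r1.
- rewrite (segmentP hC dx dv xv cph nph); apply/seteqP; split=> z.
    move=> [q /=]; rewrite in_itv /= => /andP[q0 q1] <-.
    split; first exact: parametrizes_in hg (rab _ q0 q1).
    by rewrite -es -et (fcoord_between hC cph Cc nph hg) ?rab // -r0 -r1; exact: rbt.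
  move=> [cz]; move: (cz); rewrite {1}ec => -[u uab <-].
  rewrite -es -et (fcoord_between hC cph Cc nph hg) // => bu.
  exists ((u - s) / (t - s)); last by rewrite /rho divfK // subrKC.
  rewrite /= in_itv /=; case/orP: bu => /andP[h1 h2].
    have ts0 : 0 < t - s by rewrite lt_neqAle eq_sym ts subr_ge0 (le_trans h1 h2).
    by rewrite divr_ge0 ?subr_ge0 ?(le_trans h1 h2) //= ler_pdivrMr // mul1r lerD2r.
  have ts0 : t - s < 0 by rewrite lt_neqAle ts subr_le0 (le_trans h1 h2).
  rewrite ler_ndivlMr // ler_ndivrMr // mul0r mul1r subr_le0 h2 /=.
  by rewrite lerD2r.
- move=> p q; rewrite !in_itv /= => /andP[p0 p1] /andP[q0 q1] /(ig _ _ (rab _ p0 p1) (rab _ q0 q1)).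
  by move=> /addrI/(mulIf ts).
- move=> th cth p q r p0 pq qr r1'.
  have q0 := le_trans p0 pq; have q1 := le_trans qr r1'.
  have p1 := le_trans pq q1; have rr0 := le_trans q0 qr.
  have [cc|nc] := pselect (curve_through C x v th); last first.
    by rewrite (fcoord_between hC cth Cc nc hg) ?rab //; exact: rbt.
  have dg u : 0 <= u -> u <= 1 -> g (rho u) <> th.
    move=> u0 u1; apply: disk_neq_circle => //.
    have : segment C x v (g (rho u)).
      rewrite (segmentP hC dx dv xv cph nph).
      split; first exact: parametrizes_in hg (rab _ u0 u1).
      by rewrite -es -et (fcoord_between hC cph Cc nph hg) ?rab // -r0 -r1; exact: rbt.
    by move=> /(segment_sub dx dv xv)[].
  have cg' u (u0 : 0 <= u) (u1 : u <= 1) := parametrizes_in hg (rab _ u0 u1).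
  rewrite (fcoord_const hC cth Cc cc (cg' _ p0 p1) (cg' _ q0 q1) (dg _ p0 p1) (dg _ q0 q1)).
  rewrite (fcoord_const hC cth Cc cc (cg' _ rr0 r1') (cg' _ q0 q1) (dg _ rr0 r1') (dg _ q0 q1)).
  by rewrite /between !lexx.
Qed.

Lemma within_cvg_dist (A : set R) (p : R) (h k : R -> R) :
  (forall q, A q -> `|h p - h q| = `|0 - k q|) ->
  k q @[q --> within A (nbhs p)] --> 0 -> h q @[q --> within A (nbhs p)] --> h p.
Proof.
move=> hk /cvgrPdist_lt k0; apply/cvgrPdist_lt => e /k0.
rewrite !near_withinE; apply: (@filterS _ (nbhs p)) => q hq Aq.
by rewrite hk //; exact: hq.
Qed.

(** Each pseudo-metric is additive along the path, so its value between two parameters is at most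
    that between 0 and [q1]. This summable bound allows the limit to be taken term by term. *)
Lemma d_param_continuous (ga : R -> R * R) (q1 : R) : 0 <= q1 ->
  {within `[0, q1], continuous ga} -> (forall q, 0 <= q -> q <= q1 -> P (ga q)) ->
  (forall i p q r, 0 <= p -> p <= q -> q <= r -> r <= q1 ->
     between (F (theta i) (ga p)) (F (theta i) (ga q)) (F (theta i) (ga r))) ->
  {within `[0, q1], continuous (fun q => d (ga 0) (ga q))}.
Proof.
move=> q10 cga Pga btw; have PD := polygon_disk hP.
have ci := theta_circle hd.
have add p q r : 0 <= p -> p <= q -> q <= r -> r <= q1 ->
    d (ga p) (ga r) = d (ga p) (ga q) + d (ga q) (ga r).
  move=> p0 pq qr r1; have q0 := le_trans p0 pq; have qq1 := le_trans qr r1.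
  apply: (d_additive hC hP hd).
  - exact: Pga p0 (le_trans pq qq1).
  - exact: Pga q0 qq1.
  - exact: Pga (le_trans q0 qr) r1.
  - by move=> i; apply: btw.
have lbtw i p q r : 0 <= p -> p <= q -> q <= r -> r <= q1 ->
    `|ell (theta i) (ga p) - ell (theta i) (ga r)| =
    `|ell (theta i) (ga p) - ell (theta i) (ga q)| + `|ell (theta i) (ga q) - ell (theta i) (ga r)|.
  move=> p0 pq qr r1; have q0 := le_trans p0 pq; have qq1 := le_trans qr r1.
  apply: norm_between; rewrite (ell_between hC hP (ci i)); first exact: btw.
  - exact: Pga p0 (le_trans pq qq1).
  - exact: Pga q0 qq1.
  - exact: Pga (le_trans q0 qr) r1.
apply/subspace_continuousP => p; rewrite /= in_itv /= => /andP[p0 p1].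
have Pp := Pga _ p0 p1.
have dom i q : 0 <= q -> q <= q1 -> dterm C P theta w (ga p) (ga q) i <= dterm C P theta w (ga 0) (ga q1) i.
  move=> q0 qq1; rewrite /dterm ler_wpM2l //; first by rewrite ltW // (w_gt0 hd).
  wlog pq : p q p0 p1 q0 qq1 {Pp} / p <= q.
    by move=> H; case/orP: (le_total p q) => pq; [|rewrite distrC]; apply: H.
  rewrite (lbtw i 0 p q1) // (lbtw i p q q1) //.
  rewrite addrCA lerDl; exact: addr_ge0.
have key : d (ga p) (ga q) @[q --> within `[0, q1] (nbhs p)] --> 0.
  apply: cvg_trans (@cvg_series_dominated _ _ (within `[0, q1] (nbhs p)) _
    (fun i q => dterm C P theta w (ga p) (ga q) i) (dterm C P theta w (ga 0) (ga q1)) _ _ _).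
  - apply: near_eq_cvg; rewrite near_withinE; apply: (@filterE _ (nbhs p)) => q /=.
    rewrite in_itv /= => /andP[q0 qq1].
    by rewrite (d_sumE hC hP hd Pp (Pga _ q0 qq1)).
  - rewrite near_withinE; apply: (@filterE _ (nbhs p)) => q /=.
    rewrite in_itv /= => /andP[q0 qq1] i.
    by rewrite (dterm_ge0 P hd) dom.
  - apply: (dterm_cvg hC hP hd); first exact: Pga.
    exact: Pga.
  - move=> i; have c0 := ci i.
    have cF : {within `[0, q1], continuous (fun q => F (theta i) (ga q))}.
      apply: (@within_comp _ (@disk R)) => //.
        by move=> q; rewrite /= in_itv /= => /andP[q0 qq1]; apply: PD; exact: Pga.
      apply: (fcoord_continuous_within hC c0); first by move=> y; exact: disk_cdisk.
      by move=> /disk_not_circle.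
    have p01 : `[0, q1]%classic p by rewrite /= in_itv /= p0.
    have /subspace_continuousP/(_ _ p01) cFp := cF.
    have l0 := lo_lt hC hP c0 Pp; have h0 := hi_gt hC hP c0 Pp.
    have c1 : ln (F (theta i) (ga q) - lo (theta i)) @[q --> within `[0, q1] (nbhs p)] -->
        ln (F (theta i) (ga p) - lo (theta i)).
      apply: continuous_cvg; first exact: continuous_ln.
      by apply: cvgB => //; exact: cvg_cst.
    have c2 : ln (hi (theta i) - F (theta i) (ga q)) @[q --> within `[0, q1] (nbhs p)] -->
        ln (hi (theta i) - F (theta i) (ga p)).
      apply: continuous_cvg; first exact: continuous_ln.
      by apply: cvgB => //; exact: cvg_cst.
    have c3 : ell (theta i) (ga q) @[q --> within `[0, q1] (nbhs p)] --> ell (theta i) (ga p).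
      exact: cvgB c1 c2.
    have c4 : `|ell (theta i) (ga p) - ell (theta i) (ga q)| @[q --> within `[0, q1] (nbhs p)] --> 0.
      have := cvg_norm (cvgB (cvg_cst (ell (theta i) (ga p))) c3).
      by rewrite subrr normr0; apply.
    have c5 : w i * `|ell (theta i) (ga p) - ell (theta i) (ga q)|
        @[q --> within `[0, q1] (nbhs p)] --> w i * 0 by exact: cvgMl_tmp.
    by rewrite mulr0 in c5.
have bound q : 0 <= q -> q <= q1 ->
    `|d (ga 0) (ga p) - d (ga 0) (ga q)| = `|0 - d (ga p) (ga q)|.
  move=> q0 qq1; have Pq := Pga _ q0 qq1; rewrite sub0r normrN.
  rewrite [RHS](ger0_norm (d_ge0 hC hP hd Pp Pq)); case/orP: (le_total p q) => pq.
    rewrite (add 0 p q) // opprD addrA subrr sub0r normrN ger0_norm //.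
    exact: (d_ge0 hC hP hd Pp Pq).
  rewrite (add 0 q p) // addrC addKr ger0_norm; last exact: (d_ge0 hC hP hd Pq Pp).
  by rewrite (d_sym hC hP hd Pq Pp).
apply: (@within_cvg_dist `[0, q1]%classic p (fun q => d (ga 0) (ga q)) (fun q => d (ga p) (ga q))).
  by move=> q; rewrite /= in_itv /= => /andP[q0 qq1]; exact: bound.
exact: key.
Qed.

(** Along the segment the distance from [x] is continuous, starts at 0 and is unbounded, so every
    [t >= 0] is attained. Additivity turns parametrization by this distance into an isometry. *)
Lemma ray_exists x v : P x -> boundary P v -> exists r : R -> R * R,
  [/\ isometric_on P d `[0, +oo[ r, r @` `[0, +oo[ = segment C x v `\ v
    & forall t, 0 <= t -> d x (r t) = t].
Proof.
move=> Px bv; have PD := polygon_disk hP; have [dv nPv] := polygon_boundary hP bv.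
have dx := PD _ Px; have xv := boundary_neq Px bv.
have [ga [cga [ga0 ga1] gaI iga btw]] := segment_param dx dv xv.
have in01 (q : R) : 0 <= q -> q <= 1 -> q \in `[0, 1] by move=> *; rewrite in_itv /=; apply/andP.
have gas q : 0 <= q -> q < 1 -> (segment C x v `\ v) (ga q).
  move=> q0 q1; split; first by rewrite -gaI; exists q => //; apply: in01 => //; exact: ltW.
  rewrite /= -ga1 => /(iga _ _ (in01 _ q0 (ltW q1)) (in01 _ ler01 (lexx _))) e.
  by rewrite e ltxx in q1.
have Pga q : 0 <= q -> q < 1 -> P (ga q) by move=> q0 q1; apply: (halfopen_sub Px bv); exact: gas.
have ci := theta_circle hd.
have add p q r : 0 <= p -> p <= q -> q <= r -> r < 1 ->
    d (ga p) (ga r) = d (ga p) (ga q) + d (ga q) (ga r).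
  move=> p0 pq qr r1; have q0 := le_trans p0 pq; have q1 := le_lt_trans qr r1.
  apply: (d_additive hC hP hd).
  - exact: Pga p0 (le_lt_trans pq q1).
  - exact: Pga q0 q1.
  - exact: Pga (le_trans q0 qr) r1.
  - by move=> i; apply: btw => //; exact: ltW.
have onto t : 0 <= t -> exists q, [/\ 0 <= q, q < 1 & d x (ga q) = t].
  move=> t0.
  have [q1 [q10 q11 hq1]] : exists q1, [/\ 0 <= q1, q1 < 1 & t <= d x (ga q1)].
    have i1 : `[0, 1]%classic (1 : R) by rewrite /= in_itv /= ler01 lexx.
    have /subspace_continuousP/(_ _ i1) cg1 := cga.
    (* The blow-up at [v] supplies a parameter [q1 < 1] at distance at least [t], and the
       intermediate value theorem is applied on [0, q1], inside [P]. *)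
    have nv : nbhs (ga 1) (fun y => P y -> t <= d x y) by rewrite ga1; exact: d_blowup.
    have [e /= e0 he] := (nbhs_ballP _ _).1 (cg1 _ nv).
    pose q1 := Num.max 0 (1 - e / 2).
    have q10 : 0 <= q1 by rewrite le_max lexx.
    have q11 : q1 < 1 by rewrite gt_max ltr01 /=; lra.
    have q1e : 1 - e / 2 <= q1 by rewrite le_max lexx orbT.
    exists q1; split=> //; apply: he.
    - by rewrite -ball_normE /= ger0_norm ?subr_ge0 ?ltW //; lra.
    - by apply: in01 => //; exact: ltW.
    - exact: Pga.
  have c1 : {within `[0, q1], continuous (fun q => d (ga 0) (ga q))}.
    apply: d_param_continuous => //.
    - apply: continuous_subspaceW cga => q /=; rewrite !in_itv /= => /andP[-> h].
      exact: le_trans h (ltW q11).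
    - by move=> q q0 qq1; apply: Pga => //; exact: le_lt_trans qq1 q11.
    - by move=> i p q r p0 pq qr r1; apply: btw => //; exact: le_trans r1 (ltW q11).
  have hb : Num.min (d (ga 0) (ga 0)) (d (ga 0) (ga q1)) <= t <=
      Num.max (d (ga 0) (ga 0)) (d (ga 0) (ga q1)).
    by rewrite ga0 (d_refl hC hP hd Px) ge_min le_max t0 hq1 orbT.
  have [q] := IVT q10 c1 hb; rewrite in_itv /= => /andP[q0 qq1] e.
  by exists q; split; [exact: q0|exact: le_lt_trans qq1 q11|rewrite -ga0; exact: e].
(* Made total in [t], with nothing claimed for negative [t], so that [choice] applies. *)
have onto' t : exists q, 0 <= t -> [/\ 0 <= q, q < 1 & d x (ga q) = t].
  have [t0|t0] := leP 0 t; last by exists 0.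
  by have [q hq] := onto t t0; exists q.
have [Q hQ] := choice onto'.
have dpq p q : 0 <= p -> p < 1 -> 0 <= q -> q < 1 ->
    d (ga p) (ga q) = `|d x (ga p) - d x (ga q)|.
  move=> p0 p1 q0 q1; have [Pp Pq] := (Pga _ p0 p1, Pga _ q0 q1).
  rewrite -ga0; case/orP: (le_total p q) => pq.
    rewrite (add 0 p q) // opprD addrA subrr sub0r normrN ger0_norm //.
    exact: (d_ge0 hC hP hd Pp Pq).
  rewrite (add 0 q p) // addrC addKr ger0_norm; last exact: (d_ge0 hC hP hd Pq Pp).
  exact: (d_sym hC hP hd Pp Pq).
exists (fun t => ga (Q t)); split.
- split=> [t|s t]; rewrite /= !in_itv /= ?andbT => t0.
    by have [q0 q1 _] := hQ _ t0; exact: Pga.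
  move=> s0; have [q0 q1 e] := hQ _ t0; have [p0 p1 e'] := hQ _ s0.
  by rewrite dpq // e e'.
- apply/seteqP; split=> z.
    move=> [t /=]; rewrite in_itv /= andbT => t0 <-.
    by have [q0 q1 _] := hQ _ t0; exact: gas.
  move=> [sz zv]; move: (sz); rewrite -gaI => -[q q01 eq].
  move: (q01); rewrite /= in_itv /= => /andP[q0 q1].
  have q1' : q < 1.
    by rewrite lt_neqAle q1 andbT; apply/eqP => e; apply: zv; rewrite /= -eq e.
  have Pq := Pga _ q0 q1'; have t0 := d_ge0 hC hP hd Px Pq.
  exists (d x (ga q)); first by rewrite /= in_itv /= t0.
  have [p0 p1 e] := hQ _ t0; rewrite -eq.
  apply: (d_eq0 hC hP hd (Pga _ p0 p1) Pq).
  by rewrite (dpq _ _ p0 p1 q0 q1') e subrr normr0.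
- by move=> t t0; have [] := hQ _ t0.
Qed.

(** Otherwise [P] would cut a proper nonempty relatively clopen subset out of [K]. *)
Lemma connected_boundary (K : set (R * R)) x y : connected K -> K x -> P x -> K y -> ~ P y ->
  exists2 z, K z & boundary P z.
Proof.
move=> nK Kx Px Ky nPy; apply: contrapT => nb.
have : K `&` P = K.
  apply: nK; first by exists x.
    by exists P => //; exact: (polygon_open hP).
  exists (closure P); first exact: closed_closure.
  apply/seteqP; split=> z [Kz hz]; split=> //; first exact: subset_closure.
  by have [//|bz] := polygon_closure hz; case: nb; exists z.
by move=> e; have [] : (K `&` P) y by rewrite e.
Qed.

Lemma between_trans p q r s : between p q r -> between p r s -> between p q s.
Proof.
rewrite /between => /orP[] /andP[h1 h2] /orP[] /andP[h3 h4]; apply/orP.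
- by left; rewrite h1 (le_trans h2 h4).
- by right; rewrite (le_trans h2 h4) (le_trans h3 (le_trans h4 h1)).
- by left; rewrite (le_trans h3 h1) (le_trans h2 (le_trans h3 h4)).
- by right; rewrite (le_trans h3 h1) h2.
Qed.

(** * Extending a segment beyond both ends *)

Section Line.
Variables (x z : R * R).
Hypotheses (Px : P x) (Pz : P z) (xz : x <> z).
Variables (g : R -> R * R) (a b s t : R).
Let c := curve_through C x z.
Hypotheses (hg : parametrizes c g a b) (sab : s \in `[a, b]) (tab : t \in `[a, b]).
Hypotheses (es : g s = x) (et : g t = z).

Let dx : disk x := polygon_disk hP Px.
Let dz : disk z := polygon_disk hP Pz.

Let Cc : C c. Proof. by case: (curve_throughP hC dx dz xz). Qed.

Let in_curve q : q \in `[a, b] -> c (g q).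
Proof. by move=> qab; exact: parametrizes_in hg qab. Qed.

Lemma segment_curve_param r y : r \in `[a, b] -> disk (g r) -> g r <> x ->
  segment C x (g r) y <-> exists q, [/\ q \in `[a, b], g q = y & between s q r].
Proof.
move=> rab dr rx; have cx : c x by rewrite -es; exact: in_curve.
have xr : x <> g r by exact/nesym.
have e := curve_through_eq hC Cc cx (in_curve rab) dx dr xr.
have [ph [cph nph]] := exists_off_curve hC Cc.
rewrite (segmentP hC dx dr xr cph) e //; split.
  have ec : c = g @` `[a, b] by case: hg.
  move=> [cy]; move: (cy); rewrite {1}ec => -[q qab eq] bq; exists q; split=> //.
  by move: bq; rewrite -es -eq (fcoord_between hC cph Cc nph hg).
move=> [q [qab <- bq]]; split; first exact: in_curve.
by rewrite -es (fcoord_between hC cph Cc nph hg).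
Qed.

(** The exit parameter [r] cannot lie between [s] and [t], as the segment between two points of [P]
    stays in [P]; in the given direction it therefore lies beyond [t]. *)
Lemma segment_extend r : r \in `[a, b] -> boundary P (g r) -> between s t r \/ between s r t ->
  segment C x z `<=` segment C x (g r) `\ g r.
Proof.
move=> rab br dir; have [dr nPr] := polygon_boundary hP br.
have rx : g r <> x by move=> e; apply: nPr; rewrite e.
have zx : g t <> x by rewrite et; exact/nesym.
have dt : disk (g t) by rewrite et.
have nbt : ~ between s r t.
  move=> h; apply: nPr; apply: (polygon_convex hP Px Pz).
  by rewrite -et; apply/(segment_curve_param (g r) tab dt zx); exists r.
have str : between s t r by case: dir.
move=> y; rewrite -et => /(segment_curve_param y tab dt zx)[q [qab <- bq]]; split.
  apply/(segment_curve_param (g q) rab dr rx); exists q; split=> //.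
  exact: between_trans bq str.
move=> /= e; apply: nbt; have ig : {in `[a, b] &, injective g} by case: hg.
by rewrite -(ig _ _ qab rab e).
Qed.

(** The parameters of [y0] and [y1] lie on either side of that of [x], so every base point sees [x]
    between them. *)
Lemma d_opposite r0 r1 y0 y1 : r0 \in `[a, b] -> r1 \in `[a, b] -> r0 <= s -> s <= r1 ->
  boundary P (g r0) -> boundary P (g r1) ->
  (segment C x (g r0) `\ g r0) y0 -> (segment C x (g r1) `\ g r1) y1 ->
  d y0 y1 = d x y0 + d x y1.
Proof.
move=> r0ab r1ab r0s sr1 b0 b1 h0 h1.
have Py0 := halfopen_sub Px b0 h0; have Py1 := halfopen_sub Px b1 h1.
have [d0 nP0] := polygon_boundary hP b0; have [d1 nP1] := polygon_boundary hP b1.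
have n0 : g r0 <> x by move=> e; apply: nP0; rewrite e.
have n1 : g r1 <> x by move=> e; apply: nP1; rewrite e.
case: h0 => /(segment_curve_param y0 r0ab d0 n0)[q0 [q0ab e0 bt0]] _.
case: h1 => /(segment_curve_param y1 r1ab d1 n1)[q1 [q1ab e1 bt1]] _.
have q0s : q0 <= s.
  by case/orP: bt0 => /andP[h1 h2] //; exact: le_trans h2 r0s.
have q1s : s <= q1.
  by case/orP: bt1 => /andP[h1 h2] //; exact: le_trans sr1 h1.
rewrite (d_sym hC hP hd Px Py0).
apply: (d_additive hC hP hd) => // i; have ci := theta_circle hd i.
have cx : c x by rewrite -es; exact: in_curve.
have cy0 : c y0 by rewrite -e0; exact: in_curve.
have cy1 : c y1 by rewrite -e1; exact: in_curve.
have [cc|nc] := pselect (c (theta i)); last first.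
  rewrite -e0 -e1 -es (fcoord_between hC ci Cc nc hg) //.
  by rewrite /between q0s q1s.
have nth y : P y -> y <> theta i.
  by move=> Py; apply: disk_neq_circle => //; exact: (polygon_disk hP).
rewrite (fcoord_const hC ci Cc cc cy0 cx (nth _ Py0) (nth _ Px)).
rewrite (fcoord_const hC ci Cc cc cy1 cx (nth _ Py1) (nth _ Px)).
by rewrite /between !lexx.
Qed.

(** Both ends of the curve are on the circle, outside [P], so each of the two subarcs from [x] to an
    end meets the boundary. *)
Lemma exit_points : exists r0 r1,
  [/\ r0 \in `[a, b], r1 \in `[a, b], r0 <= s, s <= r1 & boundary P (g r0) /\ boundary P (g r1)].
Proof.
case: (hg) => ab cg _ [ca cb _] _.
move: (sab); rewrite in_itv /= => /andP[as_ sb].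
have nP y : circle y -> ~ P y by move=> cy /(polygon_disk hP) /disk_not_circle.
have [_ n1] := subarc_compact_connected cg as_ (lexx b).
have [_ n0] := subarc_compact_connected cg (lexx a) sb.
have k1 : (g @` `[s, b]) x by exists s => //; rewrite /= in_itv /= lexx.
have k2 : (g @` `[s, b]) (g b) by exists b => //; rewrite /= in_itv /= sb lexx.
have k3 : (g @` `[a, s]) x by exists s => //; rewrite /= in_itv /= as_ lexx.
have k4 : (g @` `[a, s]) (g a) by exists a => //; rewrite /= in_itv /= lexx.
have [_ [r1 h1 <-] b1] := connected_boundary n1 k1 Px k2 (nP _ cb).
have [_ [r0 h0 <-] b0] := connected_boundary n0 k3 Px k4 (nP _ ca).
move: h1 h0; rewrite /= !in_itv /= => /andP[h1 h2] /andP[h3 h4].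
exists r0, r1; rewrite !in_itv /=; split=> //.
  by rewrite h3 (le_trans h4 sb).
by rewrite h2 (le_trans as_ h1).
Qed.

(** The two geodesic rays from [x] along the curve, in opposite directions, are glued at [x];
    [d_opposite] gives the distances across the joint. *)
Lemma line_through : exists l : R -> R * R,
  isometric_on P d setT l /\ segment C x z `<=` range l.
Proof.
have [r0 [r1 [r0ab r1ab r0s sr1 [b0 b1]]]] := exit_points.
have [f0 [[Pf0 if0] im0 df0]] := ray_exists Px b0.
have [f1 [[Pf1 if1] im1 df1]] := ray_exists Px b1.
have ge0 q : 0 <= q -> `[0, +oo[%classic q by move=> h; rewrite /= in_itv /= h.
have opp q q' : 0 <= q -> 0 <= q' -> d (f0 q) (f1 q') = q + q'.
  move=> h h'; rewrite -{2}(df0 q h) -{2}(df1 q' h').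
  apply: (d_opposite r0ab r1ab r0s sr1 b0 b1).
    by rewrite -im0; exists q => //; exact: ge0.
  by rewrite -im1; exists q' => //; exact: ge0.
have f00 : f0 0 = f1 0.
  have [h0 h1] := (Pf0 _ (ge0 _ (lexx 0)), Pf1 _ (ge0 _ (lexx 0))).
  by apply: (d_eq0 hC hP hd h0 h1); rewrite opp // addr0.
exists (fun q => if 0 <= q then f1 q else f0 (- q)); split.
  split=> [q _|q q' _ _].
    by case: (leP 0 q) => h; [apply/Pf1/ge0|apply/Pf0/ge0; rewrite oppr_ge0 ltW].
  case: (leP 0 q) => h; case: (leP 0 q') => h'.
  - by apply: if1; exact: ge0.
  - have nq' : 0 <= - q' by rewrite oppr_ge0 ltW.
    rewrite (d_sym hC hP hd (Pf1 _ (ge0 _ h)) (Pf0 _ (ge0 _ nq'))) opp //.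
    by rewrite addrC ger0_norm // addr_ge0.
  - have nq : 0 <= - q by rewrite oppr_ge0 ltW.
    by rewrite opp // distrC ger0_norm ?addr_ge0 // addrC.
  - have nq : 0 <= - q by rewrite oppr_ge0 ltW.
    have nq' : 0 <= - q' by rewrite oppr_ge0 ltW.
    by rewrite if0; [rewrite opprK addrC distrC -normrN opprB distrC|exact: ge0|exact: ge0].
(* The segment towards [z] is covered by the ray on the side of [x] where [z] lies. *)
have [st|ts] := leP s t.
  have dir : between s t r1 \/ between s r1 t.
    by rewrite /between st sr1 /=; case/orP: (le_total t r1) => ->; [left|right].
  move=> y /(segment_extend r1ab b1 dir); rewrite -im1 => -[q /=].
  by rewrite in_itv /= andbT => h <-; exists q => //; rewrite h.
have dir : between s t r0 \/ between s r0 t.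
  by rewrite /between (ltW ts) r0s !andbT; case/orP: (le_total t r0) => ->; [right|left]; rewrite orbT.
move=> y /(segment_extend r0ab b0 dir); rewrite -im0 => -[q /=].
rewrite in_itv /= andbT le_eqVlt => /orP[/eqP <- <-|h <-].
  by exists 0 => //; rewrite lexx f00.
by exists (- q) => //; rewrite oppr_ge0 leNgt h /= opprK.
Qed.

End Line.

Lemma line_exists x z : P x -> P z -> x <> z -> exists l : R -> R * R,
  isometric_on P d setT l /\ segment C x z `<=` range l.
Proof.
move=> Px Pz xz; have dx := polygon_disk hP Px; have dz := polygon_disk hP Pz.
have [Cc cx cz] := curve_throughP hC dx dz xz.
have [g [a [b hg]]] := family_curve hC Cc.
have ec : curve_through C x z = g @` `[a, b] by case: hg.
have [s sab es] : exists2 s, s \in `[a, b] & g s = x by move: cx; rewrite {1}ec.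
have [t tab et] : exists2 t, t \in `[a, b] & g t = z by move: cz; rewrite {1}ec.
exact: (line_through Px Pz xz hg sab tab es et).
Qed.

(** Every point of a geodesic segment realizes equality in the triangle inequality with the two
    ends, hence lies on the segment of a curve between them, and [line_exists] extends that
    segment. *)
Lemma d_geodesically_complete : geodesically_complete P d.
Proof.
move=> a b g ab [Pg ig].
have ia : `[a, b]%classic a by rewrite /= in_itv /= lexx.
have ib : `[a, b]%classic b by rewrite /= in_itv /= lexx andbT.
have Pa := Pg _ ia; have Pb := Pg _ ib.
have [e|/eqP ne] := eqVneq (g a) (g b).
  have eab : a = b.
    apply/eqP; rewrite -subr_eq0 -normr_eq0 -(ig _ _ ia ib) -e.
    by rewrite (d_refl hC hP hd Pa).
  (* The geodesic is a single point here; any other point [y] of [P] provides a line through it. *)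
  have [[y Py hy] _] := open_extends hC (polygon_open hP) (polygon_disk hP) Pa (theta_circle hd 0%N).
  have ay : g a <> y by move=> h; rewrite h ltxx in hy.
  have [l [il sl]] := line_exists Pa Py ay; exists l; split=> // y0 [u /=].
  rewrite in_itv /= -eab => /andP[h1 h2] <-.
  have -> : u = a by apply/eqP; rewrite eq_le h1 h2.
  by apply: sl; have [] := segment_ends hC (polygon_disk hP Pa) (polygon_disk hP Py) ay.
have [l [il sl]] := line_exists Pa Pb ne; exists l; split=> // _ [u uab <-].
apply: sl; have Pu := Pg _ uab; apply: (between_segment hC hP hd) => //.
apply: (d_additive_between hC hP hd) => //.
rewrite (ig _ _ ia ib) (ig _ _ ia uab) (ig _ _ uab ib).
move: uab; rewrite /= in_itv /= => /andP[h1 h2].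
by rewrite !ler0_norm ?subr_le0 //; ring.
Qed.

End Rays.

Theorem lemma9 (R : realType) (C : set (set (R * R))) (P : set (R * R))
    (sides : seq ((R * R) * (R * R))) (theta : nat -> R * R) (w : nat -> R)
    (hC : curve_family C) (hP : convex_polygon C P sides)
    (hd : metric_data C sides theta w) :
  (forall x v : R * R, P x -> boundary P v ->
     (forall y : nat -> R * R,
        (forall n, (segment C x v `\ v) (y n)) ->
        y n @[n --> \oo] --> v ->
        d_sum C P theta w x (y n) @[n --> \oo] --> +oo) /\
     (exists r : R -> R * R,
        isometric_on P (d_sum C P theta w) `[0, +oo[ r /\
        r @` `[0, +oo[ = segment C x v `\ v)) /\
  metric_on P (d_sum C P theta w) /\
  geodesically_complete P (d_sum C P theta w).
Proof.
refine (conj _ (conj (d_metric hC hP hd) (d_geodesically_complete hC hP hd))).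
move=> x v Px bv; split.
  move=> y hy; apply: (d_blowup_cvg hC hP hd Px bv) => n.
  exact: (halfopen_sub hC hP Px bv (hy n)).
by have [r [h1 h2 _]] := ray_exists hC hP hd Px bv; exists r.
Qed.
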